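(* Let $\Sigma(A,B,C,\mathbf{G})$ be a Riesz-spectral system (with scalar input and output, $U=Y=\mathbb{C}$) such that all eigenvalues $\lambda_n$, $n\in\mathbb{N}$, of $A$ lie in the open left half-plane. Assume further that the coefficient sequences $(b_n)_{n\in\mathbb{N}}$ and $(c_n)_{n\in\mathbb{N}}$ of $B$ and $C$ satisfy $$\sum_{k\in\mathbb{N}}\left|\frac{b_k\,\overline{c_k}}{\operatorname{Re}\lambda_k}\right|<\infty.$$ Then $\Sigma(A,B,C,\mathbf{G})$ is $L^\infty$-BIBO stable.
   Context: All Banach spaces are complex. $\mathbb{C}_\alpha=\{z\in\mathbb{C}:\operatorname{Re}z>\alpha\}$. For the generator $A$ of a strongly continuous semigroup $\mathbb{T}=(\mathbb{T}(t))_{t\ge0}$ on a Banach space $X$, $\omega(\mathbb{T})=\inf\{\omega\in\mathbb{R}:\sup_{t>0}e^{-t\omega}\|\mathbb{T}(t)\|<\infty\}$ is its growth bound. $X_1$ is $D(A)$ with norm $\|(\beta I-A)x\|_X$ and $X_{-1}$ is the completion of $X$ with respect to $\|(\beta I-A)^{-1}x\|_X$, for a fixed $\beta\in\rho(A)$. The semigroup extends uniquely to a strongly continuous semigroup on $X_{-1}$ whose generator $X\to X_{-1}$ extends $A$; the extensions are again denoted $\mathbb{T}$ and $A$. System node: for Banach spaces $U,X,Y$, a system node on $(U,X,Y)$ is a collection $\Sigma(A,B,C,\mathbf{G})$ where $A:D(A)\subset X\to X$ generates a strongly continuous semigroup $\mathbb{T}$ on $X$, $B\in\mathcal{L}(U,X_{-1})$,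 $C\in\mathcal{L}(X_1,Y)$, and $\mathbf{G}:\mathbb{C}_{\omega(\mathbb{T})}\to\mathcal{L}(U,Y)$ is analytic with $\mathbf{G}(\alpha)-\mathbf{G}(\beta)=C[(\alpha I-A)^{-1}-(\beta I-A)^{-1}]B$ for all $\alpha,\beta\in\mathbb{C}_{\omega(\mathbb{T})}$. Combined observation/feedthrough operator: $C\&D\begin{bmatrix}x\\ u\end{bmatrix}=C[x-(\beta I-A)^{-1}Bu]+\mathbf{G}(\beta)u$ with $\beta\in\mathbb{C}_{\omega(\mathbb{T})}$ (independent of the choice of $\beta$) and domain $D(C\&D)=\{\begin{bmatrix}x\\ u\end{bmatrix}\in X\times U: Ax+Bu\in X\}$. Generalised solution in the distributional sense: a triple $(u,x,y)$ with $u\in L^1_{\mathrm{loc}}([0,\infty),U)$, $x\in C([0,\infty),X_{-1})$, $x(t)=\mathbb{T}(t)x_0+\int_0^t\mathbb{T}(t-s)Bu(s)\,\mathrm{d}s$ for some $x_0\in X$ and all $t\ge0$, and $y$ the $Y$-valued distribution (linear functional on $C_c^\infty([0,\infty),Y')$) acting by $y(\varphi)=\int_0^\infty\left\langle\varphi''(t),(C\&D)\int_0^t(t-s)\begin{bmatrix}x(s)\\ u(s)\end{bmatrix}\mathrm{d}s\right\rangle_{Y',Y}\mathrm{d}t$. A function $y\in L^1_{\mathrm{loc}}([0,\infty),Y)$ is identified with the distribution $\varphi\mapsto\int_0^\infty\langle\varphi(t),y(t)\rangle_{Y',Y}\,\mathrm{d}t$. $L^\infty$-BIBO stability: there exists $c>0$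 such that for any generalised solution in the distributional sense $(u,x,y)$ with $u\in L^\infty_{\mathrm{loc}}([0,\infty),U)$ and $x(0)=0$ one has $y\in L^\infty_{\mathrm{loc}}([0,\infty),Y)$ and $\|y\|_{L^\infty([0,t],Y)}\le c\|u\|_{L^\infty([0,t],U)}$ for all $t>0$. Riesz-spectral system: a system node $\Sigma(A,B,C,\mathbf{G})$ with $U=Y=\mathbb{C}$ on a Hilbert space $X$ such that there is a Riesz basis $\{\phi_n\}_{n\in\mathbb{N}}$ of $X$ with each $\phi_n$ an eigenvector of $A$, with eigenvalue $\lambda_n$. $\{\psi_n\}_{n\in\mathbb{N}}$ denotes the biorthogonal sequence, $\langle\phi_n,\psi_m\rangle=\delta_{n,m}$. The coefficient sequences are $b_n=\langle B1,\psi_n\rangle$ (duality pairing of $X_{-1}$ with $D(A^* )$, extending the inner product of $X$) and $c_n=C\phi_n$. *)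

(* Defs.v *)
From HB Require Import structures.
From mathcomp Require Import all_boot all_order all_algebra sesquilinear.
From mathcomp Require Import complex.
From mathcomp Require Import all_classical all_reals all_analysis ess_sup_inf.

Set Implicit Arguments.
Unset Strict Implicit.
Unset Printing Implicit Defensive.

Import Order.TTheory GRing.Theory Num.Theory.
Import numFieldNormedType.Exports.

Local Open Scope classical_set_scope.
Local Open Scope ring_scope.
Local Open Scope complex_scope.

(* The complex numbers as a Banach space over themselves.  An alias is needed:
   the library registers completeness of [K^o] only for [K : realType], which
   shadows any instance on [R[i]^o]. *)
Definition CC (R : realType) : Type := R[i]^o.
HB.instance Definition _ (R : realType) := NormedModule.copy (CC R) R[i]^o.

Lemma ler_normC (R : realType) (z : R[i]) :
  `|z| <= (`|complex.Re z| + `|complex.Im z|)%:C.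
Proof.
rewrite normc_def lecR -[leRHS]ger0_norm ?addr_ge0// -sqrtr_sqr ler_sqrt ?sqr_ge0//.
by rewrite sqrrD !real_normK ?num_real// addrAC lerDl mulrn_wge0// mulr_ge0.
Qed.

Lemma normC_ge_Im (R : realType) (z : R[i]) : `|complex.Im z|%:C <= `|z|.
Proof.
rewrite normc_def lecR -sqrtr_sqr ler_sqrt ?addr_ge0 ?sqr_ge0//.
by rewrite lerDr sqr_ge0.
Qed.

Lemma CC_complete (R : realType) (F : set_system (CC R)) :
  ProperFilter F -> cauchy F -> cvg F.
Proof.
move=> FF /cauchy_ballP Fc.
have part (p : CC R -> R) : (forall x y, `|p x - p y|%:C <= `|x - y|) ->
    cvg (p @ F).
  move=> ple; apply: R_complete; apply/cauchy_ballP => e e0.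
  have e0' : 0 < e%:C by rewrite ltcR.
  have [[A B] /= [FA FB] AB] := Fc _ e0'.
  exists (p @` A, p @` B) => /=.
    split; [apply: filterS FA|apply: filterS FB] => z Az /=; exists z => //.
  move=> [_ _] /= [[x Ax <-] [y By <-]].
  have /= := AB (x, y) (conj Ax By).
  by rewrite -!ball_normE /= => /(le_lt_trans (ple _ _)); rewrite ltcR.
have cRe : cvg ((fun z : CC R => complex.Re z) @ F).
  by apply: part => x y; rewrite -raddfB normc_ge_Re.
have cIm : cvg ((fun z : CC R => complex.Im z) @ F).
  by apply: part => x y; rewrite -raddfB normC_ge_Im.
have /cvgrPdist_lt {}cRe := cRe; have /cvgrPdist_lt {}cIm := cIm.
move: cRe cIm; set a := lim _; set b := lim _ => cRe cIm.
apply/cvg_ex; exists (a +i* b : CC R); apply/cvgrPdist_lt => e e0.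
have eE : e = (complex.Re e)%:C.
  by apply/eqP; rewrite eq_complex /= eqxx /= -(ger0_Im (ltW e0)).
have r0 : 0 < complex.Re e / 2 by rewrite divr_gt0// -ltcR -eE.
have H1 := cRe _ r0; have H2 := cIm _ r0.
near=> z; apply: (le_lt_trans (@ler_normC R _)).
rewrite eE ltcR [ltRHS]splitr raddfB/= raddfB/= ltrD//.
  by near: z.
by near: z.
Unshelve. all: by end_near. Qed.

HB.instance Definition _ (R : realType) :=
  Uniform_isComplete.Build (CC R) (@CC_complete R).

Section BoundedOperators.
Context {R : realType}.

(* Over [R[i]] the library's norm takes its (real) values in [R[i]]. *)
Definition rnorm {V : normedModType R[i]} (v : V) : R := complex.Re `|v|.

Definition opnorm {U V : normedModType R[i]} (f : U -> V) : \bar R :=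
  ereal_sup [set (rnorm (f u))%:E | u in [set u | rnorm u <= 1]].

Definition bounded_op {U V : normedModType R[i]} (f : U -> V) : Prop :=
  linear f /\ (opnorm f < +oo)%E.

Definition op_cvg {T : Type} {U V : normedModType R[i]} (F : set_system T)
    (f : T -> U -> V) (L : U -> V) : Prop :=
  opnorm (fun u => f s u - L u) @[s --> F] --> 0%E.

End BoundedOperators.

(* Bochner integration of vector-valued functions on subsets of the real line,
   for Lebesgue measure on the Borel sets.  As for the library's scalar
   integral, functions are Borel measurable representatives of their classes
   modulo null sets. *)
Section Bochner.
Context {R : realType} {V : normedModType R[i]}.
Let mu := @lebesgue_measure R.

Record simple_fun (D : set R) := SimpleFun {
  sf_size : nat;
  sf_set : 'I_sf_size -> set R;
  sf_val : 'I_sf_size -> V;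
  sf_measurable : forall i, measurable (sf_set i);
  sf_sub : forall i, sf_set i `<=` D;
  sf_finite : forall i, (mu (sf_set i) < +oo)%E }.

Arguments sf_set {D} s i : rename.
Arguments sf_val {D} s i : rename.

Definition sf_fun D (s : simple_fun D) (t : R) : V :=
  \sum_(i < sf_size s) (\1_(sf_set s i) t)%:C *: sf_val s i.

Definition sf_int D (s : simple_fun D) : V :=
  \sum_(i < sf_size s) (fine (mu (sf_set s i)))%:C *: sf_val s i.

Definition strongly_measurable (D : set R) (f : R -> V) : Prop :=
  exists s : nat -> simple_fun D,
    forall t, D t -> sf_fun (s n) t @[n --> \oo] --> f t.

Definition is_bochner (D : set R) (f : R -> V) (v : V) : Prop :=
  exists s : nat -> simple_fun D,
  [/\ forall t, D t -> sf_fun (s n) t @[n --> \oo] --> f t,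
      (\int[mu]_(t in D) (rnorm (f t - sf_fun (s n) t))%:E)%E
        @[n --> \oo] --> 0%E
    & sf_int (s n) @[n --> \oo] --> v].

Definition bochner_integrable (D : set R) (f : R -> V) : Prop :=
  exists v, is_bochner D f v.

Definition bochner (D : set R) (f : R -> V) : V := xget 0 (is_bochner D f).

Definition L1_loc (f : R -> V) : Prop :=
  forall t : R, 0 < t -> bochner_integrable `[0, t] f.

Definition Linfty_norm (t : R) (f : R -> V) : \bar R :=
  ess_sup mu (fun s => (\1_(`[0, t]%classic) s * rnorm (f s))%:E).

Definition Linfty_loc (f : R -> V) : Prop :=
  forall t : R, 0 < t ->
    strongly_measurable `[0, t] f /\ (Linfty_norm t f < +oo)%E.

End Bochner.

Section Semigroups.
Context {R : realType}.

(* Only the values at [t >= 0] are meaningful. *)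
Record c0_semigroup (X : normedModType R[i]) := C0Semigroup {
  sg :> R -> X -> X;
  sg_bounded : forall t : R, 0 <= t -> bounded_op (sg t);
  sg0 : forall x, sg 0 x = x;
  sgD : forall s t : R, 0 <= s -> 0 <= t ->
    forall x, sg (s + t) x = sg s (sg t x);
  sg_continuous : forall x, sg t x @[t --> 0^'+] --> x }.

Definition growth_sup {X : normedModType R[i]} (T : c0_semigroup X) (w : R) :
    \bar R :=
  ereal_sup [set ((expR (- (t * w))%R)%:E * opnorm (T t))%E
                | t in [set t : R | 0 < t]].

Definition growth_bound {X : normedModType R[i]} (T : c0_semigroup X) : \bar R :=
  ereal_inf [set w%:E | w in [set w : R | (growth_sup T w < +oo)%E]].

(* The open half-plane to the right of the growth bound (the whole plane when
   the growth bound is [-oo]). *)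
Definition growth_half_plane {X : normedModType R[i]} (T : c0_semigroup X) :
    set R[i] :=
  [set z | (growth_bound T < (complex.Re z)%:E)%E].

(* [G] is the graph of the generator of [T]. *)
Definition is_generator {X : normedModType R[i]} (T : c0_semigroup X)
    (G : set (X * X)) : Prop :=
  forall x v, G (x, v) <-> (h^-1)%:C *: (T h x - x) @[h --> 0^'+] --> v.

(* An unbounded operator is a total function [A] of which only the values on
   the domain [D] are used. *)
Definition op_graph {X : Type} (D : set X) (A : X -> X) : set (X * X) :=
  [set p | D p.1 /\ A p.1 = p.2].

Definition resolvent {X : normedModType R[i]} (D : set X) (A : X -> X)
    (z : R[i]) (x : X) : X :=
  xget 0 [set v | D v /\ z *: v - A v = x].

(* The resolvent of an extension [A1 : X -> W] of an operator on [X], where [X]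
   is embedded in [W] by [j]. *)
Definition ext_resolvent {X W : normedModType R[i]} (j A1 : X -> W) (z : R[i])
    (w : W) : X :=
  xget 0 [set x | z *: j x - A1 x = w].

Definition resolvent_set {X : normedModType R[i]} (D : set X) (A : X -> X) :
    set R[i] :=
  [set z | (forall x, exists! v, D v /\ z *: v - A v = x) /\
           bounded_op (resolvent D A z)].

End Semigroups.

Section SystemNodes.
Context {R : realType}.

(* The extrapolation space is represented by its universal description: a
   Banach space [sn_X1n] with a linear embedding [sn_emb] of [X] of dense range
   which is isometric for the norm |(beta - A)^-1 x| on [X].  [sn_T1n] and
   [sn_A1n : X -> sn_X1n] are the extensions of the semigroup and of [A]. *)
Record system_node (U X Y : completeNormedModType R[i]) := SystemNode {
  sn_T : c0_semigroup X;
  sn_dom : set X;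
  sn_A : X -> X;
  sn_gen : is_generator sn_T (op_graph sn_dom sn_A);

  sn_beta : R[i];
  sn_beta_res : resolvent_set sn_dom sn_A sn_beta;
  sn_X1n : completeNormedModType R[i];
  sn_emb : X -> sn_X1n;
  sn_emb_linear : linear sn_emb;
  sn_emb_norm : forall x,
    rnorm (sn_emb x) = rnorm (resolvent sn_dom sn_A sn_beta x);
  sn_emb_dense : closure (range sn_emb) = setT;
  sn_T1n : c0_semigroup sn_X1n;
  sn_T1n_ext : forall t : R, 0 <= t ->
    forall x, sn_T1n t (sn_emb x) = sn_emb (sn_T t x);
  sn_A1n : X -> sn_X1n;
  sn_A1n_gen : is_generator sn_T1n [set (sn_emb x, sn_A1n x) | x in setT];
  sn_A1n_ext : forall x, sn_dom x -> sn_A1n x = sn_emb (sn_A x);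

  sn_B : U -> sn_X1n;
  sn_B_bounded : bounded_op sn_B;

  (* Only the values on [sn_dom] are used; boundedness is for the graph norm
     |(beta - A) x|. *)
  sn_C : X -> Y;
  sn_C_linear : forall (a : R[i]) x y, sn_dom x -> sn_dom y ->
    sn_C (a *: x + y) = a *: sn_C x + sn_C y;
  sn_C_bounded : exists M : R, forall x, sn_dom x ->
    rnorm (sn_C x) <= M * rnorm (sn_beta *: x - sn_A x);

  (* Only the values on [growth_half_plane sn_T] are used. *)
  sn_G : R[i] -> U -> Y;
  sn_G_bounded : forall z, growth_half_plane sn_T z -> bounded_op (sn_G z);
  sn_G_analytic : forall z : CC R, growth_half_plane sn_T z ->
    exists2 L : U -> Y, bounded_op L &
      op_cvg z^' (fun (w : CC R) u => (w - z : R[i])^-1 *: (sn_G w u - sn_G z u)) L;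
  sn_G_diff : forall z w,
    growth_half_plane sn_T z -> growth_half_plane sn_T w ->
    forall u, sn_G z u - sn_G w u =
      sn_C (ext_resolvent sn_emb sn_A1n z (sn_B u)
            - ext_resolvent sn_emb sn_A1n w (sn_B u)) }.

Section Node.
Context {U X Y : completeNormedModType R[i]} (S : system_node U X Y).

Definition CD_dom (x : X) (u : U) : Prop :=
  range (@sn_emb _ _ _ S) (sn_A1n S x + sn_B S u).

(* Meaningful on [CD_dom], where the value does not depend on the choice of
   the point [z] of the half-plane. *)
Definition CD (x : X) (u : U) : Y :=
  let z := xget 0 (growth_half_plane (sn_T S)) in
  sn_C S (x - ext_resolvent (sn_emb S) (sn_A1n S) z (sn_B S u)) + sn_G S z u.

(* The element of [X] which an element of the extrapolation space stands for. *)
Definition of_X1n (w : sn_X1n S) : X := xget 0 [set x | sn_emb S x = w].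

(* A test function in C_c^oo([0,oo), Y'), given with all its derivatives
   [tf k] (one-sided at 0, in the norm of Y'); only [t >= 0] is meaningful.
   Elements of the dual Y' are bounded functionals on Y. *)
Record test_function := TestFunction {
  tf : nat -> R -> Y -> CC R;
  tf_dual : forall k (t : R), 0 <= t -> bounded_op (tf k t);
  tf_deriv : forall k (t : R), 0 <= t ->
    op_cvg (within `[0, +oo[ t^')
      (fun s y => ((s - t)^-1)%:C *: (tf k s y - tf k t y)) (tf k.+1 t);
  tf_support : exists M : R, forall t : R, 0 <= t -> M < t ->
    forall y, tf 0 t y = 0 }.

Definition regular_distribution (f : R -> Y) (phi : test_function) : CC R :=
  bochner `[0, +oo[ (fun t => tf phi 0 t (f t)).

(* [y] is determined by [u] and [x], and is linear by its formula. *)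
Definition generalised_solution (u : R -> U) (x : R -> sn_X1n S)
    (y : test_function -> CC R) : Prop :=
  [/\ L1_loc u,
      {within `[0, +oo[%classic, continuous x},
      exists x0 : X, forall t : R, 0 <= t ->
        x t = sn_T1n S t (sn_emb S x0)
              + bochner `[0, t] (fun s => sn_T1n S (t - s) (sn_B S (u s)))
    & forall phi, y phi = bochner `[0, +oo[ (fun t => tf phi 2 t
        (CD (of_X1n (bochner `[0, t] (fun s => (t - s)%:C *: x s)))
            (bochner `[0, t] (fun s => (t - s)%:C *: u s))))].

Definition Linfty_BIBO_stable : Prop :=
  exists2 c : R, 0 < c &
    forall u x y, generalised_solution u x y -> Linfty_loc u -> x 0 = 0 ->
      exists f : R -> Y,
        [/\ Linfty_loc f,
            forall phi, y phi = regular_distribution f phi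
          & forall t : R, 0 < t -> (Linfty_norm t f <= c%:E * Linfty_norm t u)%E].

End Node.

End SystemNodes.

Section RieszSpectral.
Context {R : realType} {X : completeNormedModType R[i]}.

(* Inner products are linear in the first argument. *)
Definition is_hilbert (ip : {dot X for Num.conj}) : Prop :=
  forall x : X, ip x x = `|x| ^+ 2.

Definition riesz_basis (phi : nat -> X) : Prop :=
  closure [set x | exists n (a : nat -> R[i]), x = \sum_(i < n) a i *: phi i]
    = setT /\
  exists m M : R, [/\ 0 < m, 0 < M &
    forall n (a : nat -> R[i]),
      m * (\sum_(i < n) rnorm (a i : CC R) ^+ 2)
        <= rnorm (\sum_(i < n) a i *: phi i) ^+ 2
        <= M * (\sum_(i < n) rnorm (a i : CC R) ^+ 2)].

Definition biorthogonal (ip : {dot X for Num.conj}) (phi psi : nat -> X) :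
    Prop :=
  forall n m, ip (phi n) (psi m) = (n == m)%:R.

Context (S : system_node (CC R) X (CC R)).

Definition riesz_spectral (phi : nat -> X) (lambda : nat -> R[i]) : Prop :=
  riesz_basis phi /\
  forall n, [/\ phi n != 0, sn_dom S (phi n)
              & sn_A S (phi n) = lambda n *: phi n].

(* The pairing <w, psi> of [w] in the extrapolation space with [psi] in D(A^* ):
   the value at [w] of the continuous extension of x |-> <x, psi>, which exists
   exactly for [psi] in D(A^* ). *)
Definition extrapolation_pairing (ip : {dot X for Num.conj})
    (w : sn_X1n S) (psi : X) : CC R :=
  xget 0 [set b | exists F : sn_X1n S -> CC R,
    [/\ bounded_op F, forall x, F (sn_emb S x) = ip x psi & F w = b]].

Definition coef_b (ip : {dot X for Num.conj}) (psi : nat -> X) (n : nat) :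
    R[i] :=
  extrapolation_pairing ip (sn_B S (1 : R[i])) (psi n).

Definition coef_c (phi : nat -> X) (n : nat) : R[i] := sn_C S (phi n).

End RieszSpectral.

(* Main.v *)
Require Import Defs.
From HB Require Import structures.
From mathcomp Require Import all_boot all_order all_algebra sesquilinear.
From mathcomp Require Import complex ring lra.
From mathcomp Require Import all_classical all_reals all_analysis ess_sup_inf measurable_realfun.

Set Implicit Arguments.
Unset Strict Implicit.
Unset Printing Implicit Defensive.

Import Order.TTheory GRing.Theory Num.Theory.
Import numFieldNormedType.Exports.

Local Open Scope classical_set_scope.
Local Open Scope ring_scope.
Local Open Scope complex_scope.

(** In the coordinates of the Riesz basis the node decouples into scalar modes.
    The semigroup acts on the [k]-th coordinate by the exponential of [lambda k],
    so a state that starts at 0 has the coordinates [b k] times [f k], where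
    [f k] is the convolution of [u] with that exponential.  Formally the output
    is the series of the [c k * b k * f k] plus a multiple of [u].  On the
    interval from 0 to [t] the mode [f k] is bounded by the essential bound of [u]
    divided by [- Re (lambda k)] (expc_le_Re), so the hypothesis on the
    coefficients makes the series converge uniformly, with sum at most the sum of
    the hypothesis times the bound of [u].  This is the stability estimate.

    What has to be shown is that this formal output is the distributional output.
    The latter is the second derivative of the combined operator applied to the
    state and input weighted by [t - s], that is, to their doubly iterated
    primitives.  Integrating the equation of a mode gains one power of its
    resolvent uniformly in [k] (mode_double_gain, mode_single_gain), whereas
    [b k] divided by [beta - lambda k] is square summable, being the coordinate
    sequence of the resolvent applied to [B 1].  By the Riesz-Fischer property
    (riesz_fischer, weighted_coordinates) the doubly integrated state therefore
    lies in [X], and it lies in the domain of [A] once the stationary response to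
    the integrated input is subtracted (integrated_state).  There the observation
    operator, being bounded after the resolvent, acts term by term (CD_series).
    The result is the doubly iterated primitive of the formal output
    (integrated_output); the multiple of [u] is the transfer function at one point
    of the half-plane minus the sum of [c k * b k] divided by the difference of that
    point and [lambda k], which converges because the growth bound dominates the
    spectrum.  Two integrations by parts against the test function
    (test_function_by_parts) finish the identification.

    The integrals involved are Bochner integrals of functions that are only
    essentially bounded.  Their calculus rests on approximation by simple
    functions and on integration by parts (bochner_by_parts), which replaces
    differentiation almost everywhere; coordinates of vector-valued integrals are
    obtained by taking a bounded operator under the integral
    (bochner_bounded_op). *)

(** * Real-valued norms *)

(** The modulus, through the alias under which the complex numbers are a Banach
    space over themselves. *)
Notation cabs a := (@rnorm _ (CC _) a).

Section RealNorm.
Context {R : realType}.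
Implicit Types V W : normedModType R[i].

Lemma rnormE V (v : V) : `|v| = (rnorm v)%:C.
Proof. by rewrite /rnorm RRe_real// normr_real. Qed.

Lemma rnorm_ge0 V (v : V) : 0 <= rnorm v.
Proof. by rewrite -ler0c -rnormE. Qed.

Lemma rnorm0 V : rnorm (0 : V) = 0.
Proof. by rewrite /rnorm normr0. Qed.

Lemma rnorm_eq0 V (v : V) : rnorm v = 0 -> v = 0.
Proof. by move=> v0; apply/normr0_eq0; rewrite rnormE v0. Qed.

Lemma rnormN V (v : V) : rnorm (- v) = rnorm v.
Proof. by rewrite /rnorm normrN. Qed.

Lemma rdistC V (v w : V) : rnorm (v - w) = rnorm (w - v).
Proof. by rewrite /rnorm distrC. Qed.

Lemma ler_rnormD V (v w : V) : rnorm (v + w) <= rnorm v + rnorm w.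
Proof. by rewrite -lecR -rnormE rmorphD/= -!rnormE ler_normD. Qed.

Lemma ler_rnormB V (v w : V) : rnorm (v - w) <= rnorm v + rnorm w.
Proof. by rewrite -(rnormN w) ler_rnormD. Qed.

Lemma ler_rdistD V (u v w : V) : rnorm (v - w) <= rnorm (v - u) + rnorm (u - w).
Proof. by rewrite -[v - w](subrKA u) ler_rnormD. Qed.

Lemma ler_rnorm_sum V (I : Type) (r : seq I) (P : pred I) (F : I -> V) :
  rnorm (\sum_(i <- r | P i) F i) <= \sum_(i <- r | P i) rnorm (F i).
Proof.
elim/big_ind2 : _ => [|x1 x2 y1 y2 h1 h2|//]; first by rewrite rnorm0.
by rewrite (le_trans (ler_rnormD _ _))// lerD.
Qed.

Lemma rnormZ V (a : R[i]) (v : V) : rnorm (a *: v) = cabs a * rnorm v.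
Proof.
by apply: complexI; rewrite /= rmorphM/= -!rnormE normrZ.
Qed.

Lemma cabsM (a b : R[i]) : cabs (a * b) = cabs a * cabs b.
Proof. exact: (@rnormZ (CC R)). Qed.

Lemma cabsR (r : R) : cabs r%:C = `|r|.
Proof. by apply: complexI; rewrite /= -rnormE normc_def/= expr0n addr0 sqrtr_sqr. Qed.

Lemma cabs1 : cabs (1 : R[i]) = 1.
Proof. by rewrite (cabsR 1) normr1. Qed.

Lemma cabsV (a : R[i]) : cabs a^-1 = (cabs a)^-1.
Proof. by apply: complexI; rewrite /= fmorphV/= -!rnormE normfV. Qed.

Lemma cabs_conj (a : R[i]) : cabs a^* = cabs a.
Proof. by apply: complexI; rewrite /= -!rnormE normcJ. Qed.

Lemma cabs_Re (a : R[i]) : `|complex.Re a| <= cabs a.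
Proof. by rewrite -lecR -rnormE normc_ge_Re. Qed.

Lemma cabs_gt0 (a : R[i]) : (0 < cabs a) = (a != 0).
Proof. by rewrite -ltcR -rnormE normr_gt0. Qed.

Lemma cabs_ReIm (a : R[i]) : cabs a <= `|complex.Re a| + `|complex.Im a|.
Proof. by rewrite -lecR -rnormE ler_normC. Qed.

Lemma gt0c (e : R[i]) : 0 < e -> e = (complex.Re e)%:C /\ 0 < complex.Re e.
Proof.
move=> e0; have eE : e = (complex.Re e)%:C by rewrite RRe_real// gtr0_real.
by split=> //; rewrite -ltcR -eE.
Qed.

Lemma rcvgP V {T : Type} {F : set_system T} {FF : Filter F} (f : T -> V) (l : V) :
  f @ F --> l <-> forall e : R, 0 < e -> \forall x \near F, rnorm (f x - l) < e.
Proof.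
split=> [/cvgrPdist_lt fl e e0|fl].
  have e0' : 0 < e%:C by rewrite ltcR.
  by have := fl _ e0'; apply: filterS => x; rewrite distrC rnormE ltcR.
apply/cvgrPdist_lt => e /gt0c[-> e0].
by have := fl _ e0; apply: filterS => x; rewrite distrC rnormE ltcR.
Qed.

Lemma rcvg0P V {T : Type} {F : set_system T} {FF : Filter F} (f : T -> V) (l : V) :
  f @ F --> l <-> rnorm (f x - l) @[x --> F] --> (0 : R).
Proof.
rewrite rcvgP; split=> [fl|/cvgrPdist_lt fl e /fl].
  apply/cvgrPdist_lt => e /fl; apply: filterS => x.
  by rewrite sub0r normrN ger0_norm// rnorm_ge0.
by apply: filterS => x; rewrite sub0r normrN ger0_norm// rnorm_ge0.
Qed.

Lemma rcvg_squeeze V {T : Type} {F : set_system T} {FF : Filter F} (f : T -> V)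
    (l : V) (g : T -> R) : (\forall x \near F, rnorm (f x - l) <= g x) ->
  g x @[x --> F] --> (0 : R) -> f @ F --> l.
Proof.
move=> fg g0; apply/rcvg0P; apply: squeeze_cvgr g0; last exact: cvg_cst.
by apply: filterS fg => x ->; rewrite rnorm_ge0.
Qed.

Lemma rcvg_unique V {T : Type} {F : set_system T} {FF : ProperFilter F} (f : T -> V)
  (l l' : V) : f @ F --> l -> f @ F --> l' -> l = l'.
Proof. by apply: cvg_unique; exact: norm_hausdorff. Qed.

Lemma cvg_rnorm V {T : Type} {F : set_system T} {FF : Filter F} (f : T -> V)
  (l : V) : f @ F --> l -> rnorm (f x) @[x --> F] --> rnorm l.
Proof.
move/rcvgP => fl; apply/cvgrPdist_lt => e /fl; apply: filterS => x.
apply: le_lt_trans; rewrite ler_norml; apply/andP; split.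
  by rewrite -(opprB (rnorm (f x))) lerN2 lerBlDr -{1}[f x](subrK l) ler_rnormD.
by rewrite lerBlDr rdistC -{1}[l](subrK (f x)) ler_rnormD.
Qed.

Lemma rnorm_cvg_le V {T : Type} {F : set_system T} {FF : ProperFilter F} (f : T -> V)
  (l : V) (M : R) : f @ F --> l -> (\forall x \near F, rnorm (f x) <= M) -> rnorm l <= M.
Proof.
by move=> /cvg_rnorm fl fM; exact: (cvgr_to_le fl fM).
Qed.

Lemma rcauchy_cvg (V : completeNormedModType R[i]) (u : nat -> V) :
  (forall e : R, 0 < e -> exists N, forall m n, (N <= m)%N -> (N <= n)%N ->
     rnorm (u m - u n) < e) ->
  exists l : V, u @ \oo --> l.
Proof.
move=> uC; suff uc : cvg (u @ \oo) by exists (lim (u @ \oo)).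
apply/cauchy_cvgP/cauchyP => e /gt0c[eE e0].
have [N NP] := uC _ e0.
exists (u N); exists N => // n /= Nn.
by rewrite -ball_normE/= eE rnormE ltcR NP.
Qed.

Lemma rnbhsP V (x : V) (A : set V) :
  nbhs x A <-> exists2 e : R, 0 < e & forall y, rnorm (y - x) < e -> A y.
Proof.
split=> [/nbhs_normP[e/= /gt0c[eE e0] eA]|[e e0 eA]].
  exists (complex.Re e) => // y xy; apply: eA => /=.
  by rewrite eE distrC rnormE ltcR.
apply/nbhs_normP; exists e%:C => /=; first by rewrite ltcR.
by move=> y /=; rewrite distrC rnormE ltcR; exact: eA.
Qed.

Lemma rclosureP V (A : set V) (x : V) (e : R) :
  closure A x -> 0 < e -> exists2 y, A y & rnorm (y - x) < e.
Proof.
move=> Ax e0; have /Ax[y [Ay xy]] : nbhs x [set y | rnorm (y - x) < e].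
  by apply/rnbhsP; exists e.
by exists y.
Qed.

Lemma lin0 V W (f : V -> W) : linear f -> f 0 = 0.
Proof. by move=> lf; have := lf (-1) 0 0; rewrite scaler0 addr0 scaleN1r addNr. Qed.
Lemma linD V W (f : V -> W) : linear f -> {morph f : x y / x + y}.
Proof. by move=> lf x y; have := lf 1 x y; rewrite !scale1r. Qed.
Lemma linZ V W (f : V -> W) : linear f -> forall a, {morph f : x / a *: x}.
Proof. by move=> lf a x; have := lf a x 0; rewrite (lin0 lf) !addr0. Qed.
Lemma linN V W (f : V -> W) : linear f -> {morph f : x / - x}.
Proof. by move=> lf x; rewrite -scaleN1r (linZ lf) scaleN1r. Qed.
Lemma linB V W (f : V -> W) : linear f -> {morph f : x y / x - y}.
Proof. by move=> lf x y; rewrite (linD lf) (linN lf). Qed.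
Lemma lin_sum V W (f : V -> W) (lf : linear f) (I : Type) (r : seq I) (P : pred I)
  (F : I -> V) : f (\sum_(i <- r | P i) F i) = \sum_(i <- r | P i) f (F i).
Proof. by apply: (big_morph f (linD lf) (lin0 lf)). Qed.

Lemma opnorm_ge V W (f : V -> W) v : rnorm v <= 1 -> ((rnorm (f v))%:E <= opnorm f)%E.
Proof. by move=> v1; apply: ereal_sup_ubound; exists v. Qed.

Lemma opnorm_ge0 V W (f : V -> W) : (0 <= opnorm f)%E.
Proof.
apply: (@le_trans _ _ (rnorm (f 0))%:E); first by rewrite lee_fin rnorm_ge0.
by apply: opnorm_ge; rewrite rnorm0.
Qed.

Lemma rnorm_le_opnorm V W (f : V -> W) (M : R) : linear f -> (opnorm f <= M%:E)%E ->
  forall v, rnorm (f v) <= M * rnorm v.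
Proof.
move=> lf fM v; have [v0|v0] := eqVneq (rnorm v) 0.
  by rewrite (rnorm_eq0 v0) (lin0 lf) !rnorm0 mulr0.
have vgt0 : 0 < rnorm v by rewrite lt_neqAle eq_sym v0 rnorm_ge0.
rewrite -ler_pdivrMr// -lee_fin; apply: le_trans fM.
have -> : rnorm (f v) / rnorm v = rnorm (f ((rnorm v)^-1%:C *: v)).
  by rewrite (linZ lf) rnormZ cabsR ger0_norm ?invr_ge0 ?rnorm_ge0// mulrC.
by apply: opnorm_ge; rewrite rnormZ cabsR ger0_norm ?invr_ge0 ?rnorm_ge0// mulVf.
Qed.

Lemma opnorm_le V W (f : V -> W) (M : R) : 0 <= M ->
  (forall v, rnorm (f v) <= M * rnorm v) -> (opnorm f <= M%:E)%E.
Proof.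
move=> M0 fM; apply: ge_ereal_sup => _ [v /= v1 <-].
by rewrite lee_fin (le_trans (fM v))// ler_piMr.
Qed.

Lemma bounded_opP V W (f : V -> W) : bounded_op f <->
  linear f /\ exists2 M : R, 0 <= M & forall v, rnorm (f v) <= M * rnorm v.
Proof.
split=> [[lf fM]|[lf [M M0 fM]]].
  split=> //; have fn : opnorm f \is a fin_num.
    by rewrite ge0_fin_numE ?opnorm_ge0.
  exists (fine (opnorm f)); first by rewrite fine_ge0 ?opnorm_ge0.
  by apply: rnorm_le_opnorm => //; rewrite fineK.
by split=> //; apply: le_lt_trans (opnorm_le M0 fM) _; rewrite ltry.
Qed.

Lemma bounded_op_cvg V W (f : V -> W) {T : Type} {F : set_system T} {FF : Filter F}
    (g : T -> V) (l : V) :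
  bounded_op f -> g @ F --> l -> f (g x) @[x --> F] --> f l.
Proof.
move=> /bounded_opP[lf [M M0 fM]] /rcvg0P gl.
apply: (@rcvg_squeeze _ _ _ _ _ _ (fun x => M * rnorm (g x - l))).
  by near=> x; rewrite -(linB lf).
by rewrite -[X in _ --> X](mulr0 M); apply: cvgMr.
Unshelve. all: by end_near. Qed.

Lemma op_cvg1 {T : Type} (F : set_system T) {FF : Filter F} W
    (f : T -> CC R -> W) (L : CC R -> W) :
  op_cvg F f L -> f s 1 @[s --> F] --> L 1.
Proof.
move=> fL; apply/rcvgP => e e0.
have [fin /cvgrPdist_lt/(_ _ e0)] := (fine_cvgP _ _).1 fL.
move=> small; near=> s.
have /fineK sE : opnorm (fun u : CC R => f s u - L u) \is a fin_num by near: s.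
have : `|0 - fine (opnorm (fun u : CC R => f s u - L u))| < e by near: s.
rewrite sub0r normrN ger0_norm ?fine_ge0 ?opnorm_ge0//; apply: le_lt_trans.
by rewrite -lee_fin sE; apply: (@opnorm_ge (CC R) W (fun u => f s u - L u) 1); rewrite cabs1.
Unshelve. all: by end_near. Qed.
End RealNorm.

(** * Functions of a real variable *)

Section RealVariable.
Context {R : realType}.
Implicit Types V : normedModType R[i].

(** The supremum of the points which [Q] links to [a] is itself linked to [a] and
    cannot lie before [b].  This is compactness of the interval, in the form in
    which local estimates are turned into global ones throughout: boundedness, the
    mean value inequality and approximation by step functions. *)
Lemma interval_chain (a b : R) (Q : R -> R -> Prop) : a <= b ->
  (forall x y z, a <= x -> x <= y -> y <= z -> z <= b -> Q x y -> Q y z -> Q x z) ->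
  (forall t, a <= t <= b -> exists2 d, 0 < d & forall x y,
     a <= x -> t - d < x -> x <= t -> t <= y -> y < t + d -> y <= b -> Q x y) ->
  Q a b.
Proof.
move=> ab Qtrans Qloc.
pose S := [set t | a <= t <= b /\ Q a t].
have Sa : S a.
  split; first by rewrite lexx.
  have [|d d0] := Qloc a; first by rewrite lexx.
  by apply; rewrite ?lexx// ?ltrBlDr ltrDl.
have Sub : ubound S b by move=> t [/andP[]].
have supS : has_sup S by split; [exists a | exists b].
set s := sup S.
have as_ : a <= s by apply: ub_le_sup => //; exists b.
have sb : s <= b by apply: ge_sup => //; exists a.
have [|d d0 Qd] := Qloc s; first by rewrite as_.
have [t [/andP[at_ tb] Qat] st] := sup_adherent d0 supS.
have ts : t <= s by apply: ub_le_sup => //; [exists b|split; rewrite ?at_].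
have Qas : Q a s.
  by apply: (Qtrans a t s) => //; apply: Qd => //; rewrite ltrDl.
have [->//|sb'] := eqVneq b s.
have {}sb' : s < b by rewrite lt_neqAle eq_sym sb'.
pose y := Num.min b (s + d / 2).
have sy : s < y by rewrite lt_min sb' ltrDl divr_gt0.
have yb : y <= b by rewrite ge_min lexx.
have yd : y < s + d by rewrite gt_min; apply/orP; right; lra.
have Qay : Q a y.
  apply: (Qtrans a s y) => //; first exact: ltW.
  by apply: Qd => //; [rewrite ltrBlDr ltrDl|exact: ltW].
suff : y <= s by rewrite leNgt sy.
apply: ub_le_sup; first by exists b.
by split=> //; rewrite yb (le_trans as_)// ltW.
Qed.

(** The mean value inequality; straddling the point [t] is what lets a local
    estimate be chained over an interval. *)
Lemma straddle_const V (D : R -> V) (a b : R) : a <= b ->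
  (forall (e t : R), 0 < e -> a <= t <= b -> exists2 d, 0 < d & forall x y,
     a <= x -> t - d < x -> x <= t -> t <= y -> y < t + d -> y <= b ->
     rnorm (D y - D x) <= e * (y - x)) -> D b = D a.
Proof.
move=> ab loc; apply/eqP; rewrite -subr_eq0; apply/eqP/rnorm_eq0/eqP.
rewrite eq_le rnorm_ge0 andbT; apply/ler_addgt0Pr => e e0; rewrite add0r.
have e'0 : 0 < e / (b - a + 1) by rewrite divr_gt0//; lra.
have : rnorm (D b - D a) <= e / (b - a + 1) * (b - a).
  apply: (@interval_chain a b
    (fun x y => rnorm (D y - D x) <= e / (b - a + 1) * (y - x))) => //.
    move=> x y z _ _ _ _ xy yz; rewrite (le_trans (ler_rdistD (D y) _ _))//.
    by rewrite (le_trans (lerD yz xy))// -mulrDr addrA subrK.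
  by move=> t tab; exact: loc.
move=> /le_trans; apply; rewrite -mulrA ler_piMr ?(ltW e0)//.
by rewrite mulrC ler_pdivrMr; lra.
Qed.

(** Continuity and differentiability relative to the interval, one-sided at its
    end points, with real bounds in place of the complex-valued norms. *)
Definition cont_on V (f : R -> V) (a b : R) : Prop :=
  forall t e : R, a <= t <= b -> 0 < e -> exists2 d, 0 < d &
    forall s, a <= s <= b -> `|s - t| < d -> rnorm (f s - f t) < e.

Definition diff_on V (f f' : R -> V) (a b : R) : Prop :=
  forall t e : R, a <= t <= b -> 0 < e -> exists2 d, 0 < d &
    forall s, a <= s <= b -> `|s - t| < d ->
      rnorm (f s - f t - (s - t)%:C *: f' t) <= e * `|s - t|.

Lemma cont_on_bounded V (f : R -> V) (a b : R) : a <= b -> cont_on f a b ->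
  exists2 M : R, 0 <= M & forall t, a <= t <= b -> rnorm (f t) <= M.
Proof.
move=> ab cf; apply: (@interval_chain a b (fun x y => exists2 M : R, 0 <= M &
    forall t, x <= t <= y -> rnorm (f t) <= M)) => //.
  move=> x y z _ xy yz _ [M M0 MP] [N N0 NP]; exists (M + N); first exact: addr_ge0.
  move=> t /andP[xt tz]; have [ty|yt] := leP t y.
    by rewrite (le_trans (MP _ _)) ?lerDl// xt.
  by rewrite (le_trans (NP _ _)) ?lerDr// tz ltW.
move=> t tab; have [d d0 dP] := cf t 1 tab ltr01.
exists d => // x y ax tdx xt ty ytd yb.
exists (rnorm (f t) + 1); first by rewrite addr_ge0 ?rnorm_ge0.
move=> s /andP[xs sy]; rewrite -[f s](subrK (f t)) addrC.
rewrite (le_trans (ler_rnormD _ _))// lerD2l ltW// dP//.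
  by apply/andP; split; lra.
by rewrite ltr_norml; apply/andP; split; lra.
Qed.

Lemma cont_on_cst V (v : V) (a b : R) : cont_on (cst v) a b.
Proof. by move=> t e _ e0; exists 1 => // s _ _; rewrite subrr rnorm0. Qed.

Lemma cont_onD V (f g : R -> V) (a b : R) :
  cont_on f a b -> cont_on g a b -> cont_on (fun t => f t + g t) a b.
Proof.
move=> cf cg t e tab e0; have e20 : 0 < e / 2 by rewrite divr_gt0.
have [d d0 dP] := cf t _ tab e20; have [d' d'0 d'P] := cg t _ tab e20.
exists (Num.min d d'); first by rewrite lt_min d0.
move=> s sab; rewrite lt_min => /andP[sd sd'].
rewrite opprD addrACA (le_lt_trans (ler_rnormD _ _))// [e]splitr.
by rewrite ltrD// ?dP// d'P.
Qed.

Lemma cont_onZ V (g : R -> CC R) (f : R -> V) (a b : R) :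
  cont_on g a b -> cont_on f a b -> cont_on (fun t => (g t : R[i]) *: f t) a b.
Proof.
move=> cg cf t e tab e0.
pose K := rnorm (f t) + cabs (g t) + 1.
have K0 : 0 < K by rewrite ltr_wpDl// addr_ge0 ?rnorm_ge0.
pose e1 := Num.min 1 (e / (2 * K)).
have e10 : 0 < e1 by rewrite lt_min ltr01 divr_gt0 ?mulr_gt0.
have [d d0 dP] := cg t _ tab e10; have [d' d'0 d'P] := cf t _ tab e10.
exists (Num.min d d'); first by rewrite lt_min d0.
move=> s sab; rewrite lt_min => /andP[/(dP _ sab) gs /(d'P _ sab) fs].
have -> : (g s : R[i]) *: f s - (g t : R[i]) *: f t =
  (g s - g t : R[i]) *: (f s - f t) + (g s - g t : R[i]) *: f t
   + (g t : R[i]) *: (f s - f t).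
  by rewrite -scalerDr subrK scalerBl scalerBr addrA subrK.
have h1 : e1 <= 1 by rewrite ge_min lexx.
have h2 : e1 * K <= e / 2.
  by rewrite -ler_pdivlMr// -mulrA -invfM ge_min lexx orbT.
have f0 := rnorm_ge0 (f t); have g0 := @rnorm_ge0 _ (CC R) (g t).
apply: le_lt_trans (ler_rnormD _ _) _.
apply: le_lt_trans (lerD (ler_rnormD _ _) (lexx _)) _.
rewrite !rnormZ.
have q1 : cabs (g s - g t) * rnorm (f s - f t) <= e1 * 1.
  by rewrite ler_pM ?rnorm_ge0// ltW// (lt_le_trans fs).
have q2 : cabs (g s - g t) * rnorm (f t) <= e1 * rnorm (f t).
  by rewrite ler_wpM2r// ltW.
have q3 : cabs (g t) * rnorm (f s - f t) <= e1 * cabs (g t).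
  by rewrite mulrC ler_wpM2r// ltW.
move: q1 q2 q3 h2; rewrite /K !mulrDr !mulr1.
move: (_ * rnorm (f t)) => A; move: (e1 * cabs _) => B; lra.
Qed.

Lemma diff_on_cont V (f f' : R -> V) (a b : R) : diff_on f f' a b -> cont_on f a b.
Proof.
move=> df t e tab e0; have [d d0 dP] := df t 1 tab ltr01.
have K0 : 0 < 1 + rnorm (f' t) by rewrite ltr_pwDl ?rnorm_ge0.
exists (Num.min d (e / (1 + rnorm (f' t)))); first by rewrite lt_min d0 divr_gt0.
move=> s sab; rewrite lt_min => /andP[/(dP _ sab) h].
rewrite ltr_pdivlMr// => h'; rewrite -[f s - f t](subrK ((s - t)%:C *: f' t)).
apply: le_lt_trans (ler_rnormD _ _) _; apply: le_lt_trans (lerD h (lexx _)) _.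
by move: h'; rewrite rnormZ cabsR mul1r mulrDr mulr1.
Qed.

End RealVariable.

(** * The complex exponential *)

Section Cexp.
Context {R : realType}.
Implicit Types (z w : R[i]).

Lemma ReZ (s : R) z : complex.Re (s%:C * z) = s * complex.Re z.
Proof. by case: z => a b /=; rewrite mul0r subr0. Qed.

Definition cexp z : R[i] :=
  (expR (complex.Re z))%:C * (cos (complex.Im z) +i* sin (complex.Im z)).

Lemma cexp0 : cexp 0 = 1.
Proof. by rewrite /cexp /= expR0 cos0 sin0 mul1r. Qed.

Lemma cexpD z w : cexp (z + w) = cexp z * cexp w.
Proof.
rewrite /cexp !raddfD/= expRD cosD sinD rmorphM/= mulrACA; congr (_ * _).
by apply/eqP; rewrite eq_complex /= eqxx /= addrC mulrC [X in _ + X]mulrC eqxx.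
Qed.

Lemma cabs_cexp z : cabs (cexp z) = expR (complex.Re z).
Proof.
rewrite cabsM cabsR ger0_norm ?expR_ge0// (_ : cabs _ = 1) ?mulr1//.
by apply: complexI; rewrite /= -rnormE normc_def/= cos2Dsin2 sqrtr1.
Qed.

Lemma cexpN z : cexp (- z) * cexp z = 1.
Proof. by rewrite -cexpD addNr cexp0. Qed.

Lemma cexp_small z (e : R) : 0 < e -> exists2 d, 0 < d &
  forall h : R, `|h| < d -> cabs (cexp (h%:C * z) - 1 - h%:C * z) <= e * `|h|.
Proof.
move=> e0; case: z => a b.
have der (f : R -> R) (c : R) : is_derive (0 : R) (1 : R) f c ->
    exists2 d, 0 < d & forall h : R, `|h| < d -> `|f h - f 0 - h * c| <= e / 2 * `|h|.
  move=> fc; have e20 : 0 < e / 2 by rewrite divr_gt0.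
  have [df fcE] := fc; have /cvgrPdist_le/(_ _ e20) := df.
  rewrite -/('D_1 f 0) fcE => /nbhs_normP[d/= d0 dP].
  exists d => // h hd; have [->|h0] := eqVneq h 0.
    by rewrite subrr mul0r subr0 !normr0 mulr0.
  have : `|c - h^-1 *: (f (h *: 1 + 0) - f 0)| <= e / 2.
    by apply: dP => //=; rewrite sub0r normrN.
  rewrite addr0 /GRing.scale/= mulr1 => h1.
  have -> : f h - f 0 - h * c = - (h * (c - h^-1 * (f h - f 0))).
    by rewrite mulrBr mulrA divff// mul1r opprB.
  by rewrite normrN normrM mulrC ler_wpM2r.
have [|d d0 dP] := der (fun h => expR (h * a) * cos (h * b)) a.
  apply: is_derive_eq; rewrite !mul0r expR0 cos0 sin0 /GRing.scale/=.
  by rewrite !(mulr0, mulr1, mul0r, mul1r, oppr0, addr0, add0r).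
have [|d' d'0 d'P] := der (fun h => expR (h * a) * sin (h * b)) b.
  apply: is_derive_eq; rewrite !mul0r expR0 cos0 sin0 /GRing.scale/=.
  by rewrite !(mulr0, mulr1, mul0r, mul1r, oppr0, addr0, add0r).
exists (Num.min d d'); first by rewrite lt_min d0.
move=> h; rewrite lt_min => /andP[/dP h1 /d'P h2].
apply: le_trans (cabs_ReIm _) _; rewrite [e]splitr mulrDl.
move: h1 h2; rewrite !mul0r expR0 cos0 sin0 !(mulr1, mulr0, subr0) => h1 h2.
rewrite lerD//.
  rewrite (_ : complex.Re _ = expR (h * a) * cos (h * b) - 1 - h * a)//.
  by rewrite /cexp /= !mul0r !subr0 addr0.
rewrite (_ : complex.Im _ = expR (h * a) * sin (h * b) - h * b)//.
by rewrite /cexp /= !mul0r !subr0 !addr0.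
Qed.

Lemma cexp_diff z (c : R) (a b : R) :
  diff_on (fun t => cexp ((c + t)%:C * z) : CC R) (fun t => z * cexp ((c + t)%:C * z)) a b.
Proof.
move=> t e _ e0; set K := cabs (cexp ((c + t)%:C * z)).
have K0 : 0 < K + 1 by rewrite ltr_wpDl ?rnorm_ge0.
have [|d d0 dP] := @cexp_small z (e / (K + 1)); first by rewrite divr_gt0.
exists d => // s _ /dP; set h := s - t => hP.
have -> : cexp ((c + s)%:C * z) - cexp ((c + t)%:C * z)
   - (h%:C : R[i]) *: (z * cexp ((c + t)%:C * z) : CC R) =
   cexp ((c + t)%:C * z) * (cexp (h%:C * z) - 1 - h%:C * z) :> CC R.
  rewrite [c + s](_ : _ = c + t + h); last by rewrite /h; ring.
  rewrite [in LHS]rmorphD/= mulrDl cexpD /GRing.scale/=; ring.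
rewrite cabsM -/K (le_trans (ler_wpM2l (rnorm_ge0 _) hP))//.
rewrite mulrA ler_wpM2r// mulrCA ler_piMr ?(ltW e0)//.
by rewrite ler_pdivrMr// mul1r lerDl.
Qed.

End Cexp.

(** * Uniform boundedness and strongly continuous semigroups *)

Section Semigroup.
Context {R : realType}.
Implicit Types V : normedModType R[i].

(** A gliding hump: the vector built from summands of norm at most [3 ^- k],
    with signs chosen so that the [k]-th operator is large on the partial sum,
    contradicts pointwise boundedness when the norms exceed [4 * k * 3 ^ k]. *)
Lemma uniform_boundedness (X : completeNormedModType R[i]) V (T : nat -> X -> V) :
  (forall n, bounded_op (T n)) ->
  (forall x, exists M : R, forall n, rnorm (T n x) <= M) ->
  exists M : R, forall n x, rnorm (T n x) <= M * rnorm x.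
Proof.
move=> Tb Tpt; apply: contrapT => /forallNP nM.
pose t k : R := 3 ^- k.
have t0 k : 0 < t k by rewrite invr_gt0 exprn_gt0.
have tS k : t k.+1 = t k / 3 by rewrite /t exprS invfM mulrC.
have step k : exists p : nat * X * R, let: (n, y, N) := p in
    [/\ rnorm y <= t k, 0 <= N, (forall x, rnorm (T n x) <= N * rnorm x),
        4 * k%:R <= N * t k & 3 / 4 * N * t k <= rnorm (T n y)].
  have /existsNP[n /existsNP[x /negP]] := nM (4 * k%:R / t k + 1).
  rewrite -ltNge => Tnx; have [lT fin] := Tb n.
  have finN : opnorm (T n) \is a fin_num by rewrite ge0_fin_numE ?opnorm_ge0.
  pose N := fine (opnorm (T n)).
  have NP : forall x, rnorm (T n x) <= N * rnorm x.
    by apply: rnorm_le_opnorm => //; rewrite fineK.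
  have x0 : 0 < rnorm x.
    rewrite lt_neqAle rnorm_ge0 andbT eq_sym; apply/eqP => /rnorm_eq0 x0.
    by move: Tnx; rewrite x0 (lin0 lT) !rnorm0 mulr0 ltxx.
  have Nk : 4 * k%:R / t k + 1 < N.
    by rewrite -(ltr_pM2r x0) (lt_le_trans Tnx).
  have kt0 : 0 <= 4 * k%:R / t k by rewrite divr_ge0 ?(ltW (t0 k))// mulr_ge0.
  have N0 : 0 < N by lra.
  have [_ [v /= v1 <-]] := @ub_ereal_sup_adherent R [set (rnorm (T n u))%:E | u in
      [set u | rnorm u <= 1]] (N / 4) (divr_gt0 N0 (ltr0Sn _ 3)) finN.
  rewrite -/(opnorm _) -(fineK finN) -/N -EFinB lte_fin => vN.
  exists (n, (t k)%:C *: v, N); split=> //.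
  - by rewrite rnormZ cabsR gtr0_norm// ler_piMr// ltW.
  - exact: ltW.
  - by rewrite -ler_pdivrMr// ltW//; lra.
  - rewrite (linZ lT) rnormZ cabsR gtr0_norm// mulrC ler_wpM2l ?(ltW (t0 k))//.
    by rewrite ltW//; lra.
have [p pP] := choice step.
pose S k := T (p k).1.1; pose y k := (p k).1.2; pose N k := (p k).2.
pose fix x k : X := if k is j.+1 then
  (if rnorm (S j (y j)) <= rnorm (S j (x j + y j)) then x j + y j else x j - y j)
  else 0.
have Sy k : rnorm (S k (y k)) <= rnorm (S k (x k.+1)).
  rewrite /=; case: ifPn => //; rewrite -ltNge => lt.
  have lS : linear (S k) by case: (Tb (p k).1.1).
  move: lt; rewrite (linD lS) (linB lS) => lt.
  have := ler_rnormB (S k (x k) + S k (y k)) (S k (x k) - S k (y k)).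
  rewrite opprB [X in rnorm X <= _](_ : _ = 2%:R *: S k (y k)); last first.
    by rewrite addrC addrA subrK scaler_nat mulr2n.
  rewrite rnormZ (_ : 2%:R = (2%:R)%:C); last by rewrite rmorph_nat.
  by rewrite cabsR ger0_norm//; lra.
have xS k : rnorm (x k.+1 - x k) <= t k.
  rewrite /=; case: ifP => _; rewrite [x k + _]addrC addrK ?rnormN;
  by have := pP k; rewrite /y; case: (p k) => [[n' y'] N'] [].
have xD n d : rnorm (x (n + d)%N - x n) <= 3 / 2 * (t n - t (n + d)%N).
  elim: d => [|d IH]; first by rewrite addn0 !subrr rnorm0 mulr0.
  rewrite addnS (le_trans (ler_rdistD (x (n + d)%N) _ _))//.
  by have := xS (n + d)%N; rewrite tS; lra.
have xnm n m : (n <= m)%N -> rnorm (x m - x n) <= 3 / 2 * t n.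
  move=> nm; rewrite -(subnKC nm) (le_trans (xD _ _))//.
  by have := t0 (n + (m - n))%N; lra.
have tcvg : t @ \oo --> (0 : R).
  rewrite (_ : t = fun k => 3^-1 ^+ k); last by apply/funext => k; rewrite exprVn.
  by apply: cvg_expr; rewrite ger0_norm//; lra.
have [l xl] : exists l : X, x @ \oo --> l.
  apply: rcauchy_cvg => e e0.
  have e60 : 0 < e / 6 by rewrite divr_gt0.
  have /cvgrPdist_lt/(_ _ e60)[K _ KP] := tcvg.
  exists K => m n Km Kn; have := KP K (leqnn _).
  rewrite sub0r normrN gtr0_norm// => tK.
  apply: le_lt_trans (ler_rdistD (x K) _ _) _.
  by have := xnm _ _ Km; have := xnm _ _ Kn; rewrite (rdistC (x K)); lra.
have lx k : rnorm (l - x k) <= 3 / 2 * t k.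
  apply: (@rnorm_cvg_le _ _ _ \oo _ (fun n => x n - x k)).
    by apply: cvgB => //; exact: cvg_cst.
  by exists k => // n /= kn; exact: xnm.
have [M lM] := Tpt l.
have [k kM] : exists k : nat, M < k%:R.
  by exists (Num.truncn M).+1; exact: truncnS_gt.
suff : k%:R <= M by rewrite leNgt kM.
apply: le_trans (lM (p k).1.1).
have := Sy k; have := lx k.+1; have := pP k.
rewrite /S /y; case: (p k) => [[n y'] N'] /= [_ N0 TN kN yN] lxk Syk.
have := TN (l - x k.+1); have lT : linear (T n) by case: (Tb n).
rewrite (linB lT) => h1.
have h2 : rnorm (T n (x k.+1)) <= rnorm (T n l) + rnorm (T n l - T n (x k.+1)).
  by rewrite rdistC -{1}[T n (x k.+1)](subrK (T n l)) addrC ler_rnormD.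
have := ler_wpM2l N0 lxk; rewrite tS => h3.
rewrite /= in h2; lra.
Qed.

Lemma at_right0P (P : set R) : (\forall h \near 0^'+, P h) ->
  exists2 d : R, 0 < d & forall h, 0 < h < d -> P h.
Proof.
move=> /nbhs_normP[d/= d0 dP]; exists d => // h /andP[h0 hd]; apply: dP => //=.
by rewrite sub0r normrN gtr0_norm.
Qed.

Context {X : completeNormedModType R[i]} (T : c0_semigroup X).

Lemma sg_linear (t : R) : 0 <= t -> linear (T t).
Proof. by move=> t0; case: (sg_bounded T t0). Qed.

(** Otherwise the semigroup is unbounded along some times tending to 0, where
    strong continuity bounds each orbit: this contradicts uniform boundedness. *)
Lemma sg_locally_bounded : exists d M : R, [/\ 0 < d, 0 <= M &
  forall (t : R) x, 0 <= t <= d -> rnorm (T t x) <= M * rnorm x].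
Proof.
apply: contrapT => nloc.
have bad n : exists s : R, 0 <= s <= n.+1%:R^-1 /\
    ~ (forall x, rnorm (T s x) <= n%:R * rnorm x).
  apply: contrapT => /forallNP h; apply: nloc.
  exists n.+1%:R^-1, n%:R; split => // t x tn.
  by have := h t; rewrite not_andE => -[//|/contrapT]; exact.
have [s sP] := choice bad.
have [n|x|M MP] := @uniform_boundedness X X (fun n => T (s n)).
- by apply: sg_bounded; case: (sP n) => /andP[].
- have /rcvgP/(_ 1 ltr01)/at_right0P[d d0 dP] := @sg_continuous _ _ T x.
  have sb n : rnorm (T (s n) x) <= rnorm x + 1 \/ d <= s n.
    have [|snd] := leP d (s n); [by right|left].
    have [/andP[sn0 _] _] := sP n.
    have [sn|sn] := eqVneq (s n) 0; first by rewrite sn sg0 lerDl.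
    rewrite -{1}[T (s n) x](subrK x) addrC (le_trans (ler_rnormD _ _))// lerD2l.
    by rewrite ltW// dP// snd lt_neqAle eq_sym sn sn0.
  have [K Kd] : exists K, K.+1%:R^-1 < d.
    exists (Num.truncn d^-1); rewrite invf_plt ?posrE//.
    exact: truncnS_gt.
  have [M' M'P] : exists M', forall n, (n < K)%N -> rnorm (T (s n) x) <= M'.
    elim: K {Kd} => [|K [M' IH]]; first by exists 0.
    exists (Num.max M' (rnorm (T (s K) x))) => n; rewrite ltnS leq_eqVlt le_max.
    by move=> /predU1P[->|/IH ->//]; rewrite lexx orbT.
  exists (Num.max M' (rnorm x + 1)) => n; rewrite le_max.
  have [nK|Kn] := ltnP n K; first by rewrite M'P.
  have [->|dsn] := sb n; first by rewrite orbT.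
  have [/andP[_ sn] _] := sP n.
  suff : d < d by rewrite ltxx.
  apply: le_lt_trans dsn _; apply: le_lt_trans sn _; apply: le_lt_trans Kd.
  by rewrite lef_pV2 ?posrE// ler_nat ltnS.
have [k kM] : exists k : nat, M < k%:R.
  by exists (Num.truncn M).+1; exact: truncnS_gt.
have [_ sM] := sP k; apply: sM => x; apply: le_trans (MP k x) _.
by rewrite ler_wpM2r ?rnorm_ge0// ltW.
Qed.

(** The semigroup law multiplies the local bound along steps of length [d]. *)
Lemma sg_bounded_on (b : R) : exists2 M : R, 0 <= M &
  forall (t : R) x, 0 <= t <= b -> rnorm (T t x) <= M * rnorm x.
Proof.
have [d [M [d0 M0 MP]]] := sg_locally_bounded.
have [n bn] : exists n : nat, b <= n%:R * d.
  exists (Num.truncn (b / d)).+1; rewrite -ler_pdivrMr// ltW//.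
  exact: truncnS_gt.
suff [N N0 NP] : exists2 N : R, 0 <= N & forall t x, 0 <= t <= n%:R * d -> rnorm (T t x) <= N * rnorm x.
  by exists N => // t x /andP[t0 tb]; apply: NP; rewrite t0 (le_trans tb).
elim: n {bn} => [|n [N N0 NP]].
  exists 1 => // t x; rewrite mul0r -eq_le => /eqP <-.
  by rewrite sg0 mul1r.
exists (N + N * M); first by rewrite addr_ge0 ?mulr_ge0.
move=> t x /andP[t0 tn]; have [tle|tlt] := leP t (n%:R * d).
  by rewrite (le_trans (NP _ _ _)) ?t0// ler_wpM2r ?rnorm_ge0// lerDl mulr_ge0.
have nd0 : 0 <= n%:R * d by rewrite mulr_ge0// ltW.
rewrite -[t](subrKC (n%:R * d)) sgD//; last by rewrite subr_ge0 ltW.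
rewrite (le_trans (NP _ _ _)) ?nd0 ?lexx// mulrDl -mulrA.
apply: (@le_trans _ _ (N * (M * rnorm x))); last by rewrite lerDr mulr_ge0 ?rnorm_ge0.
rewrite ler_wpM2l// MP// subr_ge0 (ltW tlt)/= lerBlDl.
by move: tn; rewrite -natr1 mulrDl mul1r.
Qed.

Lemma sg_cont (x : X) (b : R) : cont_on (fun t => T t x) 0 b.
Proof.
have [M M0 MP] := sg_bounded_on b.
move=> t e /andP[t0 tb] e0.
have e'0 : 0 < e / (M + 1) by rewrite divr_gt0// ltr_wpDl.
have /rcvgP/(_ _ e'0)/at_right0P[d d0 dP] := @sg_continuous _ _ T x.
have key s r : 0 <= s -> s < r -> r <= b -> r - s < d -> rnorm (T r x - T s x) < e.
  move=> s0 sr rb rsd; rewrite -[r](subrKC s) sgD// ?subr_ge0 ?(ltW sr)//.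
  rewrite -(linB (sg_linear s0)).
  apply: le_lt_trans (MP _ _ _) _; first by rewrite s0 (le_trans (ltW sr)).
  have hd : rnorm (T (r - s) x - x) < e / (M + 1) by apply: dP; rewrite subr_gt0 sr.
  apply: le_lt_trans (ler_wpM2l M0 (ltW hd)) _.
  rewrite mulrCA gtr_pMr// ltr_pdivrMr ?mul1r ?ltrDl// ltr_wpDl//.
exists d => // s /andP[s0 sb]; have [st ds|ts ds|<- _] := ltgtP s t.
- by rewrite rdistC; apply: key => //; apply: le_lt_trans (ler_norm _) _; rewrite distrC.
- by apply: key => //; apply: le_lt_trans (ler_norm _) _.
- by rewrite subrr rnorm0.
Qed.

(** The function [s |-> cexp (- s l) T(s) phi] is constant: its increment from [x]
    to [y] is [T(x)] applied to an increment from 0 to [y - x], so the derivative at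
    0 from the right and the bound on [T(x)] are enough. *)
Lemma sg_eigen (phi : X) (l : R[i]) :
  (h^-1)%:C *: (T h phi - phi) @[h --> 0^'+] --> l *: phi ->
  forall t, 0 <= t -> T t phi = cexp (t%:C * l) *: phi.
Proof.
move=> der b b0.
have [M M0 MP] := sg_bounded_on b.
suff : cexp (- (b%:C * l)) *: T b phi = phi.
  move=> E; rewrite -{2}E scalerA -cexpD addrN cexp0 scale1r.
  by [].
have [N N0 NP] : exists2 N : R, 0 <= N & forall s, 0 <= s <= b -> cabs (cexp (- (s%:C * l))) <= N.
  exists (expR (b * `|complex.Re l|)) => [|s /andP[s0 sb]]; first exact: expR_ge0.
  rewrite cabs_cexp ler_expR raddfN/= ReZ -mulrN.
  apply: le_trans (ler_wpM2l s0 (ler_norm _)) _.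
  by rewrite normrN ler_wpM2r.
have E0 : cexp (- (0%:C * l)) *: T 0 phi = phi.
  by rewrite mul0r oppr0 cexp0 scale1r sg0.
rewrite -[RHS]E0.
apply: (@straddle_const _ _ (fun s => cexp (- (s%:C * l)) *: T s phi) 0 b b0).
move=> e t e0 tab.
pose K := N * M * N * (1 + rnorm phi) + 1.
have K0 : 0 < K.
  by rewrite ltr_wpDl// !mulr_ge0// addr_ge0 ?rnorm_ge0.
have e'0 : 0 < e / K by rewrite divr_gt0.
have /rcvgP/(_ _ e'0)/at_right0P[d d0 dP] := der.
have [d' d'0 d'P] := @cexp_small _ l _ e'0.
exists (Num.min d d' / 2); first by rewrite divr_gt0// lt_min d0.
move=> x y x0 tx xt ty ty' yb.
have /andP[hd hd'] : (y - x < d) && (y - x < d') by rewrite -lt_min; lra.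
have [<-|xy] := eqVneq x y; first by rewrite !subrr rnorm0 mulr0.
have h0 : 0 < y - x by rewrite subr_gt0 lt_neqAle xy; lra.
have xb : 0 <= x <= b by apply/andP; split; lra.
have hb : 0 <= y - x <= b by apply/andP; split; lra.
rewrite -[y in T y](subrKC x) sgD ?(ltW h0)//.
set h := y - x in hd hd' h0 hb *.
have -> : cexp (- (y%:C * l)) = cexp (- (x%:C * l)) * cexp (- (h%:C * l)).
  by rewrite -cexpD -opprD -mulrDl -rmorphD/= subrKC.
rewrite -scalerA -(linZ (sg_linear x0)) -scalerBr -(linB (sg_linear x0)) rnormZ.
have r1 : rnorm (T h phi - phi - h%:C *: (l *: phi)) <= e / K * h.
  have /ltW : rnorm ((h^-1)%:C *: (T h phi - phi) - l *: phi) < e / K.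
    by apply: dP; rewrite h0.
  rewrite -(ler_pM2r h0); apply: le_trans.
  have -> : T h phi - phi - h%:C *: (l *: phi) =
      h%:C *: ((h^-1)%:C *: (T h phi - phi) - l *: phi).
    by rewrite scalerBr [in RHS]scalerA -rmorphM/= divff ?gt_eqF// scale1r.
  by rewrite rnormZ cabsR gtr0_norm// mulrC.
have r2 : cabs (cexp (h%:C * l) - 1 - h%:C * l) <= e / K * h.
  by have := d'P h; rewrite (gtr0_norm h0); apply.
have -> : cexp (- (h%:C * l)) *: T h phi - phi =
    cexp (- (h%:C * l)) *: ((T h phi - phi - h%:C *: (l *: phi)) -
      (cexp (h%:C * l) - 1 - h%:C * l) *: phi).
  have aux (t' p' c' e' : X) : t' - p' - c' - (e' - p' - c') = t' - e'.
    by rewrite -[t' - p' - c']addrA -[e' - p' - c']addrA -!opprD opprB subrKA.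
  rewrite !scalerBl scale1r scalerA aux.
  by rewrite scalerBr scalerA cexpN scale1r.
set A := T h phi - _ - _ in r1 *; set B := _ - 1 - _ in r2 *.
have r3 : rnorm (A - B *: phi) <= e / K * h * (1 + rnorm phi).
  rewrite (le_trans (ler_rnormB _ _))// mulrDr mulr1 rnormZ lerD//.
  by rewrite ler_wpM2r ?rnorm_ge0.
have hK : 0 <= e / K * h by rewrite mulr_ge0// ltW.
have q1 := NP _ xb; have q2 := MP _ (cexp (- (h%:C * l)) *: (A - B *: phi)) xb.
apply: le_trans (ler_pM (rnorm_ge0 _) (rnorm_ge0 _) q1 q2) _.
rewrite rnormZ.
apply: (@le_trans _ _ (N * (M * (N * (e / K * h * (1 + rnorm phi)))))).
  rewrite !ler_wpM2l// ler_pM ?rnorm_ge0// NP//.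
have -> : N * (M * (N * (e / K * h * (1 + rnorm phi)))) =
  e * h * ((K - 1) / K) by rewrite /K; field; rewrite gt_eqF.
rewrite ler_piMr//; first by rewrite mulr_ge0 ?ltW.
by rewrite ler_pdivrMr// mul1r lerBlDr lerDl.
Qed.

End Semigroup.

(** * Bochner integration *)

Section SimpleFunctions.
Context {R : realType} {V : normedModType R[i]}.
Local Notation mu := (@lebesgue_measure R).
Implicit Types D E : set R.

(** An arbitrary finite index type lets sums and products of simple functions be
    indexed by sums and products of their index types. *)
Lemma simple_of D (I : finType) (A : I -> set R) (v : I -> V) :
  (forall i, measurable (A i)) -> (forall i, A i `<=` D) ->
  (forall i, (mu (A i) < +oo)%E) ->
  exists s : simple_fun D,
    sf_fun s = (fun t => \sum_i (\1_(A i) t)%:C *: v i) /\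
    sf_int s = \sum_i (fine (mu (A i)))%:C *: v i.
Proof.
move=> mA AD fA.
pose A' (k : 'I_#|I|) := A (enum_val k); pose v' (k : 'I_#|I|) := v (enum_val k).
exists (@SimpleFun R V D #|I| A' v' (fun k => mA _) (fun k => AD _) (fun k => fA _)).
have re (F : I -> V) : \sum_(k < #|I|) F (enum_val k) = \sum_i F i.
  by rewrite [RHS](reindex _ (onW_bij _ (@enum_val_bij I))).
by split; [apply/funext => t; exact: re|exact: re].
Qed.

Lemma sf_fun_out D (s : simple_fun (V:=V) D) t : ~ D t -> sf_fun s t = 0.
Proof.
move=> nDt; rewrite /sf_fun big1// => i _.
rewrite indicE memNset ?scale0r// => ti; apply: nDt.
exact: sf_sub ti.
Qed.

Lemma sf_lin D (a : R[i]) (s s' : simple_fun (V:=V) D) : exists s'' : simple_fun (V:=V) D,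
  sf_fun s'' = (fun t => a *: sf_fun s t + sf_fun s' t) /\
  sf_int s'' = a *: sf_int s + sf_int s'.
Proof.
have [|||s'' [fE iE]] := @simple_of D ('I_(sf_size s) + 'I_(sf_size s'))%type
  (fun i => match i with inl j => sf_set (s:=s) j | inr j => sf_set (s:=s') j end)
  (fun i => match i with inl j => a *: sf_val (s:=s) j | inr j => sf_val (s:=s') j end).
- by case=> j; exact: sf_measurable.
- by case=> j; exact: sf_sub.
- by case=> j; exact: sf_finite.
exists s''; rewrite fE iE; split.
  apply/funext => t; rewrite big_sumType/= /sf_fun scaler_sumr.
  by congr (_ + _); apply: eq_bigr => i _; rewrite !scalerA mulrC.
rewrite big_sumType/= /sf_int scaler_sumr.
by congr (_ + _); apply: eq_bigr => i _; rewrite !scalerA mulrC.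
Qed.

Lemma lebesgue_finite_sub (A B : set R) : measurable A -> measurable B ->
  A `<=` B -> (mu B < +oo)%E -> (mu A < +oo)%E.
Proof. by move=> mA mB AB; apply: le_lt_trans; apply: le_measure; rewrite ?inE. Qed.

Lemma sf_restrict D E (s : simple_fun (V:=V) D) : measurable E ->
  exists s' : simple_fun (V:=V) E, sf_fun s' = (fun t => (\1_E t)%:C *: sf_fun s t).
Proof.
move=> mE.
have [|||s'' [fE iE]] := @simple_of E 'I_(sf_size s)
  (fun i => E `&` sf_set (s:=s) i) (fun i => sf_val (s:=s) i).
- by move=> i; apply: measurableI => //; exact: sf_measurable.
- by move=> i; exact: subIsetl.
- move=> i; apply: lebesgue_finite_sub (sf_finite (s:=s) i).
  + by apply: measurableI => //; exact: sf_measurable.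
  + exact: sf_measurable.
  + exact: subIsetr.
exists s''; rewrite fE; apply/funext => t; rewrite /sf_fun scaler_sumr.
by apply: eq_bigr => i _; rewrite scalerA -rmorphM/= indicI.
Qed.

Lemma sf_widen D E (s : simple_fun (V:=V) E) : E `<=` D ->
  exists s' : simple_fun (V:=V) D, sf_fun s' = sf_fun s /\ sf_int s' = sf_int s.
Proof.
move=> ED; have [|||s' [fE iE]] := @simple_of D 'I_(sf_size s)
  (fun i => sf_set (s:=s) i) (fun i => sf_val (s:=s) i).
- exact: sf_measurable.
- by move=> i; apply: subset_trans ED; exact: sf_sub.
- exact: sf_finite.
by exists s'; rewrite fE iE.
Qed.

Lemma measurable_rnorm_sum n (A : 'I_n -> set R) (v : 'I_n -> V) (w : V) :
  (forall i, measurable (A i)) ->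
  measurable_fun setT (fun t => rnorm (w + \sum_(i < n) (\1_(A i) t)%:C *: v i)).
Proof.
elim: n A v w => [|n IH] A v w mA.
  by under eq_fun do rewrite big_ord0; exact: measurable_cst.
rewrite (_ : (fun t => _) = (fun t => if t \in A ord0 then
    rnorm (w + v ord0 + \sum_(i < n) (\1_(A (lift ord0 i)) t)%:C *: v (lift ord0 i)) else
    rnorm (w + \sum_(i < n) (\1_(A (lift ord0 i)) t)%:C *: v (lift ord0 i)))); last first.
  apply/funext => t; rewrite big_ord_recl indicE.
  by case: ifP => _; rewrite ?scale1r ?scale0r ?add0r// addrA.
apply: measurable_fun_ifT; [|exact: IH|exact: IH].
by apply: (measurable_fun_bool true); rewrite setTI preimage_mem_true.
Qed.

Lemma measurable_rnorm_sf D (s : simple_fun (V:=V) D) (w : V) :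
  measurable_fun setT (fun t => rnorm (w + sf_fun s t)).
Proof. by apply: measurable_rnorm_sum => i; exact: sf_measurable. Qed.

(** Splitting the domain by one set of the family at a time avoids rewriting
    the simple function over disjoint sets. *)
Lemma rnorm_sum_le n (A : 'I_n -> set R) (v : 'I_n -> V) (E : set R) (w : V) :
  (forall i, measurable (A i)) -> (forall i, (mu (A i) < +oo)%E) ->
  measurable E -> (w = 0 \/ (mu E < +oo)%E) ->
  ((rnorm ((fine (mu E))%:C *: w + \sum_(i < n) (fine (mu (A i `&` E)))%:C *: v i))%:E
   <= \int[mu]_(t in E) (rnorm (w + \sum_(i < n) (\1_(A i) t)%:C *: v i))%:E)%E.
Proof.
move=> mA fA; elim: n A v mA fA E w => [|n IH] A v mA fA E w mE wE.
  rewrite big_ord0 addr0; under eq_integral do rewrite big_ord0 addr0.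
  rewrite integral_cst//; case: wE => [->|fE].
    by rewrite scaler0 rnorm0 mul0e.
  rewrite rnormZ cabsR ger0_norm ?fine_ge0// EFinM muleC fineK//.
  by rewrite ge0_fin_numE.
set A0 := A ord0; have mA0 : measurable A0 by exact: mA.
pose F t : \bar R := (rnorm (w + \sum_(i < n.+1) (\1_(A i) t)%:C *: v i))%:E.
rewrite [leRHS](_ : _ = (\int[mu]_(t in E) F t)%E)//.
have mF D : measurable_fun D F.
  apply: measurable_funTS; apply/measurable_EFinP; exact: measurable_rnorm_sum.
have -> : (\int[mu]_(t in E) F t =
    \int[mu]_(t in E `&` A0) F t + \int[mu]_(t in E `\` A0) F t)%E.
  rewrite -{1}(setUIDK E A0) ge0_integral_setU//.
  - exact: measurableI.
  - exact: measurableD.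
  - exact: mF.
  - by move=> t _; rewrite lee_fin rnorm_ge0.
  - by apply/disj_set2P; rewrite setDE setIACA setICr setI0.
have mEA : measurable (E `&` A0) by exact: measurableI.
have mED : measurable (E `\` A0) by exact: measurableD.
have fEA : (mu (E `&` A0) < +oo)%E.
  by apply: lebesgue_finite_sub (fA ord0) => //; exact: subIsetr.
have IH1 := IH (A \o lift ord0) (v \o lift ord0) (fun i => mA _) (fun i => fA _)
  (E `&` A0) (w + v ord0) mEA (or_intror fEA).
have wED : w = 0 \/ (mu (E `\` A0) < +oo)%E.
  case: wE => [|fE]; [by left|right].
  by apply: lebesgue_finite_sub fE => //; exact: subDsetl.
have IH2 := IH (A \o lift ord0) (v \o lift ord0) (fun i => mA _) (fun i => fA _)
  (E `\` A0) w mED wED.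
have msplit B : measurable B -> (mu B < +oo)%E ->
    fine (mu B) = fine (mu (B `&` A0)) + fine (mu (B `\` A0)).
  move=> mB fB; rewrite -fineD ?ge0_fin_numE//.
  - by rewrite addeC -measureDI.
  - by apply: lebesgue_finite_sub fB => //; exact: measurableI.
  - by apply: lebesgue_finite_sub fB => //; exact: measurableD.
have F1 : (\int[mu]_(t in E `&` A0) F t = \int[mu]_(x in E `&` A0)
    (rnorm (w + v ord0 + \sum_(i < n) (\1_((A \o lift ord0) i) x)%:C *: (v \o lift ord0) i))%:E)%E.
  apply: eq_integral => t /set_mem[_ A0t]; rewrite /F big_ord_recl indicE mem_set//.
  by rewrite scale1r addrA.
have F2 : (\int[mu]_(t in E `\` A0) F t = \int[mu]_(x in E `\` A0)
    (rnorm (w + \sum_(i < n) (\1_((A \o lift ord0) i) x)%:C *: (v \o lift ord0) i))%:E)%E.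
  apply: eq_integral => t /set_mem[_ A0t]; rewrite /F big_ord_recl indicE memNset//.
  by rewrite scale0r add0r.
rewrite F1 F2; apply: le_trans (leeD IH1 IH2).
rewrite -EFinD lee_fin; apply: le_trans (ler_rnormD _ _).
rewrite le_eqVlt; apply/orP; left; apply/eqP; congr rnorm.
have wS : (fine (mu E))%:C *: w =
    (fine (mu (E `&` A0)))%:C *: w + (fine (mu (E `\` A0)))%:C *: w.
  case: wE => [->|fE]; first by rewrite !scaler0 addr0.
  by rewrite (msplit E)// rmorphD/= scalerDl.
rewrite wS big_ord_recl scalerDr.
have -> : \sum_(i < n) (fine (mu (A (lift ord0 i) `&` E)))%:C *: v (lift ord0 i) =
    \sum_(i < n) (fine (mu ((A \o lift ord0) i `&` (E `&` A0))))%:C *: (v \o lift ord0) i +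
    \sum_(i < n) (fine (mu ((A \o lift ord0) i `&` (E `\` A0))))%:C *: (v \o lift ord0) i.
  rewrite -big_split/=; apply: eq_bigr => i _.
  have mAE : measurable (A (lift ord0 i) `&` E) by apply: measurableI.
  have fAE : (mu (A (lift ord0 i) `&` E) < +oo)%E.
    by apply: lebesgue_finite_sub (fA (lift ord0 i)).
  by rewrite -scalerDl -rmorphD/= setIA setIDA -msplit.
rewrite (setIC A0 E) !addrA; congr (_ + _).
by rewrite [X in X + _ = _]addrAC [LHS]addrAC.
Qed.

Lemma rnorm_sf_int_le D (s : simple_fun (V:=V) D) : measurable D ->
  ((rnorm (sf_int s))%:E <= \int[mu]_(t in D) (rnorm (sf_fun s t))%:E)%E.
Proof.
move=> mD; have := @rnorm_sum_le _ (sf_set (s:=s)) (sf_val (s:=s)) D 0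
  (fun i => sf_measurable i) (fun i => sf_finite i) mD (or_introl erefl).
rewrite scaler0 add0r; under eq_bigr => i _ do rewrite (setIidl (@sf_sub _ _ _ s i)).
by under eq_integral do rewrite add0r.
Qed.

End SimpleFunctions.

Section BochnerIntegral.
Context {R : realType}.
Local Notation mu := (@lebesgue_measure R).
Implicit Types (D E : set R) (V : normedModType R[i]).

Lemma ecvg0P (u : nat -> \bar R) : (forall n, (0 <= u n)%E) ->
  u @ \oo --> 0%E <-> forall e : R, 0 < e -> \forall n \near \oo, (u n < e%:E)%E.
Proof.
move=> u0; split=> [/fine_cvgP[fin /cvgrPdist_lt ul] e e0|ul].
  have le := ul _ e0; near=> n.
  have un : u n \is a fin_num by near: n.
  have : `|0 - fine (u n)| < e by near: n.
  by rewrite sub0r normrN ger0_norm ?fine_ge0// -lte_fin fineK.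
apply/fine_cvgP; split.
  by have := ul _ ltr01; apply: filterS => n un; rewrite ge0_fin_numE// (lt_trans un)// ltry.
apply/cvgrPdist_lt => e /ul; apply: filterS => n un.
have fin : u n \is a fin_num by rewrite ge0_fin_numE// (lt_trans un)// ltry.
by rewrite sub0r normrN ger0_norm ?fine_ge0// -lte_fin fineK.
Unshelve. all: by end_near. Qed.

Lemma fin_num_lt (x : \bar R) (e : R) : (0 <= x)%E -> (x < e%:E)%E -> x \is a fin_num.
Proof. by move=> x0 xe; rewrite ge0_fin_numE// (lt_trans xe)// ltry. Qed.

Definition l1dist V D (f g : R -> V) : \bar R :=
  (\int[mu]_(t in D) (rnorm (f t - g t))%:E)%E.

Lemma l1dist_ge0 V D (f g : R -> V) : (0 <= l1dist D f g)%E.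
Proof. by apply: integral_ge0 => t _; rewrite lee_fin rnorm_ge0. Qed.

Lemma sm_sf V D (s : simple_fun (V:=V) D) : strongly_measurable D (sf_fun s).
Proof. by exists (fun=> s) => t _; exact: cvg_cst. Qed.

Lemma sm_lin V D (a : R[i]) (f g : R -> V) : strongly_measurable D f ->
  strongly_measurable D g -> strongly_measurable D (fun t => a *: f t + g t).
Proof.
move=> [s sf] [s' s'g].
have [s'' s''P] := choice (fun n => sf_lin a (s n) (s' n)).
exists s'' => t Dt; under eq_fun do rewrite (s''P _).1.
by apply: cvgD; [apply: cvgZr; exact: sf|exact: s'g].
Qed.

Lemma sm_sub V D (f g : R -> V) : strongly_measurable D f ->
  strongly_measurable D g -> strongly_measurable D (fun t => f t - g t).
Proof.
move=> mf mg; have := sm_lin (-1) mg mf.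
by under eq_fun do rewrite scaleN1r addrC.
Qed.

Lemma sm_rnorm V D (f : R -> V) : measurable D -> strongly_measurable D f ->
  measurable_fun D (fun t => (rnorm (f t))%:E).
Proof.
move=> mD [s sf]; apply/measurable_EFinP.
apply: (@measurable_fun_cvg _ _ _ _ (fun n t => rnorm (sf_fun (s n) t))) => [n|t Dt].
  apply: measurable_funTS.
  by have := measurable_rnorm_sf (s n) 0; under eq_fun do rewrite add0r.
exact: cvg_rnorm (sf _ Dt).
Qed.

Lemma sm_l1dist V D (f g : R -> V) : measurable D -> strongly_measurable D f ->
  strongly_measurable D g -> measurable_fun D (fun t => (rnorm (f t - g t))%:E).
Proof. by move=> mD mf mg; apply: sm_rnorm => //; exact: sm_sub. Qed.

Lemma bochner_sm V D (f : R -> V) v : is_bochner D f v -> strongly_measurable D f.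
Proof. by move=> [s [sf _ _]]; exists s. Qed.

Lemma l1dist_lin V D (a : R[i]) (f g f' g' : R -> V) : measurable D ->
  strongly_measurable D f -> strongly_measurable D g ->
  strongly_measurable D f' -> strongly_measurable D g' ->
  (l1dist D (fun t => a *: f t + g t)%R (fun t => a *: f' t + g' t)%R <=
   (cabs a)%:E * l1dist D f f' + l1dist D g g')%E.
Proof.
move=> mD mf mg mf' mg'; have a0 := @rnorm_ge0 _ (CC R) a.
have mff' := sm_l1dist mD mf mf'; have mgg' := sm_l1dist mD mg mg'.
rewrite /l1dist -ge0_integralZl//; last first.
  by move=> t _; rewrite lee_fin rnorm_ge0.
rewrite -ge0_integralD//;
  [|by move=> t _; rewrite mule_ge0// lee_fin ?rnorm_ge0|exact: measurable_funeM
   |by move=> t _; rewrite lee_fin rnorm_ge0].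
apply: ge0_le_integral => //.
- by move=> t _; rewrite lee_fin rnorm_ge0.
- by apply: sm_l1dist => //; exact: sm_lin.
- by apply: emeasurable_funD => //; exact: measurable_funeM.
move=> t _; rewrite -EFinM -EFinD lee_fin -rnormZ.
by rewrite opprD addrACA -scalerBr ler_rnormD.
Qed.

Lemma l1dist_triangle V D (h f g : R -> V) : measurable D ->
  strongly_measurable D f -> strongly_measurable D g -> strongly_measurable D h ->
  (l1dist D f g <= l1dist D f h + l1dist D h g)%E.
Proof.
move=> mD mf mg mh.
have mfh := sm_l1dist mD mf mh; have mhg := sm_l1dist mD mh mg.
rewrite /l1dist -ge0_integralD//; try by move=> t _; rewrite lee_fin rnorm_ge0.
apply: ge0_le_integral => //.
- by move=> t _; rewrite lee_fin rnorm_ge0.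
- exact: sm_l1dist.
- exact: emeasurable_funD.
by move=> t _; rewrite -EFinD lee_fin ler_rdistD.
Qed.

Lemma l1distC V D (f g : R -> V) : l1dist D f g = l1dist D g f.
Proof. by apply: eq_integral => t _; rewrite rdistC. Qed.

Lemma sf_int_dist V D (s s' : simple_fun (V:=V) D) : measurable D ->
  ((rnorm (sf_int s - sf_int s'))%:E <= l1dist D (sf_fun s) (sf_fun s'))%E.
Proof.
move=> mD; have [s'' [sE iE]] := sf_lin (-1) s' s.
have := rnorm_sf_int_le s'' mD; rewrite iE sE scaleN1r addrC.
by under eq_integral do rewrite scaleN1r addrC.
Qed.

Lemma l1dist0 V D (f : R -> V) :
  l1dist D f (cst 0%R) = (\int[mu]_(t in D) (rnorm (f t))%:E)%E.
Proof. by apply: eq_integral => t _; rewrite subr0. Qed.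

Lemma sf_int_le V D (s : simple_fun (V:=V) D) : measurable D ->
  ((rnorm (sf_int s))%:E <= l1dist D (sf_fun s) (cst 0%R))%E.
Proof.
move=> mD; apply: le_trans (rnorm_sf_int_le s mD) _.
by rewrite l1dist0.
Qed.

Lemma sm_cst0 V D : strongly_measurable D (cst 0 : R -> V).
Proof.
have [|||s [sE _]] := @simple_of R V D 'I_0 (fun=> set0) (fun=> 0); try by case.
by exists (fun=> s) => t _; rewrite sE /= big_ord0; exact: cvg_cst.
Qed.

(** The triangle inequality passes from simple functions to their limits in mean;
    uniqueness of the integral follows from it. *)
Lemma le_bochner V D (f : R -> V) v : measurable D -> is_bochner D f v ->
  ((rnorm v)%:E <= \int[mu]_(t in D) (rnorm (f t))%:E)%E.
Proof.
move=> mD bf; have mf := bochner_sm bf; move: bf => [s [sf sL sv]].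
apply/lee_addgt0Pr => e e0; have e20 : 0 < e / 2 by rewrite divr_gt0.
have /ecvg0P/(_ _ e20) h1 := sL; move/rcvgP/(_ _ e20) : sv => h2.
have [n [{}h1 {}h2]] : exists n, (l1dist D f (sf_fun (s n)) < (e / 2)%:E)%E /\
    rnorm (sf_int (s n) - v) < e / 2.
  near \oo => n; exists n; split; last by near: n.
  by near: n; apply: h1 => m; exact: l1dist_ge0.
have ms := sm_sf (s n).
have k1 := sf_int_le (s n) mD.
have k2 := l1dist_triangle mD ms (@sm_cst0 V D) mf.
apply: (@le_trans _ _ ((e / 2)%:E + (rnorm (sf_int (s n)))%:E)%E).
  have := ler_rnormD (v - sf_int (s n)) (sf_int (s n)); rewrite subrK rdistC.
  by rewrite -EFinD lee_fin => /le_trans; apply; rewrite lerD2r ltW.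
rewrite [e in leRHS]splitr EFinD addeCA; apply: leeD => //; rewrite [leRHS]addeC.
apply: le_trans k1 _; apply: le_trans k2 _; apply: leeD.
  by rewrite l1distC ltW.
by rewrite l1dist0.
Unshelve. all: by end_near. Qed.

Lemma bochner_lin V D (a : R[i]) (f g : R -> V) v w : measurable D ->
  is_bochner D f v -> is_bochner D g w ->
  is_bochner D (fun t => a *: f t + g t) (a *: v + w).
Proof.
move=> mD bf bg; have mf := bochner_sm bf; have mg := bochner_sm bg.
move: bf bg => [s [sf sL sv]] [s' [s'f s'L s'v]].
have [s'' s''P] := choice (fun n => sf_lin a (s n) (s' n)).
exists s''; split.
- move=> t Dt; under eq_fun do rewrite (s''P _).1.
  by apply: cvgD; [apply: cvgZr; exact: sf|exact: s'f].
- apply/ecvg0P => [n|e e0]; first exact: l1dist_ge0.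
  have a0 := @rnorm_ge0 _ (CC R) a.
  have e1 : 0 < e / 2 / (cabs a + 1) by rewrite !divr_gt0// ltr_wpDl.
  have e2 : 0 < e / 2 by rewrite divr_gt0.
  have h1 := (ecvg0P (fun n => l1dist_ge0 D f (sf_fun (s n)))).1 sL _ e1.
  have h2 := (ecvg0P (fun n => l1dist_ge0 D g (sf_fun (s' n)))).1 s'L _ e2.
  near=> n; rewrite (s''P n).1.
  apply: le_lt_trans (l1dist_lin a mD mf mg (sm_sf (s n)) (sm_sf (s' n))) _.
  rewrite [e]splitr EFinD; apply: lee_ltD => //.
  + rewrite fin_numM//; apply: (@fin_num_lt _ (e / 2 / (cabs a + 1))).
      exact: l1dist_ge0.
    by near: n; exact: h1.
  + apply: (@le_trans _ _ ((cabs a)%:E * (e / 2 / (cabs a + 1))%:E)%E).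
      by apply: lee_wpmul2l; rewrite ?lee_fin// ltW//; near: n.
    rewrite -EFinM lee_fin mulrCA ler_piMr ?(ltW e2)//.
    by rewrite ler_pdivrMr ?mul1r ?lerDl// ltr_wpDl.
  + by near: n.
- under eq_fun do rewrite (s''P _).2.
  by apply: cvgD => //; exact: cvgZr.
Unshelve. all: by end_near. Qed.

Lemma bochner_eq V D (f g : R -> V) v : (forall t, D t -> f t = g t) ->
  is_bochner D f v -> is_bochner D g v.
Proof.
move=> fg [s [sf sL sv]]; exists s; split=> //.
  by move=> t Dt; rewrite -fg//; exact: sf.
suff E n : (\int[mu]_(t in D) (rnorm (g t - sf_fun (s n) t))%:E =
  \int[mu]_(t in D) (rnorm (f t - sf_fun (s n) t))%:E)%E by under eq_fun do rewrite E.
by apply: eq_integral => t /set_mem Dt; rewrite fg.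
Qed.

Lemma bochner_unique V D (f : R -> V) v w : measurable D ->
  is_bochner D f v -> is_bochner D f w -> v = w.
Proof.
move=> mD bv bw; have := bochner_lin (-1) mD bv bw.
move=> /(le_bochner mD); under eq_integral do rewrite scaleN1r addNr rnorm0.
rewrite integral0 lee_fin scaleN1r addrC => h; apply/esym/eqP; rewrite -subr_eq0.
by apply/eqP/rnorm_eq0/eqP; rewrite eq_le h rnorm_ge0.
Qed.

Lemma bochnerE V D (f : R -> V) v : measurable D -> is_bochner D f v -> bochner D f = v.
Proof.
move=> mD bv; rewrite /bochner; case: xgetP => [w _ bw|/(_ v)//].
exact: bochner_unique bw bv.
Qed.

Lemma bochnerP V D (f : R -> V) : bochner_integrable D f -> is_bochner D f (bochner D f).
Proof. by move=> [v bv]; rewrite /bochner; case: xgetP => [//|/(_ v)]. Qed.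

(** Convergence in mean makes the integrals of the simple functions a Cauchy
    sequence; completeness supplies the value of the integral. *)
Lemma bochner_exists (V : completeNormedModType R[i]) D (f : R -> V)
    (s : nat -> simple_fun (V:=V) D) : measurable D ->
  (forall t, D t -> sf_fun (s n) t @[n --> \oo] --> f t) ->
  l1dist D f (sf_fun (s n)) @[n --> \oo] --> 0%E ->
  bochner_integrable D f.
Proof.
move=> mD sf sL; have mf : strongly_measurable D f by exists s.
have [l sl] : exists l : V, (fun n => sf_int (s n)) @ \oo --> l.
  apply: rcauchy_cvg => e e0; have e2 : 0 < e / 2 by rewrite divr_gt0.
  have [N _ NP] := (ecvg0P (fun n => l1dist_ge0 D f (sf_fun (s n)))).1 sL _ e2.
  exists N => m n Nm Nn; rewrite -lte_fin.
  apply: le_lt_trans (sf_int_dist (s m) (s n) mD) _.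
  apply: le_lt_trans (l1dist_triangle mD (sm_sf _) (sm_sf _) mf) _.
  rewrite [e]splitr EFinD l1distC; apply: lte_leD; rewrite ?NP//.
  + by apply: fin_num_lt (NP _ Nn); exact: l1dist_ge0.
  + by apply/ltW/NP.
by exists l; exists s; split.
Qed.

(** The images of the approximating simple functions approximate the image.  Applied
    to coordinate functionals, this reduces vector-valued integrals to scalar ones. *)
Lemma bochner_bounded_op V (W : normedModType R[i]) D (F : V -> W) (f : R -> V) v :
  measurable D -> bounded_op F ->
  is_bochner D f v -> is_bochner D (F \o f) (F v).
Proof.
move=> mD bF bf; have mf := bochner_sm bf; move: bf => [s [sf sL sv]].
have [lF [M M0 FM]] := (bounded_opP F).1 bF.
have Fs n : exists s' : simple_fun (V:=W) D,
    sf_fun s' = F \o sf_fun (s n) /\ sf_int s' = F (sf_int (s n)).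
  have [|||s' [sE iE]] := @simple_of R W D 'I_(sf_size (s n))
    (fun i => sf_set (s:=s n) i) (fun i => F (sf_val (s:=s n) i)).
  - exact: sf_measurable.
  - exact: sf_sub.
  - exact: sf_finite.
  exists s'; rewrite sE iE; split; [apply/funext => t /=|];
  rewrite (lin_sum lF); by apply: eq_bigr => i _; rewrite (linZ lF).
have [s' s'P] := choice Fs; exists s'; split.
- by move=> t Dt; under eq_fun do rewrite (s'P _).1; apply: bounded_op_cvg => //; exact: sf.
- have M1 : 0 < M + 1 by rewrite ltr_wpDl.
  apply/ecvg0P => [n|e e0]; first exact: l1dist_ge0.
  have e1 : 0 < e / (M + 1) by rewrite divr_gt0.
  have := (ecvg0P (fun n => l1dist_ge0 D f (sf_fun (s n)))).1 sL _ e1.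
  apply: filterS => n h.
  apply: (@le_lt_trans _ _ ((M + 1)%:E * l1dist D f (sf_fun (s n)))%E); last first.
    by rewrite -lte_pdivlMl// -EFinM mulrC.
  have mfs := sm_l1dist mD mf (sm_sf (s n)).
  rewrite /l1dist -ge0_integralZl//; last 2 first.
  - by move=> t _; rewrite lee_fin rnorm_ge0.
  - by rewrite lee_fin ltW.
  apply: ge0_le_integral => //.
  - by move=> t _; rewrite lee_fin rnorm_ge0.
  - apply: sm_l1dist => //; last exact: sm_sf.
    exists s' => t Dt; under eq_fun do rewrite (s'P _).1.
    by apply: bounded_op_cvg => //; exact: sf.
  - exact: measurable_funeM.
  move=> t _; rewrite -EFinM lee_fin (s'P n).1 /= -(linB lF).
  by rewrite (le_trans (FM _))// ler_wpM2r ?rnorm_ge0// lerDl.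
- by under eq_fun do rewrite (s'P _).2; exact: bounded_op_cvg.
Qed.

End BochnerIntegral.

Section BochnerDomains.
Context {R : realType}.
Local Notation mu := (@lebesgue_measure R).
Implicit Types (D E : set R) (V : normedModType R[i]).

Lemma bochner_widen V D E (f : R -> V) v : measurable D -> measurable E -> E `<=` D ->
  (forall t, D t -> ~ E t -> f t = 0) -> is_bochner E f v -> is_bochner D f v.
Proof.
move=> mD mE ED f0 [s [sf sL sv]].
have [s' s'P] := choice (fun n => sf_widen (s n) ED).
exists s'; split.
- move=> t Dt; under eq_fun do rewrite (s'P _).1.
  have [Et|nEt] := pselect (E t); first exact: sf.
  rewrite f0//; under eq_fun do rewrite sf_fun_out//.
  exact: cvg_cst.
- rewrite (_ : (fun n => _) = (fun n => l1dist E f (sf_fun (s n)))) //.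
  apply/funext => n; rewrite (s'P n).1 /l1dist.
  rewrite -{2}(setIidr ED) [RHS]integral_mkcondr; apply: eq_integral => t /set_mem Dt.
  rewrite /patch; case: ifPn => // /negP nE.
  have nEt : ~ E t by move=> Et; apply: nE; exact/mem_set.
  by rewrite f0// sf_fun_out// subr0 rnorm0.
- by under eq_fun do rewrite (s'P _).2.
Qed.

Lemma bochner_restrict (V : completeNormedModType R[i]) D E (f : R -> V) :
  measurable D -> measurable E -> E `<=` D ->
  bochner_integrable D f -> bochner_integrable E f.
Proof.
move=> mD mE ED [v bf]; have mf := bochner_sm bf; move: bf => [s [sf sL sv]].
have [s' s'P] := choice (fun n => @sf_restrict _ _ D E (s n) mE).
have s'E n t : E t -> sf_fun (s' n) t = sf_fun (s n) t.
  by move=> Et; rewrite s'P indicE mem_set// scale1r.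
apply: (@bochner_exists _ _ _ _ s') => //.
  move=> t Et; under eq_fun do rewrite s'E//.
  by apply: sf; exact: ED.
apply/ecvg0P => [n|e e0]; first exact: l1dist_ge0.
have := (ecvg0P (fun n => l1dist_ge0 D f (sf_fun (s n)))).1 sL _ e0.
apply: filterS => n; apply: le_lt_trans.
rewrite {1}/l1dist; under eq_integral => t /set_mem Et do rewrite s'E//.
apply: ge0_subset_integral => //; first by apply: sm_l1dist => //; exact: sm_sf.
by move=> t _; rewrite lee_fin rnorm_ge0.
Qed.

Lemma bochner_setU V D E F (f : R -> V) v w : measurable D -> measurable E ->
  measurable F -> D = E `|` F -> (forall t, E t -> ~ F t) ->
  is_bochner E f v -> is_bochner F f w -> is_bochner D f (v + w).
Proof.
move=> mD mE mF DEF EF bv bw.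
have h A u : measurable A -> A `<=` D -> is_bochner A f u ->
    is_bochner D (fun t => (\1_A t : R)%:C *: f t) u.
  move=> mA AD bu; apply: (bochner_widen mD mA AD).
    by move=> t _ nA; rewrite indicE memNset// scale0r.
  by apply: bochner_eq bu => t At; rewrite indicE mem_set// scale1r.
have ED : E `<=` D by rewrite DEF; left.
have FD : F `<=` D by rewrite DEF; right.
have := bochner_lin 1 mD (h _ _ mE ED bv) (h _ _ mF FD bw).
rewrite scale1r; apply: bochner_eq => t Dt; rewrite scale1r !indicE.
move: Dt; rewrite DEF => -[Et|Ft].
  by rewrite mem_set// memNset ?scale0r ?addr0 ?scale1r//; exact: EF.
by rewrite [t \in F]mem_set// memNset ?scale0r ?add0r ?scale1r// => /EF.
Qed.

Lemma sf_indic V D E (v : V) : measurable E -> E `<=` D -> (mu E < +oo)%E ->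
  exists s : simple_fun (V:=V) D, sf_fun s = (fun t => (\1_E t : R)%:C *: v) /\
    sf_int s = (fine (mu E))%:C *: v.
Proof.
move=> mE ED fE.
have [|||s [sE iE]] := @simple_of R V D 'I_1 (fun=> E) (fun=> v) => //.
exists s; rewrite iE sE big_ord1; split => //.
by apply/funext => t; rewrite big_ord1.
Qed.

Lemma is_bochner_sf V D (s : simple_fun (V:=V) D) : is_bochner D (sf_fun s) (sf_int s).
Proof.
exists (fun=> s); split; [by move=> t _; exact: cvg_cst| |exact: cvg_cst].
under eq_fun do under eq_integral do rewrite subrr rnorm0.
by rewrite integral0; exact: cvg_cst.
Qed.

Lemma lebesgue_itv_cc (a b : R) : a <= b -> mu `[a, b]%classic = (b - a)%:E.
Proof.
move=> ab; rewrite lebesgue_measure_itv/= lte_fin EFinB.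
by case: ltgtP ab => // ->; rewrite subee.
Qed.

Lemma lebesgue_itv_fin (i : interval R) (a b : R) :
  [set` i] `<=` `[a, b]%classic -> (mu [set` i] < +oo)%E.
Proof.
move=> iab; apply: lebesgue_finite_sub iab _ => //.
by rewrite lebesgue_measure_itv/= lte_fin; case: ifP => _; rewrite ?ltry// -EFinB ltry.
Qed.

Lemma bochner_cst V (v : V) (a b : R) : a <= b ->
  is_bochner `[a, b] (cst v) ((b - a)%:C *: v).
Proof.
move=> ab; have [|||s [sE iE]] := @sf_indic V `[a, b] `[a, b] v => //.
  exact: (@lebesgue_itv_fin _ a b).
rewrite lebesgue_itv_cc//= in iE; rewrite -iE.
apply: bochner_eq (is_bochner_sf s) => t tab.
by rewrite sE indicE mem_set// scale1r.
Qed.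

(** Step functions that approximate [f] on adjacent intervals concatenate, so the
    local approximation by a constant is enough. *)
Lemma step_approx V (f : R -> V) (a b e : R) : a <= b -> cont_on f a b -> 0 < e ->
  exists s : simple_fun (V:=V) `[a, b],
    forall t, a <= t <= b -> rnorm (sf_fun s t - f t) <= e.
Proof.
move=> ab cf e0.
have ocE (x y t : R) : `]x, y]%classic t = (x < t <= y) by rewrite /= in_itv.
have [s sP] : exists s : simple_fun (V:=V) `]a, b],
    forall t, a < t <= b -> rnorm (sf_fun s t - f t) <= e.
  apply: (@interval_chain _ a b (fun x y => exists s : simple_fun (V:=V) `]x, y],
    forall t, x < t <= y -> rnorm (sf_fun s t - f t) <= e)) => //.
    move=> x y z ax xy yz zb [s sP] [s' s'P].
    have sub1 : `]x, y]%classic `<=` `]x, z]%classic.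
      by move=> t; rewrite !ocE => /andP[-> /le_trans]; exact.
    have sub2 : `]y, z]%classic `<=` `]x, z]%classic.
      by move=> t; rewrite !ocE => /andP[/(le_lt_trans xy) ->].
    have [s1 [s1E _]] := sf_widen s sub1; have [s2 [s2E _]] := sf_widen s' sub2.
    have [s3 [s3E _]] := sf_lin 1 s1 s2.
    exists s3 => t /andP[xt tz]; rewrite s3E s1E s2E scale1r.
    have [ty|yt] := leP t y.
      rewrite [sf_fun s' t]sf_fun_out ?addr0 ?sP ?xt//.
      by rewrite ocE ltNge ty.
    rewrite [sf_fun s t]sf_fun_out ?add0r ?s'P ?yt//.
    by rewrite ocE leNgt yt andbF.
  move=> t tab; have [d d0 dP] := cf t e tab e0.
  exists d => // x y ax tdx xt ty ytd yb.
  have [|||s [sE iE]] := @sf_indic V `]x, y] `]x, y] (f t) => //.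
    apply: (@lebesgue_itv_fin _ x y) => r; rewrite ocE => /andP[/ltW xr ry].
    by rewrite /= in_itv/= xr.
  exists s => r xry; rewrite sE indicE mem_set ?ocE// scale1r rdistC ltW//.
  move/andP: xry => [xr ry].
  by apply: dP; [|rewrite ltr_norml]; apply/andP; split; lra.
have sub : `]a, b]%classic `<=` `[a, b]%classic.
  by move=> r; rewrite ocE => /andP[/ltW xr ry]; rewrite /= in_itv/= xr.
have [s1 [s1E _]] := sf_widen s sub.
have [|||s2 [s2E _]] := @sf_indic V `[a, b] [set a] (f a) => //.
  by move=> r ->; rewrite /= in_itv/= lexx.
  by rewrite lebesgue_measure_set1 ltry.
have [s3 [s3E _]] := sf_lin 1 s1 s2.
exists s3 => t /andP[at_ tb]; rewrite s3E s1E s2E scale1r indicE.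
have [<-|ta] := eqVneq a t.
  rewrite mem_set// scale1r sf_fun_out ?add0r ?subrr ?rnorm0 ?ltW//.
  by rewrite ocE ltxx.
rewrite memNset; last by move=> /esym/eqP; rewrite (negbTE ta).
by rewrite scale0r addr0 sP// tb andbT lt_neqAle ta.
Qed.

Lemma sf_prod V D (s : simple_fun (V:=CC R) D) (s' : simple_fun (V:=V) D) :
  exists s'' : simple_fun (V:=V) D,
    sf_fun s'' = (fun t => (sf_fun s t : R[i]) *: sf_fun s' t).
Proof.
have [|||s'' [sE _]] := @simple_of R V D ('I_(sf_size s) * 'I_(sf_size s'))%type
  (fun p => sf_set (s:=s) p.1 `&` sf_set (s:=s') p.2)
  (fun p => (sf_val (s:=s) p.1 : R[i]) *: sf_val (s:=s') p.2).
- by move=> p; apply: measurableI; exact: sf_measurable.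
- by move=> p t [/sf_sub].
- move=> p; apply: lebesgue_finite_sub (sf_finite (s:=s) p.1) => //.
  + by apply: measurableI; exact: sf_measurable.
  + exact: sf_measurable.
exists s''; rewrite sE; apply/funext => t.
rewrite /sf_fun scaler_suml -(pair_bigA _ (fun i j =>
  (\1_(sf_set (s:=s) i `&` sf_set (s:=s') j) t)%:C *:
  ((sf_val (s:=s) i : R[i]) *: sf_val (s:=s') j)))/=.
apply: eq_bigr => i _; rewrite scaler_sumr; apply: eq_bigr => j _.
by rewrite indicI/= !rmorphM/= !scalerA; congr (_ *: _); rewrite /GRing.scale/= mulrAC.
Qed.

Lemma sf_l1_fin V D (s : simple_fun (V:=V) D) : measurable D ->
  (\int[mu]_(t in D) (rnorm (sf_fun s t))%:E < +oo)%E.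
Proof.
move=> mD.
apply: (@le_lt_trans _ _ (\int[mu]_(t in D) (\sum_(i < sf_size s)
   (rnorm (sf_val (s:=s) i))%:E * (\1_(sf_set (s:=s) i) t : R)%:E))%E).
  apply: ge0_le_integral => //.
  - by move=> t _; rewrite lee_fin rnorm_ge0.
  - by apply: sm_rnorm => //; exact: sm_sf.
  - apply: emeasurable_sum => i _; apply: measurable_funeM => //.
    by apply/measurable_EFinP/measurable_indic; exact: sf_measurable.
  move=> t _.
  rewrite [leRHS](_ : _ = (\sum_(i < sf_size s)
    rnorm (sf_val (s:=s) i) * \1_(sf_set (s:=s) i) t)%:E); last by rewrite -sumEFin.
  rewrite /sf_fun lee_fin (le_trans (ler_rnorm_sum _ _ _))// ler_sum// => i _.
  by rewrite rnormZ cabsR ger0_norm// mulrC.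
rewrite ge0_integral_sum//; last 2 first.
- move=> i; apply: measurable_funeM => //.
  by apply/measurable_EFinP/measurable_indic; exact: sf_measurable.
- by move=> i t _; rewrite mule_ge0// lee_fin ?rnorm_ge0.
apply: lte_sum_pinfty => i _.
have mI : measurable_fun D (fun t => (\1_(sf_set (s:=s) i) t : R)%:E).
  by apply/measurable_EFinP/measurable_indic; exact: sf_measurable.
rewrite ge0_integralZl ?lee_fin ?rnorm_ge0//.
rewrite integral_indic//; last exact: sf_measurable.
rewrite (setIidl (@sf_sub _ _ _ s i)) lte_mul_pinfty//.
  by rewrite lee_fin rnorm_ge0.
exact: sf_finite.
Qed.

End BochnerDomains.

Section BochnerIntervals.
Context {R : realType}.
Local Notation mu := (@lebesgue_measure R).
Implicit Types (D E : set R) (V : normedModType R[i]).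

(** The approximants are the products of simple functions tending to [u] in mean
    with step functions tending uniformly to [g]. *)
Lemma bochner_prod (V : completeNormedModType R[i]) (u : R -> CC R) (g : R -> V)
    (a b : R) : a <= b -> bochner_integrable `[a, b] u -> cont_on g a b ->
  bochner_integrable `[a, b] (fun t => (u t : R[i]) *: g t).
Proof.
move=> ab [v bu] cg; set D := `[a, b]%classic.
have mD : measurable D by exact: measurable_itv.
have mu_ := bochner_sm bu; move: bu => [s [su sL _]].
have [K K0 KP] := cont_on_bounded ab cg.
pose h n : R := n.+1%:R^-1.
have h0 n : 0 < h n by rewrite invr_gt0.
have h1 n : h n <= 1 by rewrite invf_le1// ler1n.
have [t tP] := choice (fun n => step_approx ab cg (h0 n)).
have [p pP] := choice (fun n => sf_prod (s n) (t n)).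
have hcvg : h @ \oo --> (0 : R) by exact: cvg_harmonic.
have est n x : D x -> rnorm ((u x : R[i]) *: g x - sf_fun (p n) x) <=
    cabs (u x - sf_fun (s n) x) * (K + 1) + h n * cabs (u x).
  move=> Dx; have Dx' : a <= x <= b by move: Dx; rewrite /D/= in_itv.
  rewrite pP; set U := u x; set S := sf_fun (s n) x; set T := sf_fun (t n) x.
  have -> : (U : R[i]) *: g x - (S : R[i]) *: T =
      (U - S : R[i]) *: T - (U : R[i]) *: (T - g x).
    by rewrite scalerBl scalerBr opprB [RHS]addrC subrKA.
  apply: le_trans (ler_rnormB _ _) _; rewrite !rnormZ lerD//.
    rewrite ler_wpM2l ?rnorm_ge0// -[T](subrK (g x)) addrC.
    rewrite (le_trans (ler_rnormD _ _))// lerD ?KP//.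
    by rewrite (le_trans (tP n x Dx')).
  by rewrite mulrC ler_wpM2r ?rnorm_ge0// tP.
have [M M0 MP] : exists2 M : R, 0 < M & (\int[mu]_(x in D) (cabs (u x))%:E <= M%:E)%E.
  have [N _ NP] := (ecvg0P (fun n => l1dist_ge0 D u (sf_fun (s n)))).1 sL _ ltr01.
  have fin : (\int[mu]_(x in D) (cabs (u x))%:E < +oo)%E.
    rewrite -(@l1dist0 _ (CC R)).
    apply: le_lt_trans (l1dist_triangle mD mu_ (@sm_cst0 _ (CC R) D) (sm_sf (s N))) _.
    apply: lte_add_pinfty; first by apply: lt_trans (NP N (leqnn _)) _; rewrite ltry.
    by rewrite l1dist0; exact: sf_l1_fin.
  exists (fine (\int[mu]_(x in D) (cabs (u x))%:E)%E + 1).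
    by rewrite ltr_wpDl// fine_ge0// integral_ge0// => x _; rewrite lee_fin rnorm_ge0.
  rewrite EFinD fineK ?leeDl// ?lee_fin// ge0_fin_numE//.
  by rewrite integral_ge0// => x _; rewrite lee_fin rnorm_ge0.
have sm_ug : forall x, D x -> sf_fun (p n) x @[n --> \oo] --> (u x : R[i]) *: g x.
  move=> x Dx; apply: (@rcvg_squeeze _ _ _ \oo _ _ _ (fun n =>
     cabs (u x - sf_fun (s n) x) * (K + 1) + h n * cabs (u x))).
    by apply: nearW => n; rewrite rdistC est.
  rewrite -[X in _ --> X]addr0 -{1}[0](mul0r (K + 1)) -[X in _ --> _ + X](mul0r (cabs (u x))).
  apply: cvgD; apply: cvgMl => //.
  under eq_fun do rewrite rdistC; apply/(@rcvg0P _ (CC R)); exact: su.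
apply: (bochner_exists mD sm_ug).
apply/ecvg0P => [n|e e0]; first exact: l1dist_ge0.
have K1 : 0 < K + 1 by rewrite ltr_wpDl.
have e1 : 0 < e / 2 / (K + 1) by rewrite !divr_gt0.
have e2 : 0 < e / 2 / M by rewrite !divr_gt0.
have s1 := (ecvg0P (fun n => l1dist_ge0 D u (sf_fun (s n)))).1 sL _ e1.
have /cvgrPdist_lt/(_ _ e2) s2 := hcvg.
near=> n.
have m1 := sm_l1dist mD mu_ (sm_sf (s n)).
have m2 : measurable_fun D (fun x => (cabs (u x))%:E) by exact: sm_rnorm.
apply: (@le_lt_trans _ _ ((K + 1)%:E * l1dist D u (sf_fun (s n)) +
   (h n)%:E * \int[mu]_(x in D) (cabs (u x))%:E)%E).
  rewrite /l1dist -ge0_integralZl ?lee_fin ?(ltW K1)//; last first.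
    by move=> x _; rewrite lee_fin rnorm_ge0.
  rewrite -ge0_integralZl ?lee_fin ?(ltW (h0 _))//; last first.
    by move=> x _; rewrite lee_fin rnorm_ge0.
  rewrite -ge0_integralD//;
    [|by move=> x _; rewrite mule_ge0 ?lee_fin ?rnorm_ge0// ltW
     |exact: measurable_funeM
     |by move=> x _; rewrite mule_ge0 ?lee_fin ?rnorm_ge0// ltW
     |exact: measurable_funeM].
  apply: ge0_le_integral => //.
  - by move=> x _; rewrite lee_fin rnorm_ge0.
  - apply: sm_l1dist => //; last exact: sm_sf.
    by exists p.
  - by apply: emeasurable_funD; exact: measurable_funeM.
  by move=> x Dx; rewrite -!EFinM -EFinD lee_fin [_ * cabs (_ - _)]mulrC est.
rewrite [e]splitr [(e / 2 + _)%:E]EFinD; apply: lte_leD.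
- rewrite fin_numM// ge0_fin_numE ?(le_lt_trans MP) ?ltry//.
  by rewrite integral_ge0// => x _; rewrite lee_fin rnorm_ge0.
- rewrite -lte_pdivlMl// -EFinM mulrC; near: n; exact: s1.
apply: le_trans (lee_wpmul2l _ MP) _; first by rewrite lee_fin ltW.
rewrite -EFinM lee_fin -ler_pdivlMr// ltW//.
have : `|0 - h n| < e / 2 / M by near: n; exact: s2.
by rewrite sub0r normrN gtr0_norm.
Unshelve. all: by end_near. Qed.

Lemma bochner_cont (V : completeNormedModType R[i]) (g : R -> V) (a b : R) :
  a <= b -> cont_on g a b -> bochner_integrable `[a, b] g.
Proof.
move=> ab cg; have b1 : bochner_integrable `[a, b] (cst 1 : R -> CC R).
  by eexists; exact: (@bochner_cst _ (CC R)).
have [v bv] := bochner_prod ab b1 cg; exists v.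
by apply: bochner_eq bv => t _; rewrite scale1r.
Qed.

Lemma bochner_sub (V : completeNormedModType R[i]) (f : R -> V) (a b a' b' : R) :
  a <= a' -> b' <= b -> bochner_integrable `[a, b] f -> bochner_integrable `[a', b'] f.
Proof.
move=> aa bb; apply: bochner_restrict => //.
move=> t; rewrite /= !in_itv/= => /andP[at_ tb].
by rewrite (le_trans aa) ?(le_trans tb).
Qed.

Lemma bochner_itv1 V (f : R -> V) (a : R) : is_bochner `[a, a] f 0.
Proof.
have := bochner_cst (f a) (lexx a); rewrite subrr scale0r.
by apply: bochner_eq => t; rewrite /= in_itv/= -eq_le => /eqP <-.
Qed.

Lemma bochner_cat (V : completeNormedModType R[i]) (f : R -> V) (a b c : R) :
  a <= b -> b <= c -> bochner_integrable `[a, c] f ->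
  bochner `[a, c] f = bochner `[a, b] f + bochner `[b, c] f.
Proof.
move=> ab bc fi.
have f1 : bochner_integrable `[a, b] f by exact: bochner_sub fi.
have f2 : bochner_integrable `]b, c] f.
  apply: bochner_restrict fi => // t; rewrite /= !in_itv/= => /andP[bt ->].
  by rewrite (le_trans ab)// ltW.
have [w bw] := f2.
have bbc : is_bochner `[b, c] f w.
  rewrite -[w]add0r; apply: (@bochner_setU _ _ _ `[b, b] `]b, c]) => //.
  - apply/seteqP; split=> t; rewrite /= !in_itv/=.
      move=> /andP[bt tc]; have [E|nE] := eqVneq b t; [left|right].
        by rewrite E lexx.
      by rewrite tc andbT lt_neqAle nE bt.
    by case=> [|/andP[/ltW -> ->]//]; rewrite -eq_le => /eqP <-; rewrite lexx.
  - by move=> t; rewrite /= !in_itv/= -eq_le => /eqP <-; rewrite ltxx.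
  - exact: bochner_itv1.
apply: bochnerE => //; apply: (@bochner_setU _ _ _ `[a, b] `]b, c]) => //.
- apply/seteqP; split=> t; rewrite /= !in_itv/=.
    move=> /andP[at_ tc]; have [tb|bt] := leP t b; [left|right]; by rewrite ?at_ ?bt.
  by case=> [/andP[-> /le_trans->]//|/andP[bt ->]]; rewrite (le_trans ab)// ltW.
- by move=> t; rewrite /= !in_itv/= => /andP[_ /le_gtF ->].
- exact: bochnerP.
- by rewrite (bochnerE _ bbc).
Qed.

Lemma bochner_ae_le V D (f : R -> V) v (k : R -> R) (K : R) : measurable D ->
  is_bochner D f v -> measurable_fun D k -> (forall t, D t -> 0 <= k t) ->
  {ae mu, forall t, D t -> rnorm (f t) <= k t} ->
  (\int[mu]_(t in D) (k t)%:E <= K%:E)%E -> rnorm v <= K.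
Proof.
move=> mD bf mk k0 fk kK; rewrite -lee_fin.
apply: le_trans (le_bochner mD bf) _; apply: le_trans kK.
have ? := sm_rnorm mD (bochner_sm bf).
apply: ae_ge0_le_integral => //.
- by move=> t _; rewrite lee_fin rnorm_ge0.
exact/measurable_EFinP.
Qed.

End BochnerIntervals.

(** * Integration by parts against bounded functions *)

Section Primitive.
Context {R : realType}.
Local Notation mu := (@lebesgue_measure R).
Implicit Types V : normedModType R[i].

Definition ae_bounded V (u : R -> V) (T M : R) : Prop :=
  {ae mu, forall t, `[0, T]%classic t -> rnorm (u t) <= M}.

Lemma bochner_le_cst V (f : R -> V) (a b K : R) : a <= b -> 0 <= K ->
  bochner_integrable `[a, b] f ->
  {ae mu, forall t, `[a, b]%classic t -> rnorm (f t) <= K} ->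
  rnorm (bochner `[a, b] f) <= K * (b - a).
Proof.
move=> ab K0 /bochnerP bf fK; apply: (bochner_ae_le _ bf _ _ fK) => //.
by rewrite integral_cst//= lebesgue_itv_cc// -EFinM.
Qed.

Lemma ae_imply (P Q : R -> Prop) : (forall t, P t -> Q t) ->
  {ae mu, forall t, P t} -> {ae mu, forall t, Q t}.
Proof. by move=> PQ; apply: filterS; first exact: (ae_filter_ringOfSetsType mu). Qed.

Lemma ae_boundedS V (u : R -> V) (T T' M : R) : T' <= T -> ae_bounded u T M ->
  ae_bounded u T' M.
Proof.
move=> TT; apply: ae_imply => t + tT; apply.
by move: tT; rewrite /= !in_itv/= => /andP[-> /le_trans->].
Qed.

Lemma ae_bounded_itv V (u : R -> V) (T M x y : R) : 0 <= x -> y <= T ->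
  ae_bounded u T M -> {ae mu, forall t, `[x, y]%classic t -> rnorm (u t) <= M}.
Proof.
move=> x0 yT; apply: ae_imply => t + txy; apply.
by move: txy; rewrite /= !in_itv/= => /andP[/(le_trans x0) -> /le_trans->].
Qed.

Lemma bochner_diff (V : completeNormedModType R[i]) (f : R -> V) (T x y : R) :
  0 <= x -> x <= y -> y <= T -> bochner_integrable `[0, T] f ->
  bochner `[0, y] f - bochner `[0, x] f = bochner `[x, y] f.
Proof.
move=> x0 xy yT fi; have fiy : bochner_integrable `[0, y] f by exact: bochner_sub fi.
by rewrite (bochner_cat x0 xy fiy) addrC addKr.
Qed.

Lemma bochner_near_scale (V : normedModType R[i]) (u : R -> V) (g : R -> CC R)
    (c : R[i]) (x y e M : R) : x <= y -> 0 <= e -> 0 <= M ->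
  bochner_integrable `[x, y] u ->
  bochner_integrable `[x, y] (fun s => (g s : R[i]) *: u s) ->
  {ae mu, forall s, `[x, y]%classic s -> rnorm (u s) <= M} ->
  (forall s, x <= s -> s <= y -> cabs (g s - c) <= e) ->
  rnorm (bochner `[x, y] (fun s => (g s : R[i]) *: u s) - c *: bochner `[x, y] u)
    <= e * M * (y - x).
Proof.
move=> xy e0 M0 iu igu uM gc.
have mI : measurable `[x, y]%classic by exact: measurable_itv.
have b1 := bochner_lin (- c) mI (bochnerP iu) (bochnerP igu).
rewrite scaleNr addrC in b1; rewrite -(bochnerE mI b1).
apply: bochner_le_cst => //; first exact: mulr_ge0.
  by eexists; exact: b1.
move: uM; apply: ae_imply => s + sxy => /(_ sxy) us.
have {sxy} /andP[xs sy] : x <= s <= y by move: sxy; rewrite /= in_itv.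
rewrite scaleNr addrC -scalerBl rnormZ ler_pM ?rnorm_ge0//.
exact: gc.
Qed.

Lemma bochner_near_cst (V : normedModType R[i]) (f : R -> V) (v : V) (x y e : R) :
  x <= y -> 0 <= e -> bochner_integrable `[x, y] f ->
  (forall s, x <= s -> s <= y -> rnorm (f s - v) <= e) ->
  rnorm (bochner `[x, y] f - (y - x)%:C *: v) <= e * (y - x).
Proof.
move=> xy e0 fi fv.
have mI : measurable `[x, y]%classic by exact: measurable_itv.
have b1 := bochner_lin (-1) mI (bochner_cst v xy) (bochnerP fi).
rewrite scaleN1r addrC in b1; rewrite -(bochnerE mI b1).
apply: bochner_le_cst => //; first by eexists; exact: b1.
apply: aeW => s sxy; rewrite scaleN1r addrC.
by move: sxy; rewrite /= in_itv/= => /andP[xs sy]; exact: fv.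
Qed.

(** The increment over the interval from [x] to [y] of the difference between the two
    sides of the integration by parts formula is small compared to [y - x].  Here
    [i1] and [i3] stand for the two integrals, [A] for the primitive and [g] for the
    smooth factor, both sampled at [x], [t] and [y]. *)
Lemma by_parts_local (i1 i3 Ax Ay At gx gy gt g' : R[i]) (x y t e M K : R) :
  x <= t -> t <= y -> 0 <= e -> 0 <= M -> cabs Ax <= K -> cabs Ay <= K ->
  cabs (i1 - gt * (Ay - Ax)) <= e * M * (y - x) ->
  cabs (i3 - (y - x)%:C * (g' * At)) <= e * (y - x) ->
  cabs (gy - gt - (y - t)%:C * g') <= e * `|y - t| ->
  cabs (gx - gt - (x - t)%:C * g') <= e * `|x - t| ->
  cabs (Ay - At) <= e -> cabs (Ax - At) <= e ->
  cabs (i1 - gy * Ay + i3 - (0 - gx * Ax)) <= e * (M + 1 + K + cabs g') * (y - x).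
Proof.
move=> xt ty e0 M0 AxK AyK h1 h3 hy hx hAy hAx.
set p := _ - _ - _ in hy; set q := _ - _ - _ in hx.
set j1 := _ - _ in h1; set j3 := _ - _ in h3.
have -> : i1 - gy * Ay + i3 - (0 - gx * Ax) =
    j1 + j3 + (q * Ax - p * Ay) + ((x - t)%:C * (g' * (Ax - At)) - (y - t)%:C * (g' * (Ay - At))).
  rewrite /j1 /j3 /p /q (_ : (y - x)%:C = (y - t)%:C - (x - t)%:C); first by ring.
  by rewrite -rmorphB/= opprB addrA subrK.
have K0 : 0 <= K by rewrite (le_trans _ AxK) ?rnorm_ge0.
have r1 : cabs (q * Ax) <= e * (t - x) * K.
  by rewrite cabsM ler_pM ?rnorm_ge0// (le_trans hx)// distrC ger0_norm ?subr_ge0.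
have r2 : cabs (p * Ay) <= e * (y - t) * K.
  by rewrite cabsM ler_pM ?rnorm_ge0// (le_trans hy)// ger0_norm ?subr_ge0.
have r3 : cabs ((x - t)%:C * (g' * (Ax - At))) <= (t - x) * (cabs g' * e).
  by rewrite !cabsM cabsR distrC ger0_norm ?subr_ge0// !ler_wpM2l ?rnorm_ge0 ?subr_ge0.
have r4 : cabs ((y - t)%:C * (g' * (Ay - At))) <= (y - t) * (cabs g' * e).
  by rewrite !cabsM cabsR ger0_norm ?subr_ge0// !ler_wpM2l ?rnorm_ge0 ?subr_ge0.
have -> : e * (M + 1 + K + cabs g') * (y - x) = (e * M * (y - x) + e * (y - x)) +
  (e * (t - x) * K + e * (y - t) * K) + ((t - x) * (cabs g' * e) + (y - t) * (cabs g' * e)).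
  by move: (cabs g') => G; ring.
apply: le_trans (@ler_rnormD _ (CC R) _ _) _; apply: lerD; last first.
  by apply: le_trans (@ler_rnormB _ (CC R) _ _) _; apply: lerD.
apply: le_trans (@ler_rnormD _ (CC R) _ _) _; apply: lerD; last first.
  by apply: le_trans (@ler_rnormB _ (CC R) _ _) _; apply: lerD.
by apply: le_trans (@ler_rnormD _ (CC R) _ _) _; apply: lerD.
Qed.

Section Bounded.
Variables (u : R -> CC R) (T M : R).
Hypotheses (T0 : 0 <= T) (M0 : 0 <= M).
Hypotheses (ui : bochner_integrable `[0, T] u) (uM : ae_bounded u T M).

Definition prim (t : R) : CC R := bochner `[0, t] u.

Lemma prim0 : prim 0 = 0.
Proof. by apply: bochnerE => //; exact: bochner_itv1. Qed.

Lemma prim_diff (x y : R) : 0 <= x -> x <= y -> y <= T ->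
  prim y - prim x = bochner `[x, y] u.
Proof.
by move=> x0 xy yT; exact: (bochner_diff x0 xy yT ui).
Qed.

Lemma prim_lipschitz (x y : R) : 0 <= x -> x <= y -> y <= T ->
  rnorm (prim y - prim x) <= M * (y - x).
Proof.
move=> x0 xy yT; rewrite prim_diff//; apply: bochner_le_cst => //.
  exact: bochner_sub ui.
exact: ae_bounded_itv uM.
Qed.

Lemma prim_le (t : R) : 0 <= t -> t <= T -> rnorm (prim t) <= M * t.
Proof.
by move=> t0 tT; have := prim_lipschitz (lexx 0) t0 tT; rewrite prim0 !subr0.
Qed.

Lemma prim_cont : cont_on prim 0 T.
Proof.
move=> t e /andP[t0 tT] e0; have M1 : 0 < M + 1 by rewrite ltr_wpDl.
exists (e / (M + 1)); first by rewrite divr_gt0.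
move=> s /andP[s0 sT]; rewrite ltr_pdivlMr// => st.
have h : rnorm (prim s - prim t) <= M * `|s - t|.
  have [ts|st'] := leP t s.
    by rewrite ger0_norm ?subr_ge0// prim_lipschitz.
  by rewrite rdistC distrC gtr0_norm ?subr_gt0// prim_lipschitz// ltW.
apply: le_lt_trans h _; apply: le_lt_trans st; rewrite mulrDr mulr1 mulrC lerDl.
exact: normr_ge0.
Qed.

Lemma bochner_prodr (g : R -> CC R) (x y : R) : 0 <= x -> x <= y -> y <= T ->
  cont_on g x y -> bochner_integrable `[x, y] (fun s => (g s : R[i]) *: u s).
Proof.
move=> x0 xy yT cg; have iu : bochner_integrable `[x, y] u by exact: bochner_sub ui.
have [v bv] := bochner_prod xy iu cg; exists v.
by apply: bochner_eq bv => s _; exact: mulrC.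
Qed.

(** The difference of the two sides has zero derivative: locally, [u] enters
    only through its essential bound. *)
Lemma bochner_by_parts (g g' : R -> CC R) :
  diff_on g g' 0 T -> cont_on g' 0 T ->
  bochner `[0, T] (fun s => (g s : R[i]) *: u s) =
  (g T : R[i]) *: prim T - bochner `[0, T] (fun s => (g' s : R[i]) *: prim s).
Proof.
move=> dg cg'; have cg := diff_on_cont dg.
have cAg : cont_on (fun s => (g' s : R[i]) *: prim s) 0 T by exact: cont_onZ cg' prim_cont.
have iug : bochner_integrable `[0, T] (fun s => (g s : R[i]) *: u s).
  by apply: bochner_prodr.
have iAg : bochner_integrable `[0, T] (fun s => (g' s : R[i]) *: prim s).
  exact: bochner_cont.
pose I t : CC R := bochner `[0, t] (fun s => (g s : R[i]) *: u s).
pose J t : CC R := bochner `[0, t] (fun s => (g' s : R[i]) *: prim s).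
have [I0 J0] : I 0 = 0 /\ J 0 = 0.
  by split; apply: bochnerE => //; exact: bochner_itv1.
suff : I T - (g T : R[i]) *: prim T + J T = I 0 - (g 0 : R[i]) *: prim 0 + J 0.
  rewrite prim0 scaler0 subr0 I0 J0 addr0 => /eqP.
  by rewrite addr_eq0 subr_eq addrC => /eqP.
apply: (@straddle_const _ _ (fun t => I t - (g t : R[i]) *: prim t + J t) 0 T) => //.
move=> e t e0 tT; have /andP[t0 tT'] := tT.
pose K := M + 1 + M * T + cabs (g' t).
have K0 : 0 < K.
  by rewrite /K -!addrA addrCA ltr_pwDl// ?addr_ge0 ?mulr_ge0 ?rnorm_ge0.
pose e1 := e / K; have e10 : 0 < e1 by rewrite divr_gt0.
have [d2 d20 cg2] := cg _ _ tT e10.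
have [d3 d30 cA3] := prim_cont tT e10.
have [d4 d40 cAg4] := cAg _ _ tT e10.
have [d' d'0 dg'] := dg _ _ tT e10.
pose d := Num.min d2 (Num.min d3 (Num.min d4 d')).
have d0 : 0 < d by rewrite !lt_min d20 d30 d40.
exists d => // x y x0 tdx xt ty ytd yT.
have xy := le_trans xt ty.
have near s : x <= s -> s <= y -> [/\ 0 <= s <= T, `|s - t| < d2, `|s - t| < d3,
    `|s - t| < d4 & `|s - t| < d'].
  move=> xs sy; have : `|s - t| < d.
    rewrite ltr_norml ltrBrDl (lt_le_trans tdx xs)/= ltrBlDl.
    exact: le_lt_trans sy ytd.
  rewrite !lt_min => /andP[-> /andP[-> /andP[-> ->]]]; split => //.
  by rewrite (le_trans x0 xs) (le_trans sy yT).
have [yT' _ yd3 _ yd'] := near y xy (lexx _).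
have [xT' _ xd3 _ xd'] := near x (lexx _) xy.
have iux : bochner_integrable `[x, y] u by exact: bochner_sub ui.
have iugx : bochner_integrable `[x, y] (fun s => (g s : R[i]) *: u s).
  exact: bochner_sub iug.
have iAgx : bochner_integrable `[x, y] (fun s => (g' s : R[i]) *: prim s).
  exact: bochner_sub iAg.
have IE : I y - I x = _ := bochner_diff x0 xy yT iug.
have JE : J y - J x = _ := bochner_diff x0 xy yT iAg.
have PE := prim_diff x0 xy yT.
have h1 := @bochner_near_scale _ u g (g t) x y e1 M xy (ltW e10) M0 iux iugx
  (ae_bounded_itv x0 yT uM).
have h3 := @bochner_near_cst _ _ ((g' t : R[i]) *: prim t) x y e1 xy (ltW e10) iAgx.
have {}h1 := h1 (fun s xs sy => let: And5 sT sd2 _ _ _ := near s xs sy in ltW (cg2 s sT sd2)).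
rewrite -IE -PE in h1.
have {}h3 := h3 (fun s xs sy => let: And5 sT _ _ sd4 _ := near s xs sy in ltW (cAg4 s sT sd4)).
rewrite -JE in h3.
have prK s : 0 <= s <= T -> cabs (prim s) <= M * T.
  by move=> /andP[s0 sT]; rewrite (le_trans (prim_le s0 sT))// ler_wpM2l.
have := by_parts_local xt ty (ltW e10) M0 (prK _ xT') (prK _ yT') h1 h3
  (dg' _ yT' yd') (dg' _ xT' xd') (ltW (cA3 _ yT' yd3)) (ltW (cA3 _ xT' xd3)).
have -> : e1 * (M + 1 + M * T + cabs (g' t)) = e.
  by rewrite /e1 -/K -mulrA mulVf ?mulr1// gt_eqF.
congr (cabs _ <= _).
move: (I y) (I x) (J y) (J x) (prim x) (prim y) (g x) (g y) => Iy Ix Jy Jx px py gx gy.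
change ((Iy : R[i]) - Ix - gy * py + (Jy - Jx) - (0 - gx * px) =
  (Iy : R[i]) - gy * py + Jy - (Ix - gx * px + Jx)).
ring.
Qed.

End Bounded.
End Primitive.

(** * Convolution with exponentials *)

Section ExpConvolution.
Context {R : realType}.
Local Notation mu := (@lebesgue_measure R).

Lemma bochner_scale (V : normedModType R[i]) D (c : R[i]) (f : R -> V) v :
  measurable D -> is_bochner D f v -> is_bochner D (fun t => c *: f t) (c *: v).
Proof.
move=> mD; apply: bochner_bounded_op => //; apply/bounded_opP; split.
  by move=> a x y; rewrite scalerDr !scalerA mulrC.
by exists (cabs c) => [|x]; rewrite ?rnorm_ge0// rnormZ.
Qed.

Lemma bochner_opp (V : normedModType R[i]) D (f : R -> V) v :
  measurable D -> is_bochner D f v -> is_bochner D (fun t => - f t) (- v).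
Proof.
move=> mD /(bochner_scale (-1) mD); rewrite scaleN1r.
by apply: bochner_eq => t _; rewrite scaleN1r.
Qed.

Lemma diff_on_affine (c a b : R) :
  diff_on (fun s => (c - s)%:C : CC R) (fun=> -1 : CC R) a b.
Proof.
move=> t e _ e0; exists 1 => // s _ _.
have -> : ((c - s)%:C - (c - t)%:C - (s - t)%:C *: (-1) : CC R) = 0.
  change ((c - s)%:C - (c - t)%:C - (s - t)%:C * (-1) = 0 :> R[i]).
  rewrite !rmorphB/=; ring.
by rewrite rnorm0 mulr_ge0// ltW.
Qed.

Lemma cexp_diff0 (l : R[i]) (a b : R) :
  diff_on (fun t => cexp (t%:C * l) : CC R) (fun t => l * cexp (t%:C * l) : CC R) a b.
Proof.
have := @cexp_diff _ l 0 a b.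
rewrite (_ : (fun t => cexp ((0 + t)%:C * l) : CC R) = (fun t => cexp (t%:C * l))); last first.
  by apply/funext => t; rewrite add0r.
rewrite (_ : (fun t => l * cexp ((0 + t)%:C * l) : CC R) = (fun t => l * cexp (t%:C * l)))//.
by apply/funext => t; rewrite add0r.
Qed.

Lemma cexp_cont (l : R[i]) (a b : R) : cont_on (fun t => cexp (t%:C * l) : CC R) a b.
Proof. exact: diff_on_cont (@cexp_diff0 l a b). Qed.

Lemma cexp_conv_cont (l : R[i]) (t a b : R) :
  cont_on (fun s => cexp ((t - s)%:C * l) : CC R) a b.
Proof.
have := diff_on_cont (@cexp_diff _ (- l) (- t) a b).
rewrite (_ : (fun s => cexp ((- t + s)%:C * - l) : CC R) = (fun s => cexp ((t - s)%:C * l)))//.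
by apply/funext => s; rewrite mulrN -mulNr -rmorphN/= opprD opprK.
Qed.

Lemma integral_expR_le (M r t : R) : 0 <= M -> r < 0 -> 0 <= t ->
  (\int[mu]_(s in `[0%R, t]) (M * expR ((t - s) * r))%:E <= (M / - r)%:E)%E.
Proof.
move=> M0 r0; rewrite le_eqVlt => /predU1P[<-|t0].
  rewrite set_itv1 integral_set1 lee_fin divr_ge0// oppr_ge0; exact: ltW.
pose F s := M / - r * expR ((t - s) * r).
have dF x : is_derive x (1 : R) F (M * expR ((t - x) * r)).
  rewrite /F; apply: is_derive_eq; rewrite /GRing.scale/= !(mulr0, add0r, addr0, mulr1, sub0r, mulN1r, mul1r).
  by field; rewrite lt_eqF.
have cF : continuous F.
  by move=> x; apply/differentiable_continuous/derivable1_diffP; have [] := dF x.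
rewrite (@continuous_FTC2 _ _ F)//.
- rewrite /F subrr mul0r expR0 mulr1 -EFinB lee_fin lerBlDr lerDl.
  by rewrite mulr_ge0 ?expR_ge0// divr_ge0// oppr_ge0 ltW.
- apply: continuous_subspaceT => x.
  have dk : is_derive x (1 : R) (fun s => M * expR ((t - s) * r)) (- r * M * expR ((t - x) * r)).
    apply: is_derive_eq; rewrite /GRing.scale/= !(mulr0, add0r, addr0, mulr1, sub0r, mulN1r, mul1r).
    by ring.
  by apply/differentiable_continuous/derivable1_diffP; have [] := dk.
- split.
  + by move=> x _; have [] := dF x.
  + by apply: cvg_at_right_filter; exact: cF.
  + by apply: cvg_at_left_filter; exact: cF.
- by move=> x _; rewrite derive1E; have [_ ->] := dF x.
Qed.

Section Bounded.
Variables (u : R -> CC R) (T M : R).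
Hypotheses (T0 : 0 <= T) (M0 : 0 <= M).
Hypotheses (ui : bochner_integrable `[0, T] u) (uM : ae_bounded u T M).

(** Cauchy's formula for repeated integration: integration by parts against the
    function [T - s]. *)
Lemma bochner_double_prim :
  bochner `[0, T] (fun s => (T - s)%:C *: u s) = prim (prim u) T.
Proof.
have := bochner_by_parts T0 M0 ui uM (@diff_on_affine T 0 T) (@cont_on_cst _ (CC R) (-1) 0 T).
move=> ->; rewrite subrr scale0r sub0r /prim.
have iP : bochner_integrable `[0, T] (prim u).
  by apply: bochner_cont => //; exact: prim_cont uM.
have /(bochner_opp (measurable_itv _)) := bochnerP iP.
have E : (fun t => - prim u t) = (fun s => ((-1 : R[i]) *: prim u s)).
  by apply/funext => s; rewrite scaleN1r.
by rewrite E => /(bochnerE (measurable_itv _)) ->; rewrite opprK.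
Qed.

Variable l : R[i].

(** The scalar mode [x' = l x + u], [x 0 = 0]. *)
Definition expc (v : R -> CC R) (t : R) : CC R :=
  bochner `[0, t] (fun s => cexp ((t - s)%:C * l) *: v s).

Let w (s : R) : CC R := cexp (s%:C * - l) *: u s.

Let wi : bochner_integrable `[0, T] w.
Proof. by apply: (bochner_prodr (T:=T)) => //; exact: cexp_cont. Qed.

(** In this form the dependence on [t] is a product of an exponential and a
    primitive, which gives continuity and the differential equation. *)
Lemma expcE (t : R) : 0 <= t -> t <= T -> expc u t = cexp (t%:C * l) *: prim w t.
Proof.
move=> t0 tT; apply: bochnerE => //.
have wit : bochner_integrable `[0, t] w by exact: bochner_sub wi.
have := bochner_scale (cexp (t%:C * l)) (measurable_itv _) (bochnerP wit).
apply: bochner_eq => s _; rewrite /w scalerA -cexpD mulrN -mulNr -mulrDl.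
by rewrite -rmorphN -rmorphD.
Qed.

Let N := expR (T * `|complex.Re l|).

Let wM : ae_bounded w T (N * M).
Proof.
move: uM; apply: ae_imply => s + sT => /(_ sT) us.
rewrite /w rnormZ ler_pM ?rnorm_ge0//.
move: sT; rewrite /= in_itv/= => /andP[s0 sT].
rewrite cabs_cexp ler_expR ReZ raddfN/=.
by rewrite (le_trans (ler_norm _))// normrM normrN ger0_norm// ler_wpM2r.
Qed.

Let NM0 : 0 <= N * M. Proof. by rewrite mulr_ge0// expR_ge0. Qed.

Lemma expc_cont : cont_on (expc u) 0 T.
Proof.
have c1 := @cont_onZ _ _ _ _ _ _ (@cexp_cont l 0 T) (prim_cont NM0 wi wM).
move=> t e tT e0; have [d d0 dP] := c1 t e tT e0.
exists d => // s sT st; have := dP s sT st.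
by move: tT sT => /andP[t0 tT] /andP[s0 sT]; rewrite !expcE.
Qed.

(** The differential equation of the mode, integrated once. *)
Lemma expc_prim :
  l *: bochner `[0, T] (expc u) = expc u T - prim u T.
Proof.
have cg' : cont_on (fun t => l * cexp (t%:C * l) : CC R) 0 T.
  exact: (@cont_onZ _ _ _ _ _ _ (@cont_on_cst _ (CC R) l 0 T) (@cexp_cont l 0 T)).
have := bochner_by_parts T0 NM0 wi wM (@cexp_diff0 l 0 T) cg'.
have -> : (fun s => cexp (s%:C * l) *: w s) = u.
  by apply/funext => s; rewrite /w scalerA mulrN mulrC cexpN scale1r.
have iE : bochner_integrable `[0, T] (expc u).
  by apply: bochner_cont => //; exact: expc_cont.
have -> : bochner `[0, T] (fun s => (l * cexp (s%:C * l)) *: prim w s) =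
    l *: bochner `[0, T] (expc u).
  apply: bochnerE; first exact: measurable_itv.
  apply: bochner_eq (bochner_scale l (measurable_itv _) (bochnerP iE)) => s.
  by rewrite /= in_itv/= => /andP[s0 sT]; rewrite expcE// scalerA.
rewrite -expcE// => E.
by rewrite /prim E opprB addrCA subrr addr0.
Qed.

Let expc_integrable (t : R) : 0 <= t -> t <= T ->
  bochner_integrable `[0, t] (fun s => cexp ((t - s)%:C * l) *: u s).
Proof.
move=> t0 tT; apply: (bochner_prodr (T:=T) ui) => //.
exact: cexp_conv_cont.
Qed.

Lemma expc_le (t : R) : 0 <= t -> t <= T -> complex.Re l <= 0 ->
  rnorm (expc u t) <= M * t.
Proof.
move=> t0 tT l0; rewrite -[t in M * t]subr0; apply: bochner_le_cst => //.
  exact: expc_integrable.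
have := ae_bounded_itv (lexx 0) tT uM; apply: ae_imply => s + st => /(_ st) us.
rewrite rnormZ -[M]mul1r ler_pM ?rnorm_ge0// cabs_cexp -expR0 ler_expR ReZ.
by move: st; rewrite /= in_itv/= => /andP[_ st]; rewrite mulr_ge0_le0// subr_ge0.
Qed.

(** The kernel [cexp (s l)] has norm at most [- 1 / Re l] in [L^1], uniformly in time.
    This is where the real parts in the summability hypothesis come from. *)
Lemma expc_le_Re (t : R) : 0 <= t -> t <= T -> complex.Re l < 0 ->
  rnorm (expc u t) <= M / - complex.Re l.
Proof.
move=> t0 tT l0.
apply: (@bochner_ae_le _ _ _ _ _ (fun s => M * expR ((t - s) * complex.Re l)) _
   (measurable_itv _) (bochnerP (expc_integrable t0 tT))).
- apply: measurable_funTS; apply: continuous_measurable_fun.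
  move=> x; apply: cvgMr; apply: continuous_cvg; first exact: continuous_expR.
  by apply: cvgMl; apply: cvgB; [exact: cvg_cst|exact: cvg_id].
- by move=> s _; rewrite mulr_ge0 ?expR_ge0.
- have := ae_bounded_itv (lexx 0) tT uM; apply: ae_imply => s + st => /(_ st) us.
  by rewrite rnormZ cabs_cexp ReZ mulrC ler_wpM2r ?expR_ge0.
- exact: integral_expR_le.
Qed.

End Bounded.
End ExpConvolution.

(** * Expansion in a Riesz basis *)

Section RieszBasis.
Context {R : realType} {X : completeNormedModType R[i]}.
Variables (ip : {dot X for Num.conj}) (phi psi : nat -> X).
Hypotheses (hilb : is_hilbert ip) (rb : riesz_basis phi)
  (bi : biorthogonal ip phi psi).

(** The Cauchy-Schwarz inequality follows from the triangle inequality, by expanding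
    the norm of [x + a *: y] with [a = ip x y]. *)
Lemma ip_le (x y : X) : `|ip x y| <= `|x| * `|y|.
Proof.
set a := ip x y; have [->|a0] := eqVneq a 0; first by rewrite normr0 mulr_ge0.
have na : 0 < `|a| by rewrite normr_gt0.
have := dnormD ip x (a *: y); rewrite /= !hilb normrZ.
have -> : ip x (a *: y) = `|a| ^+ 2.
  by rewrite linearZr_LR/= -/a mulrC -normCK.
have -> : Num.conj (`|a| ^+ 2) = `|a| ^+ 2 by apply/CrealP; rewrite rpredX// normr_real.
move=> E; have : `|x + a *: y| ^+ 2 <= (`|x| + `|a| * `|y|) ^+ 2.
  rewrite lerXn2r ?nnegrE ?addr_ge0 ?mulr_ge0//.
  by rewrite -normrZ ler_normD.
rewrite E sqrrD [leRHS]addrAC lerD2l -mulr2n ler_pMn2r//.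
by rewrite expr2 mulrCA ler_pM2l.
Qed.

Definition rcoord (k : nat) (x : X) : CC R := ip x (psi k).

Lemma rcoord_linear k : linear (rcoord k).
Proof. by move=> a x y; rewrite /rcoord linearPl. Qed.

Lemma rcoord_bounded k : bounded_op (rcoord k).
Proof.
apply/bounded_opP; split; first exact: rcoord_linear.
exists (rnorm (psi k)) => [|x]; first exact: rnorm_ge0.
have := ip_le x (psi k).
by rewrite -[`|ip _ _|](@rnormE _ (CC R)) !rnormE -rmorphM/= lecR mulrC.
Qed.

Lemma rcoord_phi k n : rcoord k (phi n) = (n == k)%:R :> R[i].
Proof. exact: bi. Qed.

Lemma rcoord_sum k N (a : nat -> R[i]) :
  rcoord k (\sum_(i < N) a i *: phi i) = if (k < N)%N then a k else 0.
Proof.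
rewrite (lin_sum (rcoord_linear k)).
under eq_bigr do rewrite (linZ (rcoord_linear k)) rcoord_phi.
case: ltnP => kN.
  rewrite (bigD1 (Ordinal kN))//= big1 ?addr0; last first.
    by move=> i; rewrite -val_eqE/= => /negbTE ->; exact: mulr0.
  by rewrite eqxx; exact: mulr1.
rewrite big1// => i _; rewrite (_ : (i == k :> nat) = false); first exact: mulr0.
by rewrite ltn_eqF// (leq_trans (ltn_ord i)).
Qed.

Definition rproj (N : nat) (x : X) : X := \sum_(i < N) (rcoord i x : R[i]) *: phi i.

Lemma rproj_linear N : linear (rproj N).
Proof.
move=> a x y; rewrite /rproj scaler_sumr -big_split/=; apply: eq_bigr => i _.
by rewrite rcoord_linear scalerDl scalerA.
Qed.

Lemma riesz_bounds : exists m M : R, [/\ 0 < m, 0 < M &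
  forall N (a : nat -> R[i]),
    m * (\sum_(i < N) cabs (a i) ^+ 2) <= rnorm (\sum_(i < N) a i *: phi i) ^+ 2
    <= M * (\sum_(i < N) cabs (a i) ^+ 2)].
Proof. by case: rb. Qed.

(** Bounds on operators are thereby checked on finite combinations of the basis,
    where the Riesz inequalities apply. *)
Lemma rnorm_bounded_closure (V : normedModType R[i]) (F : X -> V) (K : R) :
  bounded_op F -> 
  (forall N (a : nat -> R[i]), rnorm (F (\sum_(i < N) a i *: phi i)) <=
     K * rnorm (\sum_(i < N) a i *: phi i)) ->
  forall x, rnorm (F x) <= K * rnorm x.
Proof.
move=> /bounded_opP[lF [M M0 FM]] FK x; apply/ler_addgt0Pr => e e0.
have K0 : 0 < M + `|K| + 1 by rewrite ltr_wpDl// addr_ge0.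
have e1 : 0 < e / (M + `|K| + 1) by rewrite divr_gt0.
have : closure [set x | exists n (a : nat -> R[i]), x = \sum_(i < n) a i *: phi i] x.
  by case: rb => ->.
move=> /rclosureP/(_ e1)[_ [N [a ->]] /ltW xy].
set y := \sum_(_ < _) _ in xy *.
have h1 : rnorm (F x) <= rnorm (F y) + M * rnorm (y - x).
  rewrite -lerBlDl; apply: le_trans (FM (y - x)); rewrite (linB lF) rdistC lerBlDr.
  by have := ler_rnormD (F x - F y) (F y); rewrite subrK.
have h2 : K * rnorm y <= K * rnorm x + `|K| * rnorm (y - x).
  rewrite -lerBlDl -mulrBr; apply: le_trans (ler_norm _) _; rewrite normrM ler_wpM2l//.
  have h3 := ler_rnormD (x - y) y; rewrite subrK rdistC in h3.
  rewrite ler_norml lerBlDr lerBrDr addrC lerBlDl h3.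
  by have := ler_rnormD (y - x) x; rewrite subrK.
apply: le_trans h1 _; apply: le_trans (lerD (FK N a) (lexx _)) _.
apply: le_trans (lerD h2 (lexx _)) _; rewrite -addrA lerD2l -mulrDl.
have K1 : 0 <= `|K| + M by rewrite addr_ge0.
apply: le_trans (ler_wpM2l K1 xy) _.
rewrite mulrCA ler_piMr ?(ltW e0)// ler_pdivrMr// mul1r addrC.
by rewrite lerDl.
Qed.

Lemma bounded_sum (V : normedModType R[i]) (N : nat) (F : 'I_N -> X -> V) :
  (forall i, bounded_op (F i)) -> bounded_op (fun x => \sum_i F i x).
Proof.
move=> bF; apply/bounded_opP; split.
  move=> a x y; rewrite scaler_sumr -big_split/=; apply: eq_bigr => i _.
  by have [lF _] := bF i; rewrite lF.
have /choice[M MP] : forall i, exists M : R, 0 <= M /\ forall x, rnorm (F i x) <= M * rnorm x.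
  by move=> i; have /bounded_opP[_ [M M0 FM]] := bF i; exists M.
exists (\sum_i M i) => [|x]; first by rewrite sumr_ge0// => i _; case: (MP i).
rewrite (le_trans (ler_rnorm_sum _ _ _))// mulr_suml ler_sum// => i _.
by case: (MP i).
Qed.

Lemma rproj_bounded N : bounded_op (rproj N).
Proof.
apply: bounded_sum => i; apply/bounded_opP; split.
  by move=> a x y; rewrite rcoord_linear scalerDl scalerA.
have /bounded_opP[_ [M M0 cM]] := rcoord_bounded i.
exists (M * rnorm (phi i)) => [|x]; first by rewrite mulr_ge0// rnorm_ge0.
by rewrite rnormZ mulrAC ler_wpM2r// rnorm_ge0.
Qed.

Lemma rproj_sum N n (a : nat -> R[i]) : (n <= N)%N ->
  rproj N (\sum_(i < n) a i *: phi i) = \sum_(i < n) a i *: phi i.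
Proof.
move=> nN; rewrite /rproj; under eq_bigr do rewrite rcoord_sum.
rewrite (big_ord_widen N (fun i => a i *: phi i))//.
rewrite [RHS]big_mkcond/=; apply: eq_bigr => i _.
by case: ifP => _; rewrite ?scale0r.
Qed.

(** The Riesz inequalities compare a truncated sum with the full one, uniformly in
    the place of truncation. *)
Lemma rproj_le : exists2 K : R, 0 < K & forall N x, rnorm (rproj N x) <= K * rnorm x.
Proof.
have [m [M [m0 M0 mM]]] := riesz_bounds.
exists (Num.sqrt (M / m)); first by rewrite sqrtr_gt0 divr_gt0.
move=> N; apply: rnorm_bounded_closure; first exact: rproj_bounded.
move=> n a; rewrite -(@ler_pXn2r _ 2) ?nnegrE ?mulr_ge0 ?sqrtr_ge0 ?rnorm_ge0//.
rewrite exprMn sqr_sqrtr ?divr_ge0 ?(ltW m0) ?(ltW M0)// /rproj.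
have /andP[_ h1] := mM N (fun i => rcoord i (\sum_(i < n) a i *: phi i)).
have /andP[h2 _] := mM n a.
apply: le_trans h1 _; rewrite -mulrA ler_pM2l// ler_pdivlMl//.
apply: le_trans h2; rewrite ler_pM2l//.
under eq_bigr do rewrite rcoord_sum.
rewrite (eq_bigr (fun i : 'I_N => if (i < n)%N then cabs (a i) ^+ 2 else 0)); last first.
  by move=> i _; case: ifP => // _; rewrite (@rnorm0 _ (CC R)) expr0n.
rewrite -big_mkcond/=.
have [nN|Nn] := leqP n N; first by rewrite -(big_ord_widen N (fun i => cabs (a i) ^+ 2)).
rewrite (eq_bigl xpredT); last by move=> i /=; rewrite (ltn_trans (ltn_ord i) Nn).
rewrite (big_ord_widen n (fun i => cabs (a i) ^+ 2) (ltnW Nn)) big_mkcond/=.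
by apply: ler_sum => i _; case: ifP => // _; exact: sqr_ge0.
Qed.

(** The truncations are uniformly bounded and are eventually the identity on each
    finite combination; these are dense. *)
Lemma rproj_cvg x : (fun N => rproj N x) @ \oo --> x.
Proof.
have [K K0 rprojK] := rproj_le.
apply/rcvgP => e e0; have K1 : 0 < K + 1 by rewrite ltr_wpDl// ltW.
have e1 : 0 < e / (K + 1) by rewrite divr_gt0.
have : closure [set x | exists n (a : nat -> R[i]), x = \sum_(i < n) a i *: phi i] x.
  by case: rb => ->.
move=> /rclosureP/(_ e1)[_ [n [a ->]]]; set y := \sum_(_ < _) _ => xy.
exists n => // N /= nN; apply: le_lt_trans (ler_rdistD y _ _) _.
have -> : rproj N x - y = rproj N (x - y).
  by rewrite (linB (rproj_linear N)) rproj_sum.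
apply: le_lt_trans (lerD (rprojK N _) (lexx _)) _.
by rewrite (rdistC y x) -[X in _ + X]mul1r -mulrDl mulrC -ltr_pdivlMr// rdistC.
Qed.

Lemma rcoord_inj x y : (forall k, rcoord k x = rcoord k y) -> x = y.
Proof.
move=> xy; have cy := @rproj_cvg y.
have E : (fun N => rproj N y) = (fun N => rproj N x).
  by apply/funext => N; apply: eq_bigr => i _; rewrite xy.
rewrite E in cy; exact: rcvg_unique (@rproj_cvg x) cy.
Qed.

Lemma bessel : exists2 K : R, 0 < K &
  forall N x, \sum_(i < N) cabs (rcoord i x) ^+ 2 <= K * rnorm x ^+ 2.
Proof.
have [m [M [m0 M0 mM]]] := riesz_bounds; have [K K0 rprojK] := rproj_le.
exists (K ^+ 2 / m); first by rewrite divr_gt0// exprn_gt0.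
move=> N x; have /andP[h _] := mM N (rcoord^~ x).
rewrite mulrAC ler_pdivlMr// mulrC; apply: le_trans h _.
by rewrite -exprMn ler_pXn2r ?nnegrE ?mulr_ge0 ?rnorm_ge0// ?(ltW K0)//; exact: rprojK.
Qed.

(** By the upper Riesz inequality the partial sums form a Cauchy sequence. *)
Lemma riesz_fischer (a : nat -> R[i]) (K : R) :
  (forall N, \sum_(i < N) cabs (a i) ^+ 2 <= K) ->
  exists x, forall k, rcoord k x = a k.
Proof.
move=> aK; have [m [M [m0 M0 mM]]] := riesz_bounds.
pose S N : R := \sum_(i < N) cabs (a i) ^+ 2.
have Snd : nondecreasing_seq S.
  by apply/nondecreasing_seqP => n; rewrite /S big_ord_recr/= lerDl sqr_ge0.
have Scvg : cvgn S.
  by apply: nondecreasing_is_cvgn => //; exists K => _ [n _ <-]; exact: aK.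
pose x N := \sum_(i < N) a i *: phi i.
have diff n N : (n <= N)%N -> rnorm (x N - x n) ^+ 2 <= M * (S N - S n).
  move=> nN; pose b i := if (n <= i)%N then a i else 0.
  have /andP[_] := mM N b.
  have -> : \sum_(i < N) b i *: phi i = x N - x n.
    rewrite /x (big_ord_widen N (fun i => a i *: phi i) nN) [X in _ - X]big_mkcond/=.
    rewrite -sumrB; apply: eq_bigr => i _; rewrite /b.
    by case: leqP => _; rewrite ?subr0 ?scale0r ?subrr.
  have -> // : \sum_(i < N) cabs (b i) ^+ 2 = S N - S n.
  rewrite /S (big_ord_widen N (fun i => cabs (a i) ^+ 2) nN) [X in _ - X]big_mkcond/=.
  rewrite -sumrB; apply: eq_bigr => i _; rewrite /b.
  by case: leqP => _; rewrite ?subr0 ?subrr// (@rnorm0 _ (CC R)) expr0n.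
have [l xl] : exists l : X, x @ \oo --> l.
  apply: rcauchy_cvg => e e0.
  have e1 : 0 < e ^+ 2 / M by rewrite divr_gt0// exprn_gt0.
  have /cvgrPdist_lt/(_ _ e1)[N _ NP] := Scvg.
  exists N.
  have key p q : (N <= p)%N -> (p <= q)%N -> rnorm (x q - x p) < e.
    move=> Np pq; rewrite -(@ltr_pXn2r _ 2) ?nnegrE ?rnorm_ge0// ?(ltW e0)//.
    apply: le_lt_trans (diff p q pq) _; rewrite mulrC -ltr_pdivlMr//.
    have qN := NP q (leq_trans Np pq); have pN := NP p Np.
    have Sq : S q <= lim (S @ \oo) by exact: nondecreasing_cvgn_le.
    have Sp : S p <= S q by exact: Snd.
    rewrite ger0_norm ?subr_ge0 in pN; last by exact: le_trans Sq.
    by apply: le_lt_trans pN; rewrite lerD2r.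
  move=> p q Np Nq; have [pq|qp] := leqP p q; first by rewrite rdistC key.
  by rewrite key// ltnW.
exists l => k.
have c1 := bounded_op_cvg (rcoord_bounded k) xl.
have c2 : rcoord k (x N) @[N --> \oo] --> (a k : CC R).
  by apply: cvg_near_cst; exists k.+1 => // N /= kN; rewrite /x rcoord_sum kN.
exact: (@rcvg_unique _ (CC R) _ \oo _ _ _ _ (c1 _) c2).
Qed.

End RieszBasis.

(** * Diagonal operators and extension by density *)

Section Diagonal.
Context {R : realType} {X : completeNormedModType R[i]}.
Variables (ip : {dot X for Num.conj}) (phi psi : nat -> X).
Hypotheses (hilb : is_hilbert ip) (rb : riesz_basis phi)
  (bi : biorthogonal ip phi psi).
Variables (F : X -> X) (d : nat -> R[i]).
Hypotheses (bF : bounded_op F) (Fd : forall n, F (phi n) = d n *: phi n).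

Lemma diagonal_sum N (a : nat -> R[i]) :
  F (\sum_(i < N) a i *: phi i) = \sum_(i < N) (a i * d i) *: phi i.
Proof.
have [lF _] := bF; rewrite (lin_sum lF); apply: eq_bigr => i _.
by rewrite (linZ lF) Fd scalerA.
Qed.

(** A bounded operator acts term by term on the expansion of [x]. *)
Lemma rcoord_diagonal k x : rcoord ip psi k (F x) = d k * rcoord ip psi k x :> R[i].
Proof.
have c1 : F (rproj ip phi psi N x) @[N --> \oo] --> F x.
  exact: (bounded_op_cvg bF (@rproj_cvg _ _ ip phi psi hilb rb bi x)).
have c2 : rcoord ip psi k (F (rproj ip phi psi N x)) @[N --> \oo] -->
    rcoord ip psi k (F x).
  exact: (bounded_op_cvg (rcoord_bounded psi hilb k) c1).
have c3 : rcoord ip psi k (F (rproj ip phi psi N x)) @[N --> \oo] -->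
    (d k * rcoord ip psi k x : CC R).
  apply: cvg_near_cst; exists k.+1 => // N /= kN.
  rewrite (diagonal_sum N (fun i => rcoord ip psi i x)).
  by rewrite (rcoord_sum bi k N (fun i => (rcoord ip psi i x : R[i]) * d i)) kN mulrC.
have E := @rcvg_unique _ (CC R) _ \oo _ _ _ _ c2 c3.
exact: E.
Qed.

End Diagonal.

(** The constant depends on the basis only.  For the operators of the semigroup this
    bounds the growth. *)
Lemma diagonal_contraction (R : realType) (X : completeNormedModType R[i])
    (phi : nat -> X) : riesz_basis phi ->
  exists2 K : R, 0 < K & forall (F : X -> X) (d : nat -> R[i]), bounded_op F ->
    (forall n, F (phi n) = d n *: phi n) -> (forall n, cabs (d n) <= 1) ->
    forall x, rnorm (F x) <= K * rnorm x.
Proof.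
move=> rb; have [m [M [m0 M0 mM]]] := riesz_bounds rb.
exists (Num.sqrt (M / m)); first by rewrite sqrtr_gt0 divr_gt0.
move=> F d bF Fd d1; apply: (rnorm_bounded_closure rb bF) => N a.
rewrite (diagonal_sum bF Fd) -(@ler_pXn2r _ 2) ?nnegrE ?mulr_ge0 ?sqrtr_ge0 ?rnorm_ge0//.
rewrite exprMn sqr_sqrtr ?divr_ge0 ?(ltW m0) ?(ltW M0)//.
have /andP[_ h1] := mM N (fun i => a i * d i).
have /andP[h2 _] := mM N a.
apply: le_trans h1 _; rewrite -mulrA ler_pM2l// ler_pdivlMl//.
apply: le_trans h2; rewrite ler_pM2l// ler_sum// => i _.
by rewrite cabsM lerXn2r ?nnegrE ?mulr_ge0 ?rnorm_ge0// ler_piMr ?rnorm_ge0.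
Qed.

Section DenseExtension.
Context {R : realType}.
Variables (X : normedModType R[i]) (W Y : completeNormedModType R[i]).
Variables (j : X -> W) (f : X -> Y).
Hypotheses (lj : linear j) (lf : linear f) (jf : forall x, rnorm (j x) = rnorm (f x)).
Hypothesis dense_j : closure (range j) = setT.

Lemma dense_approx (w : W) (e : R) : 0 < e -> exists x, rnorm (j x - w) < e.
Proof.
move=> e0; have : closure (range j) w by rewrite dense_j.
by move=> /rclosureP/(_ e0)[_ [x _ <-] xw]; exists x.
Qed.

Let rel (w : W) (y : Y) := forall e : R, 0 < e ->
  exists x, rnorm (j x - w) < e /\ rnorm (f x - y) < e.

Let rel_exists w : exists y, rel w y.
Proof.
have /choice[x xw] : forall n : nat, exists x, rnorm (j x - w) < n.+1%:R^-1.
  by move=> n; apply: dense_approx; rewrite invr_gt0.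
have hcvg : (fun n : nat => n.+1%:R^-1 : R) @ \oo --> (0 : R) by exact: cvg_harmonic.
have small (e : R) : 0 < e -> exists N, forall n, (N <= n)%N -> n.+1%:R^-1 < e.
  move=> e0; have /cvgrPdist_lt/(_ _ e0)[N _ NP] := hcvg.
  by exists N => n /NP; rewrite sub0r normrN ger0_norm.
have [y xy] : exists y : Y, (fun n => f (x n)) @ \oo --> y.
  apply: rcauchy_cvg => e e0.
  have [N NP] := small (e / 2) (divr_gt0 e0 (ltr0Sn _ 1)).
  exists N => m n Nm Nn; rewrite -(linB lf) -jf (linB lj).
  apply: le_lt_trans (ler_rdistD w _ _) _; rewrite [e]splitr ltrD//.
    exact: lt_trans (xw m) (NP m Nm).
  by rewrite rdistC; exact: lt_trans (xw n) (NP n Nn).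
exists y => e e0; have [N NP] := small e e0.
move/rcvgP/(_ _ e0) : xy => [N' _ N'P].
exists (x (maxn N N')); split; last by apply: N'P => /=; exact: leq_maxr.
by apply: lt_trans (xw _) _; apply: NP; exact: leq_maxl.
Qed.

(** The closure of the graph of [f] over [j] is single-valued because limits inherit
    the isometry, and total because the target is complete. *)
Lemma isometric_extension : exists r : W -> Y,
  [/\ linear r, forall x, r (j x) = f x & forall w, rnorm (r w) = rnorm w].
Proof.
have [r rP] := choice rel_exists.
have dist w y w' y' : rel w y -> rel w' y' -> rnorm (y - y') <= rnorm (w - w').
  move=> wy w'y'; apply/ler_addgt0Pr => e e0.
  have e4 : 0 < e / 4 by rewrite divr_gt0.
  have [x [x1 x2]] := wy _ e4; have [x' [x'1 x'2]] := w'y' _ e4.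
  have h1 := ler_rdistD (f x) y y'; have h2 := ler_rdistD (f x') (f x) y'.
  have h3 : rnorm (f x - f x') = rnorm (j x - j x') by rewrite -(linB lf) -jf (linB lj).
  have h4 := ler_rdistD w (j x) (j x'); have h5 := ler_rdistD w' w (j x').
  move: h1 h2 h4 h5; rewrite h3 (rdistC y (f x)) (rdistC w' (j x')).
  by move: x1 x2 x'1 x'2; lra.
have rnormr w : rnorm (r w) = rnorm w.
  have r0 : rel 0 0.
    by move=> e e0; exists 0; rewrite (lin0 lf) (lin0 lj) !subrr !rnorm0.
  apply/eqP; rewrite eq_le; have := dist _ _ _ _ (rP w) r0; rewrite !subr0 => ->/=.
  apply/ler_addgt0Pr => e e0; have e2 : 0 < e / 2 by rewrite divr_gt0.
  have [x [x1 x2]] := rP w _ e2.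
  have h1 := ler_rdistD (j x) w 0; have h2 := ler_rdistD (r w) (f x) 0.
  move: h1 h2; rewrite !subr0 -(jf x) (rdistC w); lra.
have uniq w y : rel w y -> r w = y.
  move=> wy; have := dist _ _ _ _ (rP w) wy; rewrite subrr rnorm0 => h.
  by apply/eqP; rewrite -subr_eq0; apply/eqP/rnorm_eq0/eqP; rewrite eq_le h rnorm_ge0.
exists r; split=> //; last first.
  by move=> x; apply: uniq => e e0; exists x; rewrite !subrr !rnorm0.
move=> a w w'; apply: uniq => e e0.
have A0 := @rnorm_ge0 _ (CC R) a.
have K0 : 0 < cabs a + 1 by rewrite ltr_wpDl.
have e1 : 0 < e / (cabs a + 1) by rewrite divr_gt0.
have [x [x1 x2]] := rP w _ e1; have [x' [x'1 x'2]] := rP w' _ e1.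
have eE : e = cabs a * (e / (cabs a + 1)) + e / (cabs a + 1).
  by field; rewrite gt_eqF.
exists (a *: x + x'); rewrite lj lf; split.
  rewrite opprD addrACA -scalerBr (le_lt_trans (ler_rnormD _ _))// eE.
  by rewrite ler_ltD// rnormZ ler_wpM2l// ltW.
rewrite opprD addrACA -scalerBr (le_lt_trans (ler_rnormD _ _))// eE.
by rewrite ler_ltD// rnormZ ler_wpM2l// ltW.
Qed.

Lemma dense_eq (V : normedModType R[i]) (F G : W -> V) : bounded_op F -> bounded_op G ->
  (forall x, F (j x) = G (j x)) -> forall w, F w = G w.
Proof.
move=> /bounded_opP[lF [M M0 FM]] /bounded_opP[lG [N N0 GN]] FG w.
apply/eqP; rewrite -subr_eq0; apply/eqP/rnorm_eq0/eqP.
rewrite eq_le rnorm_ge0 andbT; apply/ler_addgt0Pr => e e0; rewrite add0r.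
have K0 : 0 < M + N + 1 by rewrite ltr_wpDl// addr_ge0.
have [x xw] := dense_approx w (divr_gt0 e0 K0).
have -> : F w - G w = F (w - j x) - G (w - j x).
  by rewrite (linB lF) (linB lG) FG opprB addrA subrK.
apply: le_trans (ler_rnormB _ _) _; apply: le_trans (lerD (FM _) (GN _)) _.
rewrite -mulrDl rdistC; apply: le_trans (ler_wpM2l (addr_ge0 M0 N0) (ltW xw)) _.
by rewrite mulrCA ler_piMr ?(ltW e0)// ler_pdivrMr// mul1r lerDl.
Qed.

End DenseExtension.

(** * Coordinates of a Riesz-spectral node *)

Lemma at_right0I (R : realType) (P : set R) (d : R) : 0 < d ->
  (forall h, 0 < h < d -> P h) -> \forall h \near 0^'+, P h.
Proof.
move=> d0 dP; exists d => // h /= hd h0; apply: dP; rewrite h0.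
by move: hd; rewrite /ball_ /= sub0r normrN gtr0_norm.
Qed.

Section NodeCoordinates.
Context {R : realType} {X : completeNormedModType R[i]}.
Variables (ip : {dot X for Num.conj}) (S : system_node (CC R) X (CC R)).
Variables (phi psi : nat -> X) (lambda : nat -> R[i]).
Hypotheses (hilb : is_hilbert ip) (rs : riesz_spectral S phi lambda)
  (bi : biorthogonal ip phi psi) (neg : forall n, complex.Re (lambda n) < 0).

Local Notation T := (sn_T S).
Local Notation dom := (sn_dom S).
Local Notation A := (sn_A S).
Local Notation beta := (sn_beta S).
Local Notation emb := (@sn_emb _ _ _ _ S).
Local Notation res := (resolvent dom A beta).
Local Notation co := (rcoord ip psi).

Lemma rs_basis : riesz_basis phi. Proof. by case: rs. Qed.

Lemma dom0 : dom 0 /\ A 0 = 0.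
Proof.
apply/(sn_gen S 0 0).
apply: cvg_near_cst; exists 1 => //= h _ h0.
by rewrite (lin0 (sg_linear T (ltW h0))) subr0 scaler0.
Qed.

Lemma domP x v : dom x -> A x = v -> (h^-1)%:C *: (T h x - x) @[h --> 0^'+] --> v.
Proof. by move=> dx Ax; apply/(sn_gen S x v). Qed.

Lemma dom_lin (a : R[i]) x y : dom x -> dom y ->
  dom (a *: x + y) /\ A (a *: x + y) = a *: A x + A y.
Proof.
move=> dx dy; apply/(sn_gen S _ _).
have cx := domP dx erefl; have cy := domP dy erefl.
have cax : a *: ((h^-1)%:C *: (T h x - x)) @[h --> 0^'+] --> a *: A x.
  exact: cvgZr.
have /rcvgP c : a *: ((h^-1)%:C *: (T h x - x)) + (h^-1)%:C *: (T h y - y)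
    @[h --> 0^'+] --> a *: A x + A y by exact: cvgD cax cy.
have E : \forall h \near 0^'+, (h^-1)%:C *: (T h (a *: x + y) - (a *: x + y)) =
    a *: ((h^-1)%:C *: (T h x - x)) + (h^-1)%:C *: (T h y - y).
  exists 1 => //= h _ h0; rewrite (sg_linear T (ltW h0)) opprD addrACA -scalerBr.
  by rewrite scalerDr !scalerA [a * _]mulrC.
apply/rcvgP => e e0; have := c e e0.
by move: E; apply: filterS2 => h /= ->.
Qed.

Lemma resP x : dom (res x) /\ beta *: res x - A (res x) = x.
Proof.
have [ex _] := sn_beta_res S; have [v [vP _]] := ex x.
by rewrite /resolvent; case: xgetP => [w _ //|/(_ v)].
Qed.

Lemma res_unique x v : dom v -> beta *: v - A v = x -> res x = v.
Proof.
move=> dv vx; have [ex _] := sn_beta_res S; have [v' [v'P uniq]] := ex x.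
by rewrite -(uniq v (conj dv vx)) (uniq _ (resP x)).
Qed.

Lemma res_bounded : bounded_op res.
Proof. by case: (sn_beta_res S). Qed.

Lemma beta_lambda n : beta - lambda n != 0.
Proof.
apply/negP => /eqP bl; have [phi0 dphi Aphi] := rs.2 n.
have [d0 A0] := dom0.
have h1 : res 0 = phi n by apply: res_unique => //; rewrite Aphi -scalerBl bl scale0r.
have h2 : res 0 = 0 by apply: res_unique => //; rewrite A0 scaler0 subr0.
by move: phi0; rewrite -h1 h2 eqxx.
Qed.

Lemma dom_scale (a : R[i]) x : dom x -> dom (a *: x) /\ A (a *: x) = a *: A x.
Proof.
move=> dx; have [d0 A0] := dom0; have := dom_lin a dx d0.
by rewrite A0 !addr0.
Qed.

Lemma res_phi n : res (phi n) = (beta - lambda n)^-1 *: phi n.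
Proof.
have [phi0 dphi Aphi] := rs.2 n; have [dc Ac] := dom_scale (beta - lambda n)^-1 dphi.
apply: res_unique => //; rewrite Ac Aphi !scalerA -scalerBl [beta * _]mulrC -mulrBr.
by rewrite mulVf ?scale1r// beta_lambda.
Qed.

Lemma co_res k x : co k (res x) = (beta - lambda k)^-1 * co k x :> R[i].
Proof. exact: (rcoord_diagonal hilb rs_basis bi res_bounded res_phi). Qed.

Lemma T_phi n t : 0 <= t -> T t (phi n) = cexp (t%:C * lambda n) *: phi n.
Proof.
move=> t0; have [phi0 dphi Aphi] := rs.2 n.
by apply: sg_eigen t0; exact: domP.
Qed.

Lemma co_T k t x : 0 <= t -> co k (T t x) = cexp (t%:C * lambda k) * co k x :> R[i].
Proof.
move=> t0; apply: (rcoord_diagonal hilb rs_basis bi (sg_bounded T t0)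
  (fun n => T_phi n t0)).
Qed.

(** The operators of the semigroup are diagonal with entries of modulus at most 1,
    since the eigenvalues lie in the left half-plane; hence 1 exceeds the growth
    bound. *)
Lemma growth_half_plane_neq0 : growth_half_plane T !=set0.
Proof.
have [K K0 KP] := diagonal_contraction rs_basis.
exists 1; rewrite /growth_half_plane/= .
apply: (@le_lt_trans _ _ 0%:E); last by rewrite lte_fin.
apply: ereal_inf_lbound; exists 0 => //=.
apply: (@le_lt_trans _ _ K%:E); last by rewrite ltry.
apply: ge_ereal_sup => _ [t /= t0 <-].
rewrite mulr0 oppr0 expR0 mul1e; apply: opnorm_le; first exact: ltW.
apply: (KP _ (fun n => cexp (t%:C * lambda n))).
- exact: (sg_bounded T (ltW t0)).
- by move=> n; rewrite T_phi// ltW.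
- move=> n; rewrite cabs_cexp ReZ -expR0 ler_expR mulr_ge0_le0//; first exact: ltW.
  exact: (ltW (neg n)).
Qed.

(** The norm of [T(t)] is at least the modulus [expR (t * Re (lambda n))] of each of
    its eigenvalues, so the growth bound dominates all the [Re (lambda n)]. *)
Lemma growth_half_plane_gap (z : R[i]) : growth_half_plane T z ->
  exists2 w : R, w < complex.Re z & forall n, complex.Re (lambda n) <= w.
Proof.
rewrite /growth_half_plane/= => /ereal_inf_lt[_ [w /= wfin <-]].
rewrite lte_fin => wz; exists w => // n; rewrite leNgt; apply/negP => wl.
set d := complex.Re (lambda n) - w; have d0 : 0 < d by rewrite subr_gt0.
have g0 : (0 <= growth_sup T w)%E.
  apply: (@le_trans _ _ ((expR (- (1 * w))%R)%:E * opnorm (T 1%R))%E).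
    by rewrite mule_ge0// ?opnorm_ge0// lee_fin expR_ge0.
  by apply: ereal_sup_ubound; exists 1 => //=.
pose K := fine (growth_sup T w).
have KE : growth_sup T w = K%:E by rewrite fineK// ge0_fin_numE.
have K0 : 0 <= K by rewrite fine_ge0.
have t0 : 0 < (K + 1) / d by rewrite divr_gt0// ltr_wpDl.
set t := (K + 1) / d in t0.
have : ((expR (- (t * w))%R)%:E * opnorm (T t) <= K%:E)%E.
  by rewrite -KE; apply: ereal_sup_ubound; exists t.
apply/negP; rewrite -ltNge.
have [phi0 _ _] := rs.2 n.
have p0 : 0 < rnorm (phi n).
  by rewrite lt_neqAle rnorm_ge0 andbT eq_sym; apply: contra phi0 => /eqP/rnorm_eq0 ->.
have op : ((expR (t * complex.Re (lambda n)))%:E <= opnorm (T t))%E.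
  have := @opnorm_ge _ _ _ (T t) ((rnorm (phi n))^-1%:C *: phi n).
  rewrite rnormZ cabsR gtr0_norm ?invr_gt0// mulVf ?gt_eqF// => /(_ (lexx 1)).
  rewrite (linZ (sg_linear T (ltW t0))) T_phi ?(ltW t0)// !rnormZ cabsR gtr0_norm ?invr_gt0//.
  by rewrite mulrCA mulVf ?gt_eqF// mulr1 cabs_cexp ReZ.
apply: lt_le_trans (lee_wpmul2l _ op); first last.
  by rewrite lee_fin expR_ge0.
rewrite -EFinM -expRD lte_fin addrC -mulrBr -/d.
apply: lt_le_trans (expR_ge1Dx _).
by rewrite /t divfK ?gt_eqF//; lra.
Qed.

(** The distance from [z] to the eigenvalues is bounded below, so changing the
    spectral parameter costs a factor that is uniform in [n]. *)
Lemma gap_bound (z : R[i]) : growth_half_plane T z ->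
  exists2 K : R, 0 < K & forall n,
    [/\ z - lambda n != 0, cabs (beta - lambda n) <= K * cabs (z - lambda n) &
        `|complex.Re (lambda n)| <= K * cabs (z - lambda n)].
Proof.
move=> /growth_half_plane_gap[w wz lw].
set d := complex.Re z - w; have d0 : 0 < d by rewrite subr_gt0.
have zl n : d <= cabs (z - lambda n).
  apply: le_trans (cabs_Re _); apply: le_trans (ler_norm _).
  by rewrite raddfB/= lerD2l lerN2.
pose K := 1 + (cabs (beta - z) + cabs z) / d.
have K1 : 1 <= K by rewrite lerDl divr_ge0 ?(ltW d0)// addr_ge0 ?rnorm_ge0.
exists K => [|n]; first exact: lt_le_trans ltr01 K1.
have zn0 : 0 < cabs (z - lambda n) by exact: lt_le_trans d0 (zl n).
have key (c e : R) : 0 <= e -> e <= cabs (beta - z) + cabs z ->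
    c <= e + cabs (z - lambda n) -> c <= K * cabs (z - lambda n).
  move=> e0 eK ce; apply: le_trans ce _; rewrite /K mulrDl mul1r addrC lerD2l.
  apply: le_trans eK _; rewrite -mulrA ler_peMr ?addr_ge0 ?rnorm_ge0//.
  by rewrite mulrC ler_pdivlMr// mul1r.
split.
- by rewrite -cabs_gt0.
- apply: (key _ (cabs (beta - z))); rewrite ?rnorm_ge0// ?lerDl ?rnorm_ge0//.
  exact: (@ler_rdistD _ (CC R)).
- apply: (key _ (cabs z)); rewrite ?rnorm_ge0// ?lerDr ?rnorm_ge0//.
  apply: le_trans (cabs_Re _) _; rewrite rdistC addrC.
  by have := @ler_rnormD _ (CC R) (lambda n - z) z; rewrite subrK.
Qed.

Local Notation W := (sn_X1n S).
Local Notation T1 := (sn_T1n S).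
Local Notation A1 := (@sn_A1n _ _ _ _ S).
Local Notation B := (@sn_B _ _ _ _ S).

(** The norm of the extrapolation space is that of the resolvent, which therefore
    identifies this space isometrically with [X]. *)
Lemma extended_resolvent : exists r : W -> X,
  [/\ linear r, forall x, r (emb x) = res x & forall w, rnorm (r w) = rnorm w].
Proof.
apply: isometric_extension; last exact: sn_emb_dense.
- exact: sn_emb_linear.
- by case: res_bounded.
- exact: sn_emb_norm.
Qed.

(** The resolvent on the extrapolation space, with values in [X]. *)
Definition eres : W -> X := projT1 (cid extended_resolvent).

Lemma eresP : [/\ linear eres, forall x, eres (emb x) = res x &
  forall w, rnorm (eres w) = rnorm w].
Proof. exact: (projT2 (cid extended_resolvent)). Qed.

(** The coordinates of the extrapolation space: the factor undoes the action of
    the resolvent on the eigenvector. *)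
Definition ecoord (k : nat) (w : W) : CC R := (beta - lambda k) *: co k (eres w).

Lemma ecoord_emb k x : ecoord k (emb x) = co k x.
Proof.
have [_ rE _] := eresP; rewrite /ecoord rE co_res.
change ((beta - lambda k) * ((beta - lambda k)^-1 * co k x) = co k x :> R[i]).
by rewrite mulrA mulfV ?mul1r// beta_lambda.
Qed.

Lemma ecoord_bounded k : bounded_op (ecoord k).
Proof.
have [lr _ rn] := eresP; have /bounded_opP[lc [M M0 cM]] := rcoord_bounded psi hilb k.
apply/bounded_opP; split.
  by move=> a x y; rewrite /ecoord lr lc scalerDr !scalerA mulrC.
exists (cabs (beta - lambda k) * M) => [|w]; first by rewrite mulr_ge0 ?rnorm_ge0.
by rewrite rnormZ -mulrA ler_wpM2l ?rnorm_ge0// -rn.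
Qed.

(** The resolvent is injective on the extrapolation space, and so are coordinates on
    [X]. *)
Lemma ecoord_eq0 w : (forall k, ecoord k w = 0) -> w = 0.
Proof.
have [lr _ rn] := eresP; move=> w0; apply: rnorm_eq0; rewrite -rn.
have -> : eres w = 0; last exact: rnorm0.
apply: (rcoord_inj hilb rs_basis bi) => k.
rewrite (lin0 (rcoord_linear ip psi k)).
have /eqP := w0 k; rewrite /ecoord scaler_eq0 (negbTE (beta_lambda k)) => /eqP.
by [].
Qed.

Lemma ecoord_inj w w' : (forall k, ecoord k w = ecoord k w') -> w = w'.
Proof.
move=> ww; apply/eqP; rewrite -subr_eq0; apply/eqP/ecoord_eq0 => k.
have [lc _] := ecoord_bounded k; rewrite (linB lc) ww; exact: subrr.
Qed.

(** Both sides are continuous in [w] and agree on [X]. *)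
Lemma ecoord_T k t w : 0 <= t -> ecoord k (T1 t w) = cexp (t%:C * lambda k) *: ecoord k w.
Proof.
move=> t0; apply: (dense_eq (sn_emb_dense S) (F := fun w => ecoord k (T1 t w))
  (G := fun w => cexp (t%:C * lambda k) *: ecoord k w)).
- have /bounded_opP[lc [M M0 cM]] := ecoord_bounded k.
  have /bounded_opP[lt [N N0 tN]] := sg_bounded T1 t0.
  apply/bounded_opP; split; first by move=> a x y; rewrite lt lc.
  exists (M * N) => [|x]; first exact: mulr_ge0.
  by rewrite (le_trans (cM _))// -mulrA ler_wpM2l.
- have /bounded_opP[lc [M M0 cM]] := ecoord_bounded k.
  apply/bounded_opP; split.
    by move=> a x y; rewrite lc scalerDr !scalerA [_ * a]mulrC.
  exists (cabs (cexp (t%:C * lambda k)) * M) => [|x].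
    by rewrite mulr_ge0 ?rnorm_ge0//.
  by rewrite rnormZ -mulrA ler_wpM2l ?rnorm_ge0.
- by move=> x; rewrite sn_T1n_ext// !ecoord_emb; exact: co_T.
Qed.

Lemma cexp_quotient (l : R[i]) (v : CC R) :
  (h^-1)%:C *: (cexp (h%:C * l) *: v - v) @[h --> 0^'+] --> l *: v.
Proof.
apply/rcvgP => e e0; have v1 : 0 < rnorm v + 1 by rewrite ltr_wpDl ?rnorm_ge0.
have [d d0 dP] := @cexp_small _ l (e / (rnorm v + 1)) (divr_gt0 e0 v1).
apply: (at_right0I d0) => h /andP[h0 hlt].
have hd : `|h| < d by rewrite gtr0_norm.
have -> : (h^-1)%:C *: (cexp (h%:C * l) *: v - v) - l *: v =
    ((h^-1)%:C * (cexp (h%:C * l) - 1 - h%:C * l)) *: v.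
  rewrite [in RHS]mulrBr mulrA -rmorphM/= mulVf ?gt_eqF// mul1r scalerBl -scalerA.
  by rewrite scalerBl scale1r.
rewrite rnormZ cabsM cabsR gtr0_norm ?invr_gt0//.
have h1 : h^-1 * cabs (cexp (h%:C * l) - 1 - h%:C * l) <= e / (rnorm v + 1).
  by rewrite mulrC ler_pdivrMr//; have := dP h hd; rewrite gtr0_norm.
apply: le_lt_trans (ler_wpM2r (rnorm_ge0 _) h1) _.
by rewrite -mulrA gtr_pMr// mulrC ltr_pdivrMr// mul1r ltrDl.
Qed.

(** The extension of [A] is the derivative of the extended semigroup at 0, which in
    coordinates is that of an exponential. *)
Lemma ecoord_A k x : ecoord k (A1 x) = lambda k *: co k x.
Proof.
have gx : (h^-1)%:C *: (T1 h (emb x) - emb x) @[h --> 0^'+] --> A1 x.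
  have [g _] := @sn_A1n_gen _ _ _ _ S (emb x) (A1 x).
  by apply: g; exists x.
have c1 : ecoord k ((h^-1)%:C *: (T1 h (emb x) - emb x)) @[h --> 0^'+] --> ecoord k (A1 x).
  exact: bounded_op_cvg (ecoord_bounded k) gx.
have c2 : ecoord k ((h^-1)%:C *: (T1 h (emb x) - emb x)) @[h --> 0^'+] --> lambda k *: co k x.
  have [lc _] := ecoord_bounded k.
  have E : \forall h \near 0^'+, ecoord k ((h^-1)%:C *: (T1 h (emb x) - emb x)) =
      (h^-1)%:C *: (cexp (h%:C * lambda k) *: co k x - co k x).
    apply: (at_right0I ltr01) => h /andP[h0 _].
    by rewrite (linZ lc) (linB lc) ecoord_T ?(ltW h0)// ecoord_emb.
  apply/rcvgP => e e0; have /rcvgP/(_ e e0) := @cexp_quotient (lambda k) (co k x).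
  by move: E; apply: filterS2 => h /= ->.
exact: (@rcvg_unique _ (CC R) _ _ _ _ _ _ c1 c2).
Qed.

Definition bcoef k : R[i] := ecoord k (B (1 : R[i])).

(** A functional is determined by its values on the dense subspace [X]. *)
Lemma coef_bE k : coef_b S ip psi k = bcoef k.
Proof.
rewrite /coef_b /extrapolation_pairing; case: xgetP => [b _ [F [bF FE Fb]]|].
  rewrite -[LHS]Fb; apply: (dense_eq (sn_emb_dense S) bF (ecoord_bounded k)) => x.
  by rewrite FE ecoord_emb.
move=> /(_ (bcoef k)); case; exists (ecoord k); split => //; first exact: ecoord_bounded.
exact: ecoord_emb.
Qed.

(** The quotients are the coordinates of an element of [X], the resolvent applied to
    [B 1]. *)
Lemma bcoef_bessel : exists K : R, forall N,
  \sum_(i < N) cabs (bcoef i / (beta - lambda i)) ^+ 2 <= K.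
Proof.
have [K K0 KP] := bessel hilb rs_basis bi.
exists (K * rnorm (eres (B (1 : R[i]))) ^+ 2) => N; apply: le_trans (KP N _).
rewrite le_eqVlt; apply/orP; left; apply/eqP; apply: eq_bigr => i _.
congr (cabs _ ^+ 2); rewrite /bcoef /ecoord.
change ((beta - lambda i) * co i (eres (B (1 : R[i]))) / (beta - lambda i) = co i (eres (B (1 : R[i]))) :> R[i]).
by rewrite mulrAC mulfV ?mul1r// beta_lambda.
Qed.

(** Membership in [X], and in the domain of [A], is shown by comparison with the
    square summable coordinates of the resolvent applied to [B 1]. *)
Lemma weighted_coordinates (a : nat -> R[i]) (C : R) :
  (forall k, cabs (a k) <= C * cabs (bcoef k / (beta - lambda k))) ->
  exists x, forall k, co k x = a k.
Proof.
move=> aC; have [K KP] := bcoef_bessel.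
apply: (riesz_fischer hilb rs_basis bi (K := C ^+ 2 * K)) => N.
apply: le_trans (ler_wpM2l (sqr_ge0 C) (KP N)); rewrite mulr_sumr ler_sum// => i _.
rewrite -exprMn lerXn2r ?nnegrE ?rnorm_ge0//.
exact: le_trans (rnorm_ge0 _) (aC i).
Qed.

Lemma of_X1nE (w : W) x : (forall k, ecoord k w = co k x) -> of_X1n w = x.
Proof.
move=> wx; have ex : emb x = w by apply: ecoord_inj => k; rewrite ecoord_emb wx.
rewrite /of_X1n; case: xgetP => [y _ /= yw|/(_ x)//].
by apply: (rcoord_inj hilb rs_basis bi) => k; rewrite -!ecoord_emb yw ex.
Qed.

(** The candidate coordinates define an element of [X] that solves the resolvent
    equation, as do the coordinates of any solution. *)
Lemma ext_resolvent_coord (z : R[i]) (v : CC R) k : growth_half_plane T z ->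
  co k (ext_resolvent emb A1 z (B v)) = (v : R[i]) * bcoef k / (z - lambda k) :> R[i].
Proof.
move=> /gap_bound[K K0 KP].
have [lB _] := sn_B_bounded S.
have BE j : ecoord j (B v) = (v : R[i]) * bcoef j :> R[i].
  have [lc _] := ecoord_bounded j.
  rewrite -[v in LHS](mulr1 (v : R[i])).
  by rewrite -[(v : R[i]) * 1]/((v : R[i]) *: (1 : CC R)) (linZ lB) (linZ lc).
have lhs x j : ecoord j (z *: emb x - A1 x) = (z - lambda j) * co j x :> R[i].
  have [lc _] := ecoord_bounded j.
  rewrite (linB lc) (linZ lc) ecoord_emb ecoord_A.
  change (z * co j x - lambda j * co j x = (z - lambda j) * co j x :> R[i]).
  by rewrite mulrBl.
have [x xE] : exists x, forall j, co j x = (v : R[i]) * bcoef j / (z - lambda j) :> R[i].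
  apply: (@weighted_coordinates _ (cabs v * K)) => j; have [z0 h _] := KP j.
  have b0 : 0 < cabs (beta - lambda j) by rewrite cabs_gt0 beta_lambda.
  have hz : (cabs (z - lambda j))^-1 <= K * (cabs (beta - lambda j))^-1.
    by rewrite ler_pdivlMr// ler_pdivrMl ?cabs_gt0// mulrC.
  rewrite !cabsM !cabsV [leRHS]mulrACA.
  by rewrite ler_wpM2l// !mulr_ge0 ?rnorm_ge0.
have xP : z *: emb x - A1 x = B v.
  apply: ecoord_inj => j; rewrite BE lhs xE.
  have [z0 _ _] := KP j.
  by rewrite mulrC divfK.
rewrite /ext_resolvent; case: xgetP => [y _ /= yP|/(_ x)//].
have := lhs y k; rewrite yP BE => ->; have [z0 _ _] := KP k.
by rewrite mulrAC mulfV ?mul1r.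
Qed.

End NodeCoordinates.

(** * Dominated series and uniform limits *)

Section Series.
Context {R : realType}.

(** The Weierstrass test with the tail of the majorant as rate; when [h] depends on a
    parameter and [M] does not, convergence is uniform in the parameter. *)
Lemma dominated_series (V : completeNormedModType R[i]) (a : nat -> R) (sigma : R) :
  (forall k, 0 <= a k) -> (fun N => \sum_(k < N) a k) @ \oo --> sigma ->
  forall (h : nat -> V) (M : R), 0 <= M -> (forall k, rnorm (h k) <= M * a k) ->
  exists l : V, forall N, rnorm (\sum_(k < N) h k - l) <= M * (sigma - \sum_(k < N) a k).
Proof.
move=> a0 acvg h M M0 hM; set S := fun N => _ in acvg.
have Snd : nondecreasing_seq S.
  by apply/nondecreasing_seqP => n; rewrite /S big_ord_recr/= lerDl.
have Sle n : S n <= sigma.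
  rewrite -(cvg_lim _ acvg)//; apply: nondecreasing_cvgn_le => //.
  by apply/cvg_ex; exists sigma.
pose H N : V := \sum_(k < N) h k.
have HS p q : (p <= q)%N -> rnorm (H q - H p) <= M * (S q - S p).
  move=> pq; rewrite -(subnKC pq); elim: (q - p)%N => [|d IH].
    by rewrite addn0 !subrr rnorm0 mulr0.
  rewrite addnS; apply: le_trans (ler_rdistD (H (p + d)%N) _ _) _.
  have -> : H (p + d).+1 - H (p + d)%N = h (p + d)%N.
    by rewrite /H big_ord_recr/= addrAC subrr add0r.
  apply: le_trans (lerD (hM _) IH) _; rewrite -mulrDr ler_wpM2l//.
  by rewrite addrA lerD2r /S big_ord_recr/= addrC.
have [l Hl] : exists l : V, H @ \oo --> l.
  apply: rcauchy_cvg => e e0.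
  have M1 : 0 < M + 1 by rewrite ltr_wpDl.
  have e1 : 0 < e / (M + 1) by rewrite divr_gt0.
  have /cvgrPdist_lt/(_ _ e1)[N _ NP] := acvg.
  have key p q : (N <= p)%N -> (p <= q)%N -> rnorm (H q - H p) < e.
    move=> Np pq; apply: le_lt_trans (HS p q pq) _.
    have := NP p Np; rewrite ger0_norm ?subr_ge0// => h1.
    have h2 : S q - S p <= sigma - S p by rewrite lerD2r.
    have h3 : S q - S p <= e / (M + 1) by rewrite (le_trans h2)// ltW.
    apply: le_lt_trans (ler_wpM2l M0 h3) _.
    by rewrite mulrCA gtr_pMr// ltr_pdivrMr// mul1r ltrDl.
  exists N => p q Np Nq; have [pq|qp] := leqP p q; first by rewrite rdistC key.
  by rewrite key// ltnW.
exists l => N; rewrite -/(H N) rdistC.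
have c1 : H n - H N @[n --> \oo] --> l - H N by apply: cvgB => //; exact: cvg_cst.
have c2 : \forall n \near \oo, rnorm (H n - H N) <= M * (sigma - S N).
  exists N => // n /= Nn; apply: le_trans (HS N n Nn) _.
  by rewrite ler_wpM2l// lerD2r Sle.
exact: rnorm_cvg_le c1 c2.
Qed.

Definition unif_cvg (V : normedModType R[i]) (g : nat -> R -> V) (f : R -> V) (T : R) :=
  forall e : R, 0 < e -> exists N, forall n, (N <= n)%N ->
    forall t, 0 <= t <= T -> rnorm (g n t - f t) <= e.

Lemma unif_cvg_cont (V : normedModType R[i]) (g : nat -> R -> V) (f : R -> V) (T : R) :
  (forall n, cont_on (g n) 0 T) -> unif_cvg g f T -> cont_on f 0 T.
Proof.
move=> cg gf t e tT e0; have e4 : 0 < e / 4 by rewrite divr_gt0.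
have [N NP] := gf _ e4; have [d d0 dP] := cg N t _ tT e4.
exists d => // s sT st.
have h1 := NP N (leqnn _) s sT; have h2 := NP N (leqnn _) t tT; have h3 := dP s sT st.
have h4 := ler_rdistD (g N s) (f s) (f t); have h5 := ler_rdistD (g N t) (g N s) (f t).
rewrite (rdistC (f s) (g N s)) in h4.
by move: h1 h2 h3 h4 h5; lra.
Qed.

(** The error is at most the uniform distance times the length of the interval. *)
Lemma unif_cvg_bochner (V : completeNormedModType R[i]) (g : nat -> R -> V) (f : R -> V)
    (T : R) : 0 <= T -> (forall n, cont_on (g n) 0 T) -> unif_cvg g f T ->
  bochner `[0, T] (g n) @[n --> \oo] --> bochner `[0, T] f.
Proof.
move=> T0 cg gf; have cf := unif_cvg_cont cg gf.
have fi := bochner_cont T0 cf.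
apply/rcvgP => e e0; have T1 : 0 < T + 1 by rewrite ltr_wpDl.
have [N NP] := gf _ (divr_gt0 e0 T1); exists N => // n /= Nn.
have gi := bochner_cont T0 (cg n).
have mI : measurable `[0, T]%classic by exact: measurable_itv.
have b1 := bochner_lin (-1) mI (bochnerP fi) (bochnerP gi).
rewrite scaleN1r addrC in b1; rewrite -(bochnerE mI b1).
have eT : 0 <= e / (T + 1) by rewrite divr_ge0 ?(ltW e0)// ltW.
apply: (@le_lt_trans _ _ (e / (T + 1) * (T - 0))).
  apply: (bochner_le_cst T0 eT (ex_intro _ _ b1)).
  apply: aeW => s sT; rewrite scaleN1r addrC.
  by apply: NP; move: sT; rewrite /= in_itv.
by rewrite subr0 -mulrA gtr_pMr// mulrC ltr_pdivrMr// mul1r ltrDl.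
Qed.

Lemma cont_on_reflect (V : normedModType R[i]) (f : R -> V) (T : R) :
  cont_on f 0 T -> cont_on (fun s => f (T - s)) 0 T.
Proof.
move=> cf t e /andP[t0 tT] e0.
have [|d d0 dP] := cf (T - t) e _ e0; first by rewrite subr_ge0 tT lerBlDr lerDl.
exists d => // s /andP[s0 sT] st; apply: dP.
  by rewrite subr_ge0 sT lerBlDr lerDl.
have -> : T - s - (T - t) = t - s by ring.
by rewrite distrC.
Qed.

Lemma within_cont_on (V : normedModType R[i]) (f : R -> V) :
  {within `[0, +oo[%classic, continuous f} -> forall T, cont_on f 0 T.
Proof.
move=> cf T t e /andP[t0 tT] e0.
have /rcvgP/(_ e e0) : f @ within `[0, +oo[ (nbhs t) --> f t.
  by have /subspace_continuousP := cf; apply; rewrite /= in_itv/= t0.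
move=> /nbhs_normP[d/= d0 dP]; exists d => // s /andP[s0 sT] st.
by apply: dP => /=; [rewrite distrC|rewrite in_itv/= s0].
Qed.

Lemma ae_bounded_cont (f : R -> CC R) (T K : R) :
  (forall t, 0 <= t <= T -> cabs (f t) <= K) -> ae_bounded f T K.
Proof. by move=> fK; apply: aeW => t; rewrite /= in_itv/=; exact: fK. Qed.

End Series.

(** * Test functions *)

Section TestFunctions.
Context {R : realType}.
Variable p : @test_function R (CC R).

Definition tfval (k : nat) (t : R) : CC R := tf p k t (1 : R[i]).

(** A functional on the scalars is multiplication by its value at 1. *)
Lemma tfvalE k t (y : CC R) : 0 <= t -> tf p k t y = (y : R[i]) *: tfval k t.
Proof.
move=> t0; have [lp _] := tf_dual p k t0.
by rewrite /tfval -(linZ lp) /GRing.scale/= mulr1.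
Qed.

Lemma tfval_deriv k t : 0 <= t ->
  ((s - t)^-1)%:C *: (tfval k s - tfval k t) @[s --> within `[0, +oo[ t^'] --> tfval k.+1 t.
Proof. by move=> t0; exact: (op_cvg1 (@tf_deriv _ _ p k t t0)). Qed.

Lemma tfval_deriv_eps k t (e : R) : 0 <= t -> 0 < e -> exists2 d : R, 0 < d &
  forall s, 0 <= s -> s != t -> `|s - t| < d ->
    rnorm (((s - t)^-1)%:C *: (tfval k s - tfval k t) - tfval k.+1 t) < e.
Proof.
move=> t0 e0; have /rcvgP/(_ e e0) := @tfval_deriv k t t0.
move=> /nbhs_normP[d/= d0 dP]; exists d => // s s0 st sd.
by apply: dP => //=; [rewrite distrC|rewrite in_itv/= s0].
Qed.

Lemma tfval_diff k T : diff_on (tfval k) (tfval k.+1) 0 T.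
Proof.
move=> t e /andP[t0 tT] e0; have [d d0 dP] := tfval_deriv_eps k t0 e0.
exists d => // s /andP[s0 sT] sd.
have [->|st] := eqVneq s t; first by rewrite !subrr scale0r subr0 rnorm0 normr0 mulr0.
have st0 : s - t != 0 by rewrite subr_eq0.
have -> : tfval k s - tfval k t - (s - t)%:C *: tfval k.+1 t =
    (s - t)%:C *: (((s - t)^-1)%:C *: (tfval k s - tfval k t) - tfval k.+1 t).
  by rewrite scalerBr scalerA -rmorphM/= divff// scale1r.
by rewrite rnormZ cabsR mulrC ler_wpM2r// ltW// dP.
Qed.

(** If a function vanishes after some time, so do its derivatives after any later
    time. *)
Lemma tfval_support : exists2 T : R, 0 < T & forall k t, T <= t -> tfval k t = 0.
Proof.
have [M MP] := tf_support p.
exists (Num.max M 0 + 1); first by rewrite ltr_wpDl// le_max lexx orbT.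
have M0 : 0 <= Num.max M 0 by rewrite le_max lexx orbT.
suff key k : forall t, Num.max M 0 < t -> tfval k t = 0.
  by move=> k t Tt; apply: key; apply: lt_le_trans Tt; rewrite ltrDl.
elim: k => [|k IH] t Mt.
  by apply: MP; [exact/ltW/(le_lt_trans M0)|apply: le_lt_trans Mt; rewrite le_max lexx].
have t0 : 0 <= t by exact/ltW/(le_lt_trans M0).
apply: rnorm_eq0; apply/eqP; rewrite eq_le rnorm_ge0 andbT.
apply/ler_addgt0Pr => e e0; rewrite add0r.
have [d d0 dP] := tfval_deriv_eps k t0 e0.
have d2 : 0 < d / 2 by rewrite divr_gt0.
have := dP (t + d / 2); rewrite addrAC subrr add0r => /(_ _ _ _)/ltW.
rewrite (IH t)// (IH (t + d / 2)); last by rewrite (lt_trans Mt)// ltrDl.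
rewrite subrr scaler0 sub0r rnormN; apply.
- by rewrite addr_ge0// ltW.
- by rewrite -subr_eq0 addrAC subrr add0r gt_eqF.
- by rewrite gtr0_norm// ltr_pdivrMr// mulr_natr mulr2n ltrDl.
Qed.

Lemma bochner_ray (V : normedModType R[i]) (f : R -> V) (T : R) : 0 <= T ->
  bochner_integrable `[0, T] f -> (forall t, T < t -> f t = 0) ->
  bochner `[0, +oo[ f = bochner `[0, T] f.
Proof.
move=> T0 fi f0; apply: bochnerE => //.
apply: (bochner_widen _ _ _ _ (bochnerP fi)) => //.
  by move=> t; rewrite /= !in_itv/= => /andP[->].
move=> t; rewrite /= !in_itv/= andbT => t0 /negP; rewrite t0/= -ltNge; exact: f0.
Qed.

(** Two integrations by parts.  The boundary terms vanish, at 0 because the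
    primitives do and at a late time because the test function does. *)
Lemma test_function_by_parts (f w : R -> CC R) :
  (forall T, 0 <= T -> bochner_integrable `[0, T] f) ->
  (forall T, 0 <= T -> exists2 M : R, 0 <= M & ae_bounded f T M) ->
  (forall t, 0 <= t -> w t = prim (prim f) t) ->
  bochner `[0, +oo[ (fun t => tf p 2 t (w t)) = bochner `[0, +oo[ (fun t => tf p 0 t (f t)).
Proof.
move=> fi fb wE; have [T T0 supp] := tfval_support.
have T0' := ltW T0; have fiT := fi T T0'; have [M M0 fM] := fb T T0'.
have cp k : cont_on (tfval k) 0 T by exact: diff_on_cont (@tfval_diff k T).
have cP := prim_cont M0 fiT fM.
have iP : bochner_integrable `[0, T] (prim f) by exact: bochner_cont.
have [K K0 KP] := cont_on_bounded T0' cP.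
have PK := ae_bounded_cont KP.
have cPP := prim_cont K0 iP PK.
have in_T t : `[0, T]%classic t -> 0 <= t by rewrite /= in_itv/= => /andP[].
have i2 : bochner_integrable `[0, T] (fun t => (tfval 2 t : R[i]) *: prim (prim f) t).
  by apply: bochner_cont => //; exact: cont_onZ (cp 2%N) cPP.
have i0 : bochner_integrable `[0, T] (fun t => (tfval 0 t : R[i]) *: f t).
  by apply: (bochner_prodr fiT) => //; exact: (cp 0%N).
have e2 t : `[0, T]%classic t ->
    (tfval 2 t : R[i]) *: prim (prim f) t = tf p 2 t (w t).
  move=> /in_T t0; rewrite wE// tfvalE//; exact: mulrC.
have e0 t : `[0, T]%classic t -> (tfval 0 t : R[i]) *: f t = tf p 0 t (f t).
  move=> /in_T t0; rewrite tfvalE//; exact: mulrC.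
have b2 := bochner_eq e2 (bochnerP i2).
have b0 := bochner_eq e0 (bochnerP i0).
have mI : measurable `[0, T]%classic by exact: measurable_itv.
rewrite (bochner_ray T0' (ex_intro _ _ b2)); last first.
  move=> t Tt; rewrite tfvalE ?(ltW (lt_trans T0 Tt))// supp ?(ltW Tt)//; exact: mulr0.
rewrite (bochner_ray T0' (ex_intro _ _ b0)); last first.
  move=> t Tt; rewrite tfvalE ?(ltW (lt_trans T0 Tt))// supp ?(ltW Tt)//; exact: mulr0.
rewrite (bochnerE mI b2) (bochnerE mI b0).
have B0 := bochner_by_parts T0' M0 fiT fM (@tfval_diff 0 T) (cp 1%N).
have B1 := bochner_by_parts T0' K0 iP PK (@tfval_diff 1 T) (cp 2%N).
have Z0 : (tfval 0 T : R[i]) *: prim f T = 0.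
  by rewrite (supp 0%N T (lexx _)) scale0r.
have Z1 : (tfval 1 T : R[i]) *: prim (prim f) T = 0.
  by rewrite (supp 1%N T (lexx _)) scale0r.
have drop (x y z : CC R) : x = y - z -> y = 0 -> x = - z by move=> -> ->; rewrite sub0r.
have {}B0 := drop _ _ _ B0 Z0.
have {}B1 := drop _ _ _ B1 Z1.
exact: esym (etrans B0 (etrans (congr1 (fun z : CC R => - z) B1) (opprK _))).
Qed.

End TestFunctions.

(** * Expansion of the observation operator *)

Section Observation.
Context {R : realType} {X : completeNormedModType R[i]}.
Variables (ip : {dot X for Num.conj}) (S : system_node (CC R) X (CC R)).
Variables (phi psi : nat -> X) (lambda : nat -> R[i]).
Hypotheses (hilb : is_hilbert ip) (rs : riesz_spectral S phi lambda)
  (bi : biorthogonal ip phi psi) (neg : forall n, complex.Re (lambda n) < 0).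

Local Notation T := (sn_T S).
Local Notation dom := (sn_dom S).
Local Notation A := (sn_A S).
Local Notation beta := (sn_beta S).
Local Notation emb := (@sn_emb _ _ _ _ S).
Local Notation res := (resolvent dom A beta).
Local Notation co := (rcoord ip psi).
Local Notation b := (bcoef ip S psi lambda).
Local Notation c := (coef_c S phi).

(** By the bound on the observation operator in the graph norm.  Composed with the
    resolvent, the operator may be applied to expansions term by term. *)
Lemma obs_bounded : bounded_op (fun x => sn_C S (res x)).
Proof.
apply/bounded_opP; split.
  move=> a x y; have [lr _] := res_bounded S.
  have [dx _] := resP S x; have [dy _] := resP S y.
  by rewrite lr sn_C_linear.
have [M MP] := sn_C_bounded S.
exists (Num.max M 0) => [|x]; first by rewrite le_max lexx orbT.
have [dx xE] := resP S x; apply: le_trans (MP _ dx) _; rewrite xE.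
by rewrite ler_wpM2r ?rnorm_ge0// le_max lexx.
Qed.

Lemma obs_phi n : sn_C S (res (phi n)) = (beta - lambda n)^-1 *: sn_C S (phi n).
Proof.
have [phi0 dphi _] := rs.2 n; have [d0 _] := dom0 S.
rewrite (res_phi rs).
have C0 : sn_C S 0 = 0.
  have := @sn_C_linear _ _ _ _ S 1 0 0 d0 d0; rewrite scaler0 addr0 scale1r.
  by move=> /eqP; rewrite -subr_eq subrr => /eqP <-.
by have := @sn_C_linear _ _ _ _ S (beta - lambda n)^-1 _ _ dphi d0; rewrite !addr0 C0 addr0.
Qed.

Lemma obs_series x :
  (\sum_(k < N) (co k x : R[i]) *: ((beta - lambda k)^-1 *: sn_C S (phi k)))
    @[N --> \oo] --> sn_C S (res x).
Proof.
have hc : rproj ip phi psi N x @[N --> \oo] --> x by exact: rproj_cvg hilb (rs_basis rs) bi _.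
have h : sn_C S (res (rproj ip phi psi N x)) @[N --> \oo] --> sn_C S (res x).
  exact: bounded_op_cvg obs_bounded hc.
have E N : sn_C S (res (rproj ip phi psi N x)) =
    \sum_(k < N) (co k x : R[i]) *: ((beta - lambda k)^-1 *: sn_C S (phi k)).
  have [lo _] := obs_bounded.
  rewrite /rproj (lin_sum lo); apply: eq_bigr => k _.
  by rewrite (linZ lo) obs_phi.
have -> : (fun N => \sum_(k < N) (co k x : R[i]) *: ((beta - lambda k)^-1 *: sn_C S (phi k)))
   = (fun N => sn_C S (res (rproj ip phi psi N x))) by apply/funext => N; rewrite E.
exact: h.
Qed.

Definition base_point : R[i] := xget 0 (growth_half_plane T).
Local Notation z0 := base_point.

Lemma base_pointP : growth_half_plane T z0.
Proof. by have [z hz] := growth_half_plane_neq0 rs neg; rewrite /base_point; case: xgetP => [w _ //|/(_ z)]. Qed.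

(** The element [zeta] exhibits the state, corrected by the stationary response to the
    input [v], as a value of the resolvent; this places it in the domain of [A],
    where the observation operator has an expansion. *)
Lemma CD_series (x zeta : X) (v : CC R) :
  (forall k, co k zeta = (beta - lambda k) * (co k x - (v : R[i]) * b k / (z0 - lambda k)) :> R[i]) ->
  (\sum_(k < N) (c k * (co k x - (v : R[i]) * b k / (z0 - lambda k)) : R[i]) : CC R)
    @[N --> \oo] --> CD S x v - (v : R[i]) *: sn_G S z0 (1 : R[i]).
Proof.
move=> zE; have hz := base_pointP.
set y := x - ext_resolvent emb (@sn_A1n _ _ _ _ S) z0 (sn_B S v).
have coy k : co k y = co k x - (v : R[i]) * b k / (z0 - lambda k) :> R[i].
  by rewrite (linB (rcoord_linear ip psi k)) (ext_resolvent_coord hilb rs bi).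
have ry : res zeta = y.
  apply: (rcoord_inj hilb (rs_basis rs) bi) => k.
  rewrite coy (co_res hilb rs bi) zE mulrA mulVf ?mul1r//.
  exact: beta_lambda rs _.
have [lG _] := sn_G_bounded hz.
have GE : sn_G S z0 v = (v : R[i]) *: sn_G S z0 (1 : R[i]).
  by rewrite -(linZ lG) -[in LHS](mulr1 (v : R[i])).
have -> : CD S x v - (v : R[i]) *: sn_G S z0 (1 : R[i]) = sn_C S (res zeta).
  by rewrite /CD -/z0 -/y ry GE addrK.
have E N : (\sum_(k < N) (c k * (co k x - (v : R[i]) * b k / (z0 - lambda k)) : R[i]) : CC R) =
   \sum_(k < N) (co k zeta : R[i]) *: ((beta - lambda k)^-1 *: sn_C S (phi k)).
  apply: eq_bigr => k _; rewrite zE scalerA.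
  change (c k * (co k x - (v : R[i]) * b k / (z0 - lambda k)) =
   (beta - lambda k) * (co k x - (v : R[i]) * b k / (z0 - lambda k)) / (beta - lambda k) * c k :> R[i]).
  rewrite [X in _ = X * _]mulrAC mulfV ?mul1r 1?mulrC//.
  exact: beta_lambda rs _.
rewrite (_ : (fun N => _) = (fun N => \sum_(k < N) (co k zeta : R[i]) *: ((beta - lambda k)^-1 *: sn_C S (phi k)))).
  exact: obs_series.
by apply/funext => N; exact: E.
Qed.

End Observation.

(** * Superposition of the scalar modes *)

Section Modes.
Context {R : realType}.

Lemma bochner_sum (V : normedModType R[i]) (D : set R) (d : nat -> R[i])
    (g : nat -> R -> V) (v : nat -> V) N : measurable D ->
  (forall k, is_bochner D (g k) (v k)) ->
  is_bochner D (fun s => \sum_(k < N) d k *: g k s) (\sum_(k < N) d k *: v k).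
Proof.
move=> mD gv; elim: N => [|N IH].
  have b0 := bochner_scale 0 mD (gv 0%N); rewrite scale0r in b0.
  rewrite big_ord0; apply: bochner_eq b0 => t _.
  by rewrite scale0r big_ord0.
rewrite big_ord_recr/= addrC; apply: bochner_eq (bochner_lin (d N) mD (gv N) IH) => t _.
by rewrite big_ord_recr/= addrC.
Qed.

Lemma bochner_weighted_sum (V : normedModType R[i]) (D : set R) (d : nat -> R[i])
    (h : R -> R[i]) (g : nat -> R -> V) (v : nat -> V) N : measurable D ->
  (forall k, is_bochner D (fun s => h s *: g k s) (v k)) ->
  is_bochner D (fun s => h s *: \sum_(k < N) d k *: g k s) (\sum_(k < N) d k *: v k).
Proof.
move=> mD gv; apply: bochner_eq (bochner_sum d N mD gv) => t _.
by rewrite scaler_sumr; apply: eq_bigr => k _; rewrite !scalerA mulrC.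
Qed.

Lemma cont_on_sum (V : normedModType R[i]) (d : nat -> R[i]) (g : nat -> R -> V) (a b : R) N :
  (forall k, cont_on (g k) a b) -> cont_on (fun s => \sum_(k < N) d k *: g k s) a b.
Proof.
move=> cg; elim: N => [|N IH].
  rewrite (_ : (fun _ => _) = cst 0); first exact: cont_on_cst.
  by apply/funext => t; rewrite big_ord0.
rewrite (_ : (fun _ => _) = (fun s => \sum_(k < N) d k *: g k s + (d N : CC R) *: g N s)).
  apply: cont_onD => //; exact: cont_onZ (@cont_on_cst _ (CC R) (d N) a b) (cg N).
by apply/funext => t; rewrite big_ord_recr.
Qed.

Lemma affine_cont (T a b : R) : cont_on (fun s => (T - s)%:C : CC R) a b.
Proof. exact: diff_on_cont (@diff_on_affine _ T a b). Qed.

(** By Cauchy's formula the doubly iterated primitive is a single integral, through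
    which uniform limits pass. *)
Lemma double_prim_series (V : completeNormedModType R[i]) (T : R) (d : nat -> R[i])
    (g : nat -> R -> V) (v : nat -> V) (f : R -> V) : 0 <= T ->
  (forall k, cont_on (g k) 0 T) ->
  (forall k, is_bochner `[0, T] (fun s => (T - s)%:C *: g k s) (v k)) ->
  unif_cvg (fun N s => \sum_(k < N) d k *: g k s) f T ->
  (\sum_(k < N) d k *: v k) @[N --> \oo] --> bochner `[0, T] (fun s => (T - s)%:C *: f s).
Proof.
move=> T0 cg gv gf; have mI : measurable `[0, T]%classic by exact: measurable_itv.
rewrite (_ : (fun N => \sum_(k < N) d k *: v k) =
  (fun N => bochner `[0, T] (fun s => (T - s)%:C *: \sum_(k < N) d k *: g k s))); last first.
  by apply/funext => N; rewrite (bochnerE mI (bochner_weighted_sum d N mI gv)).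
apply: unif_cvg_bochner => // [N|e e0].
  exact: cont_onZ (@affine_cont T 0 T) (@cont_on_sum _ d g 0 T N cg).
have T1 : 0 < T + 1 by rewrite ltr_wpDl.
have [N NP] := gf _ (divr_gt0 e0 T1); exists N => n Nn t tT.
rewrite -scalerBr rnormZ cabsR.
have /andP[t0 tT'] := tT; rewrite ger0_norm ?subr_ge0//.
apply: (@le_trans _ _ (T * (e / (T + 1)))).
  by apply: ler_pM; rewrite ?subr_ge0 ?rnorm_ge0// ?NP// lerBlDr lerDl.
by rewrite mulrCA ler_piMr ?(ltW e0)// ler_pdivrMr// mul1r lerDl.
Qed.

Lemma cvg_eqr (V : normedModType R[i]) (h : nat -> V) (l l' : V) :
  h @ \oo --> l -> l = l' -> h @ \oo --> l'.
Proof. by move=> hl <-. Qed.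

Section Mode.
Variables (u : R -> CC R) (T M : R).
Hypotheses (T0 : 0 <= T) (M0 : 0 <= M).
Hypotheses (ui : bochner_integrable `[0, T] u) (uM : ae_bounded u T M).
Variable l : R[i].
Hypothesis l0 : complex.Re l <= 0.

Local Notation f := (expc l u).

Lemma mode_bounded : ae_bounded f T (M * T).
Proof.
apply: ae_bounded_cont => t /andP[t0 tT].
by apply: le_trans (expc_le M0 ui uM t0 tT l0) _; rewrite ler_wpM2l.
Qed.

Lemma mode_integrable : bochner_integrable `[0, T] f.
Proof. by apply: bochner_cont => //; exact: expc_cont T0 M0 ui uM l. Qed.

Let MT0 : 0 <= M * T. Proof. exact: mulr_ge0. Qed.

(** The differential equation of the mode, integrated twice. *)
Lemma mode_double : l *: prim (prim f) T = prim f T - prim (prim u) T.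
Proof.
have mI : measurable `[0, T]%classic by exact: measurable_itv.
have iP : bochner_integrable `[0, T] (prim u).
  by apply: bochner_cont => //; exact: prim_cont uM.
have iF : bochner_integrable `[0, T] (prim f).
  by apply: bochner_cont => //; exact: prim_cont mode_integrable mode_bounded.
have b1 := bochner_scale l mI (bochnerP iF).
have b2 := bochner_lin (-1) mI (bochnerP iP) (bochnerP mode_integrable).
have E t : `[0, T]%classic t -> l *: prim f t = -1 *: prim u t + f t.
  rewrite /= in_itv/= => /andP[t0 tT].
  have ut := bochner_sub (lexx 0) tT ui; have uMt := ae_boundedS tT uM.
  have e := expc_prim t0 M0 ut uMt l.
  by apply: etrans e _; rewrite scaleN1r addrC.
have b3 := bochner_eq E b1.
have e := bochner_unique mI b3 b2.
by apply: etrans e _; rewrite scaleN1r addrC.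
Qed.

Lemma mode_single : l *: prim f T = f T - prim u T.
Proof. exact: expc_prim T0 M0 ui uM l. Qed.

Lemma mode_double_bochner :
  is_bochner `[0, T] (fun s => (T - s)%:C *: f s) (prim (prim f) T).
Proof.
have e := bochner_double_prim T0 MT0 mode_integrable mode_bounded.
have c := cont_onZ (@affine_cont T 0 T) (expc_cont T0 M0 ui uM l).
by have := bochnerP (bochner_cont T0 c); rewrite e.
Qed.

Lemma prim_bounded (g : R -> CC R) (K : R) : 0 <= K ->
  bochner_integrable `[0, T] g -> ae_bounded g T K -> ae_bounded (prim g) T (K * T).
Proof.
move=> K0 gi gK; apply: ae_bounded_cont => t /andP[t0 tT].
by apply: le_trans (prim_le K0 gi gK t0 tT) _; rewrite ler_wpM2l.
Qed.

Let shift_le (V : normedModType R[i]) (beta : R[i]) (x y z : V) (a b c : R) :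
  l *: x = y - z -> rnorm x <= a -> rnorm y <= b -> rnorm z <= c ->
  rnorm ((beta - l) *: x) <= cabs beta * a + (b + c).
Proof.
move=> e xa yb zc; rewrite scalerBl e.
apply: le_trans (ler_rnormB _ _) _; rewrite rnormZ lerD//.
  by rewrite ler_wpM2l ?rnorm_ge0.
by apply: le_trans (ler_rnormB _ _) _; exact: lerD.
Qed.

(** Integrating a mode trades a factor [l] for a bounded quantity, uniformly in
    [l]: this is the gain of one power of the resolvent that brings integrated
    trajectories into the domain of the observation operator. *)
Lemma mode_double_gain (beta : R[i]) :
  rnorm ((beta - l) *: prim (prim f) T)
    <= cabs beta * (M * T * T * T) + (M * T * T + M * T * T).
Proof.
have iP : bochner_integrable `[0, T] (prim u).
  by apply: bochner_cont => //; exact: prim_cont uM.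
have iF : bochner_integrable `[0, T] (prim f).
  by apply: bochner_cont => //; exact: prim_cont mode_integrable mode_bounded.
apply: shift_le mode_double _ _ _.
- apply: prim_le iF _ _ T0 (lexx _); rewrite ?mulr_ge0//.
  exact: prim_bounded mode_integrable mode_bounded.
- exact: prim_le mode_integrable mode_bounded _ T0 (lexx _).
- apply: prim_le iP _ _ T0 (lexx _); rewrite ?mulr_ge0//.
  exact: prim_bounded ui uM.
Qed.

Lemma mode_single_gain (beta : R[i]) :
  rnorm ((beta - l) *: prim f T) <= cabs beta * (M * T * T) + (M * T + M * T).
Proof.
apply: shift_le mode_single _ _ _.
- exact: prim_le mode_integrable mode_bounded _ T0 (lexx _).
- exact: expc_le T0 (lexx _) l0.
- exact: prim_le ui uM _ T0 (lexx _).
Qed.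

End Mode.

(** The output of the series of modes with weights [d k]; the sum of the weights
    divided by the decay rates is finite, so the series converges uniformly on
    bounded intervals. *)
Section Superposition.
Variables (lambda d : nat -> R[i]) (sigma : R).
Hypothesis neg : forall k, complex.Re (lambda k) < 0.
Hypothesis dsum : (fun N => \sum_(k < N) cabs (d k) / - complex.Re (lambda k)) @ \oo --> sigma.
Variable u : R -> CC R.

Local Notation S N := (\sum_(k < N) cabs (d k) / - complex.Re (lambda k)).
Local Notation FN N s := (\sum_(k < N) d k *: expc (lambda k) u s).

Definition mode_series (s : R) : CC R :=
  xget 0 [set l : CC R | FN N s @[N --> \oo] --> l].

Let a0 k : 0 <= cabs (d k) / - complex.Re (lambda k).
Proof. by rewrite divr_ge0 ?rnorm_ge0// oppr_ge0 ltW. Qed.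

Section Bound.
Variables (T M : R).
Hypotheses (T0 : 0 <= T) (M0 : 0 <= M).
Hypotheses (ui : bochner_integrable `[0, T] u) (uM : ae_bounded u T M).

(** Each term is at most [M] times the corresponding term of the convergent
    majorant, at every time; the tail bound is thus uniform. *)
Lemma mode_series_approx (s : R) N : 0 <= s <= T ->
  rnorm (FN N s - mode_series s) <= M * (sigma - S N).
Proof.
move=> /andP[s0 sT].
have hk k : rnorm (d k *: expc (lambda k) u s) <= M * (cabs (d k) / - complex.Re (lambda k)).
  rewrite rnormZ mulrCA ler_wpM2l ?rnorm_ge0//.
  apply: (expc_le_Re M0 ui uM) => //; exact: neg.
have [l lP] := dominated_series a0 dsum M0 hk.
suff -> : mode_series s = l by exact: lP.
have lim : FN N s @[N --> \oo] --> l.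
  apply: (rcvg_squeeze (g := fun N => M * (sigma - S N))); first exact: nearW lP.
  rewrite -[X in _ --> X](mulr0 M) -[X in M * X](subrr sigma).
  by apply: cvgMr; apply: cvgB => //; exact: cvg_cst.
rewrite /mode_series; case: xgetP => [l' _ /= l'P|/(_ l)//].
exact: rcvg_unique l'P lim.
Qed.

Lemma mode_series_le (s : R) : 0 <= s <= T -> rnorm (mode_series s) <= M * sigma.
Proof.
by move=> sT; have := mode_series_approx 0 sT; rewrite !big_ord0 sub0r rnormN subr0.
Qed.

Let tail_small (K e : R) : 0 <= K -> 0 < e ->
  exists N, forall n, (N <= n)%N -> K * (sigma - S n) <= e.
Proof.
move=> K0 e0; have K1 : 0 < K + 1 by rewrite ltr_wpDl.
have /cvgrPdist_lt/(_ _ (divr_gt0 e0 K1))[N _ NP] := dsum.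
exists N => n Nn; have h : sigma - S n <= e / (K + 1).
  by apply: le_trans (ler_norm _) _; rewrite ltW//; exact: NP.
apply: le_trans (ler_wpM2l K0 h) _.
by rewrite mulrCA ler_piMr ?(ltW e0)// ler_pdivrMr// mul1r lerDl.
Qed.

Let FN_cont N : cont_on (fun s => FN N s) 0 T.
Proof.
have ck k : cont_on (expc (lambda k) u) 0 T by exact: expc_cont T0 M0 ui uM _.
exact: (@cont_on_sum _ d (fun k => expc (lambda k) u) 0 T N ck).
Qed.

Let FN_unif : unif_cvg (fun N s => FN N s) mode_series T.
Proof.
move=> e e0; have [N NP] := tail_small M0 e0; exists N => n Nn t tT.
by apply: le_trans (NP n Nn); exact: mode_series_approx.
Qed.

Lemma mode_series_cont : cont_on mode_series 0 T.
Proof. exact: unif_cvg_cont FN_cont FN_unif. Qed.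

(** The doubly iterated primitives are integrals of uniformly convergent series. *)
Lemma mode_series_double :
  (\sum_(k < N) d k *: prim (prim (expc (lambda k) u)) T) @[N --> \oo]
    --> prim (prim mode_series) T.
Proof.
have mI : measurable `[0, T]%classic by exact: measurable_itv.
have M1 : 0 <= M * sigma.
  by apply: le_trans (rnorm_ge0 _) (mode_series_le (s := 0) _); rewrite lexx.
have iS : bochner_integrable `[0, T] mode_series.
  by apply: bochner_cont => //; exact: mode_series_cont.
have bS : ae_bounded mode_series T (M * sigma) by apply: ae_bounded_cont mode_series_le.
have E := bochner_double_prim T0 M1 iS bS.
have Nre k : complex.Re (lambda k) <= 0 by exact: ltW.
have bk k := mode_double_bochner T0 M0 ui uM (Nre k).
have cg k : cont_on (expc (lambda k) u) 0 T by exact: expc_cont T0 M0 ui uM _.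
exact: cvg_eqr (double_prim_series T0 cg bk FN_unif) E.
Qed.

End Bound.
End Superposition.

End Modes.

(** * Input-output behaviour of the node *)

(** The stationary response to the integrated input cancels the part of the
    double primitive [p] of a mode that one resolvent alone does not control. *)
Lemma stationary_split (F : fieldType) (beta l z p q v : F) :
  l * p = q - v -> z - l != 0 ->
  (beta - l) * ((beta - l) * (p - v / (z - l))) =
    beta * ((beta - l) * p) - (beta - l) * q + v * (z - beta) * ((beta - l) / (z - l)).
Proof.
move=> e zl; have -> : q = l * p + v by rewrite e subrK.
field; exact: zl.
Qed.

Lemma cvg_lin (R : realType) (V : normedModType R[i]) (r : R[i]) (g h : nat -> V) (a b : V) :
  g @ \oo --> a -> h @ \oo --> b -> r *: g n + h n @[n --> \oo] --> r *: a + b.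
Proof. by move=> ga hb; apply: cvgD => //; exact: cvgZr. Qed.

Section Output.
Context {R : realType} {X : completeNormedModType R[i]}.
Variables (ip : {dot X for Num.conj}) (S : system_node (CC R) X (CC R)).
Variables (phi psi : nat -> X) (lambda : nat -> R[i]).
Hypotheses (hilb : is_hilbert ip) (rs : riesz_spectral S phi lambda)
  (bi : biorthogonal ip phi psi) (neg : forall n, complex.Re (lambda n) < 0).

Local Notation beta := (sn_beta S).
Local Notation co := (rcoord ip psi).
Local Notation ecoord := (ecoord ip psi lambda).
Local Notation W := (sn_X1n S).
Local Notation T1 := (sn_T1n S).
Local Notation B := (@sn_B _ _ _ _ S).
Local Notation b := (bcoef ip S psi lambda).
Local Notation c := (coef_c S phi).
Local Notation z0 := (base_point S).

Variables (u : R -> CC R) (x : R -> W).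
Hypotheses (ui : forall t, 0 <= t -> bochner_integrable `[0, t] u)
  (ub : forall t, 0 <= t -> exists2 M : R, 0 <= M & ae_bounded u t M)
  (xc : forall t, cont_on x 0 t)
  (xE : forall t, 0 <= t -> x t = bochner `[0, t] (fun s => T1 (t - s) (B (u s)))).

(** A coordinate functional may be taken under the integral, and turns the semigroup
    into an exponential. *)
Lemma state_mode k t : 0 <= t -> ecoord k (x t) = b k *: expc (lambda k) u t.
Proof.
move=> t0; have mI : measurable `[0, t]%classic by exact: measurable_itv.
have [lB _] := sn_B_bounded S; have [lc _] := ecoord_bounded S psi lambda hilb k.
have i1 : bochner_integrable `[0, t] (fun s => (u s : R[i]) *: T1 (t - s) (B (1 : R[i]))).
  apply: bochner_prod (ui t0) _ => //.
  have cT : cont_on (fun s => T1 s (B (1 : R[i]))) 0 t by exact: sg_cont.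
  exact: (cont_on_reflect cT).
have E1 s : `[0, t]%classic s -> (u s : R[i]) *: T1 (t - s) (B (1 : R[i])) = T1 (t - s) (B (u s)).
  rewrite /= in_itv/= => /andP[s0 st]; have ts : 0 <= t - s by rewrite subr_ge0.
  rewrite -(linZ (sg_linear T1 ts)) -(linZ lB); congr (T1 _ (B _)).
  exact: (mulr1 (u s : R[i])).
have b1 := bochnerP i1.
have bx : is_bochner `[0, t] (fun s => (u s : R[i]) *: T1 (t - s) (B (1 : R[i]))) (x t).
  have ex := etrans (xE t0) (bochnerE mI (bochner_eq E1 b1)).
  by rewrite ex.
have bk := bochner_bounded_op mI (ecoord_bounded S psi lambda hilb k) bx.
have ie : bochner_integrable `[0, t] (fun s => cexp ((t - s)%:C * lambda k) *: u s).
  by apply: (bochner_prodr (ui t0)) => //; exact: cexp_conv_cont.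
have be := bochner_scale (b k) mI (bochnerP ie).
have E2 s : `[0, t]%classic s -> (ecoord k \o (fun s => (u s : R[i]) *: T1 (t - s) (B (1 : R[i])))) s
    = b k *: (cexp ((t - s)%:C * lambda k) *: u s).
  rewrite /= in_itv/= => /andP[s0 st]; have ts : 0 <= t - s by rewrite subr_ge0.
  rewrite (linZ lc) (ecoord_T hilb rs bi)//.
  change ((u s : R[i]) * (cexp ((t - s)%:C * lambda k) * b k) =
    b k * (cexp ((t - s)%:C * lambda k) * (u s : R[i])) :> R[i]); ring.
exact: bochner_unique mI (bochner_eq E2 bk) be.
Qed.

Local Notation xx t := (bochner `[0, t] (fun s => (t - s)%:C *: x s)).
Local Notation uu t := (bochner `[0, t] (fun s => (t - s)%:C *: u s)).

Lemma integrated_state_mode k t : 0 <= t ->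
  ecoord k (xx t) = b k *: prim (prim (expc (lambda k) u)) t.
Proof.
move=> t0; have mI : measurable `[0, t]%classic by exact: measurable_itv.
have [lc _] := ecoord_bounded S psi lambda hilb k.
have cx := bochner_cont t0 (cont_onZ (@affine_cont _ t 0 t) (@xc t)).
have bk := bochner_bounded_op mI (ecoord_bounded S psi lambda hilb k) (bochnerP cx).
have [M M0 uM] := ub t0; have nk : complex.Re (lambda k) <= 0 by exact: ltW.
have be := bochner_scale (b k) mI (mode_double_bochner t0 M0 (ui t0) uM nk).
have E s : `[0, t]%classic s -> b k *: ((t - s)%:C *: expc (lambda k) u s)
   = (ecoord k \o (fun s => (t - s)%:C *: x s)) s.
  rewrite /= in_itv/= => /andP[s0 st].
  by rewrite (linZ lc) state_mode// !scalerA mulrC.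
exact: bochner_unique mI bk (bochner_eq E be).
Qed.

Variable sigma : R.
Hypothesis dsum :
  (fun N => \sum_(k < N) cabs (c k * b k) / - complex.Re (lambda k)) @ \oo --> sigma.

(** The gap between the point and the spectrum dominates the real parts of the
    eigenvalues. *)
Lemma transfer_series :
  exists s : CC R, (\sum_(k < N) (c k * b k / (z0 - lambda k) : R[i]) : CC R) @[N --> \oo] --> s.
Proof.
have [K K0 KP] := gap_bound rs (base_pointP rs neg).
have a0 k : 0 <= cabs (c k * b k) / - complex.Re (lambda k).
  by rewrite divr_ge0 ?rnorm_ge0// oppr_ge0 ltW.
have hk k : rnorm (c k * b k / (z0 - lambda k) : CC R)
    <= K * (cabs (c k * b k) / - complex.Re (lambda k)).
  have [zk _ h] := KP k; have zk0 : 0 < cabs (z0 - lambda k) by rewrite cabs_gt0.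
  have r0 : 0 < - complex.Re (lambda k) by rewrite oppr_gt0.
  rewrite -[rnorm _]/(cabs (c k * b k / (z0 - lambda k))) cabsM cabsV.
  rewrite [leRHS]mulrCA ler_wpM2l ?rnorm_ge0//.
  rewrite ler_pdivlMr// mulrC ler_pdivrMr//.
  by move: h; rewrite ltr0_norm.
have [l lP] := dominated_series a0 dsum (ltW K0) hk.
exists l; apply: (rcvg_squeeze (g := fun N => K * (sigma -
  \sum_(k < N) cabs (c k * b k) / - complex.Re (lambda k)))); first exact: nearW lP.
rewrite -[X in _ --> X](mulr0 K) -[X in K * X](subrr sigma).
by apply: cvgMr; apply: cvgB => //; exact: cvg_cst.
Qed.

Local Notation P k t := (prim (prim (expc (lambda k) u)) t).
Local Notation Q k t := (prim (expc (lambda k) u) t).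
Local Notation V t := (prim (prim u) t).

(** Twice integrated, the state lies in [X], and the state minus the stationary
    response to the integrated input lies in the domain of [A]: dividing by
    [b k / (beta - lambda k)], which is square summable, leaves coordinates
    bounded uniformly in [k]. *)
Lemma integrated_state t : 0 <= t ->
  exists x0 zeta : X, [/\ of_X1n (xx t) = x0,
    forall k, co k x0 = b k * P k t :> R[i] &
    forall k, co k zeta =
      (beta - lambda k) * (co k x0 - (V t : R[i]) * b k / (z0 - lambda k)) :> R[i]].
Proof.
move=> t0; have [M M0 uM] := ub t0; have nk k : complex.Re (lambda k) <= 0 by exact: ltW.
have gP k := mode_double_gain t0 M0 (ui t0) uM (nk k) beta.
have gQ k := mode_single_gain t0 M0 (ui t0) uM (nk k) beta.
have eP k : lambda k * P k t = Q k t - V t :> R[i].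
  have e := mode_double t0 M0 (ui t0) uM (nk k).
  change (lambda k *: P k t = Q k t - V t :> CC R).
  exact: e.
move: gP gQ; set KP := _ + _; set KQ := _ + _ => gP gQ.
have {}gP k : cabs ((beta - lambda k) * P k t) <= KP by exact: gP.
have {}gQ k : cabs ((beta - lambda k) * Q k t) <= KQ by exact: gQ.
have bl k : beta - lambda k != 0 by exact: beta_lambda rs k.
have weight (a : nat -> R[i]) (C : R) k : cabs ((beta - lambda k) * a k) <= C ->
    cabs (b k * a k) <= C * cabs (b k / (beta - lambda k)).
  move=> h; have -> : b k * a k = (beta - lambda k) * a k * (b k / (beta - lambda k)).
    by move: (bl k); move: (beta - lambda k) (b k) (a k) => g y z g0; field.
  by rewrite cabsM ler_wpM2r ?rnorm_ge0.
have [x0 x0E] := @weighted_coordinates _ _ _ _ _ _ _ hilb rs bi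
  (fun k => b k * P k t) KP (fun k => weight (fun k => P k t) KP k (gP k)).
have [K K0 gap] := gap_bound rs (base_pointP rs neg).
pose a k : R[i] := (beta - lambda k) * (P k t - (V t : R[i]) / (z0 - lambda k)).
have aE k : (beta - lambda k) * a k = beta * ((beta - lambda k) * P k t)
    - (beta - lambda k) * Q k t
    + (V t : R[i]) * (z0 - beta) * ((beta - lambda k) / (z0 - lambda k)).
  by have [zk _ _] := gap k; exact: stationary_split (eP k) zk.
have aK k : cabs ((beta - lambda k) * a k) <=
    cabs beta * KP + KQ + cabs ((V t : R[i]) * (z0 - beta)) * K.
  have [zk h _] := gap k; have zk0 : 0 < cabs (z0 - lambda k) by rewrite cabs_gt0.
  rewrite aE.
  have h1 : cabs (beta * ((beta - lambda k) * P k t)) <= cabs beta * KP.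
    by rewrite cabsM ler_wpM2l ?rnorm_ge0// gP.
  have h2 : cabs ((V t : R[i]) * (z0 - beta) * ((beta - lambda k) / (z0 - lambda k)))
      <= cabs ((V t : R[i]) * (z0 - beta)) * K.
    by rewrite cabsM ler_wpM2l ?rnorm_ge0// cabsM cabsV ler_pdivrMr.
  have h3 := le_trans (@ler_rnormB _ (CC R) _ _) (lerD h1 (gQ k)).
  exact: le_trans (@ler_rnormD _ (CC R) _ _) (lerD h3 h2).
have [zeta zE] := @weighted_coordinates _ _ _ _ _ _ _ hilb rs bi
  (fun k => b k * a k) _ (fun k => weight a _ k (aK k)).
exists x0, zeta; split => [|k|k].
- apply: (of_X1nE hilb rs bi) => k; rewrite integrated_state_mode//.
- exact: x0E.
- rewrite zE x0E /a.
  have alg (F : fieldType) (y g p v w : F) :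
    y * (g * (p - v / w)) = g * (y * p - v * y / w) by ring.
  exact: alg.
Qed.

Variable tau : CC R.
Hypothesis tauP :
  (\sum_(k < N) (c k * b k / (z0 - lambda k) : R[i]) : CC R) @[N --> \oo] --> tau.

(** The expansion of the output of the integrated state splits into the integrated
    series of modes and a multiple of the integrated input.  The factor does not
    depend on time: it is the part of the transfer function at the chosen point which
    the series of modes leaves over. *)
Lemma integrated_output t : 0 <= t ->
  CD S (of_X1n (xx t)) (uu t) =
    prim (prim (mode_series lambda (fun k => c k * b k) u)) t
    + (sn_G S z0 (1 : R[i]) - tau : R[i]) *: V t.
Proof.
move=> t0; have [M M0 uM] := ub t0; have [x0 [zeta [x0P x0E zE]]] := integrated_state t0.
have eu := bochner_double_prim t0 M0 (ui t0) uM.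
have h1 := CD_series hilb rs bi neg zE.
have h2 := @mode_series_double _ lambda (fun k => c k * b k) sigma neg dsum u t M t0 M0 (ui t0) uM.
have h3 := @cvg_lin R (CC R) (- (V t : R[i])) _ _ _ _ tauP h2.
have E : (fun N => (\sum_(k < N) (c k * (co k x0 - (V t : R[i]) * b k / (z0 - lambda k)) : R[i]) : CC R))
  = (fun N => - (V t : R[i]) *: (\sum_(k < N) (c k * b k / (z0 - lambda k) : R[i]) : CC R)
       + \sum_(k < N) (c k * b k) *: P k t).
  apply/funext => N; rewrite scaler_sumr -big_split/=; apply: eq_bigr => k _.
  rewrite x0E.
  have alg (F : fieldType) (y g p v w : F) :
    g * (y * p - v * y / w) = - v * (g * y / w) + g * y * p by ring.
  exact: alg.
rewrite -E in h3.
have h4 := rcvg_unique h1 h3.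
rewrite x0P eu.
have alg (Z : lmodType R[i]) (v : R[i]) (w a g q : Z) : a - v *: g = - v *: q + w -> a = w + v *: (g - q).
  move=> /eqP; rewrite subr_eq => /eqP ->; rewrite scalerBr scaleNr.
  by rewrite [- _ + w]addrC -addrA [- _ + _]addrC.
have h5 := alg (CC R) (V t : R[i]) _ _ _ _ (h4 _).
rewrite h5; congr (_ + _); exact: mulrC.
Qed.

End Output.

(** * Essential bounds and the stability estimate *)

Section EssentialBounds.
Context {R : realType}.
Local Notation mu := (@lebesgue_measure R).

Lemma Linfty_norm_ge0 (V : normedModType R[i]) (t : R) (f : R -> V) : (0 <= Linfty_norm t f)%E.
Proof.
apply: ess_sup_gee.
  apply: (@lt_le_trans _ _ (mu `[0, 1]%classic)).
    by rewrite lebesgue_measure_itv/= lte_fin ltr01 sube0 lte_fin ltr01.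
  by apply: le_measure; rewrite ?inE//; exact: measurableT.
by apply: aeW => s; rewrite lee_fin mulr_ge0 ?rnorm_ge0// indicE.
Qed.

Lemma Linfty_ae_bounded (V : normedModType R[i]) (t : R) (f : R -> V) :
  (Linfty_norm t f < +oo)%E -> exists M : R, [/\ 0 <= M, Linfty_norm t f = M%:E & ae_bounded f t M].
Proof.
move=> foo; have f0 := Linfty_norm_ge0 t f.
have fE : Linfty_norm t f = (fine (Linfty_norm t f))%:E by rewrite fineK// ge0_fin_numE.
exists (fine (Linfty_norm t f)); split => //; first exact: fine_ge0.
have := ess_sup_ge mu (fun s => (\1_(`[0, t]%classic) s * rnorm (f s))%:E).
rewrite -/(Linfty_norm t f) fE; apply: ae_imply => s + ts; rewrite lee_fin indicE.
by rewrite mem_set// mul1r.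
Qed.

Lemma Linfty_norm_le (V : normedModType R[i]) (t K : R) (f : R -> V) : 0 <= K ->
  ae_bounded f t K -> (Linfty_norm t f <= K%:E)%E.
Proof.
move=> K0 fK; apply/ess_supP; move: fK; apply: ae_imply => s fs.
rewrite lee_fin indicE; have [st|st] := pselect (`[0, t]%classic s).
  by rewrite mem_set// mul1r fs.
by rewrite memNset// mul0r.
Qed.

Lemma ae_imply2 (P Q A : R -> Prop) : (forall t, P t -> Q t -> A t) ->
  (\forall t \ae mu, P t) -> (\forall t \ae mu, Q t) -> \forall t \ae mu, A t.
Proof. by move=> PQA hP hQ; exact: (@filterS2 _ _ (ae_filter_ringOfSetsType mu) _ _ _ PQA hP hQ). Qed.

Lemma Linfty_loc_bounded (u : R -> CC R) t : Linfty_loc u -> 0 <= t ->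
  exists2 M : R, 0 <= M & ae_bounded u t M.
Proof.
move=> ul t0; have t1 : 0 < t + 1 by rewrite ltr_wpDl.
have [_ /Linfty_ae_bounded[M [M0 _ uM]]] := ul _ t1.
by exists M => //; apply: ae_boundedS uM; rewrite lerDl.
Qed.

Lemma L1_loc_integrable (u : R -> CC R) t : L1_loc u -> 0 <= t ->
  bochner_integrable `[0, t] u.
Proof.
move=> u1; rewrite le_eqVlt => /orP[/eqP <-|]; last exact: u1.
by exists 0; exact: bochner_itv1.
Qed.

End EssentialBounds.

Section PrimLinear.
Context {R : realType}.

Lemma prim_lin (D : R[i]) (f u : R -> CC R) (t : R) :
  bochner_integrable `[0, t] u -> bochner_integrable `[0, t] f ->
  prim (fun s => D *: u s + f s) t = D *: prim u t + prim f t.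
Proof.
move=> ui fi; have mI : measurable `[0, t]%classic by exact: measurable_itv.
exact: bochnerE mI (bochner_lin D mI (bochnerP ui) (bochnerP fi)).
Qed.

Lemma prim_double_lin (D : R[i]) (f u : R -> CC R) (t M N : R) : 0 <= t -> 0 <= M -> 0 <= N ->
  bochner_integrable `[0, t] u -> ae_bounded u t M ->
  bochner_integrable `[0, t] f -> ae_bounded f t N ->
  prim (prim (fun s => D *: u s + f s)) t = D *: prim (prim u) t + prim (prim f) t.
Proof.
move=> t0 M0 N0 ui uM fi fN; have mI : measurable `[0, t]%classic by exact: measurable_itv.
have iu : bochner_integrable `[0, t] (prim u).
  by apply: bochner_cont => //; exact: prim_cont uM.
have i_f : bochner_integrable `[0, t] (prim f).
  by apply: bochner_cont => //; exact: prim_cont fN.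
have E s : `[0, t]%classic s ->
    D *: prim u s + prim f s = prim (fun s => D *: u s + f s) s.
  rewrite /= in_itv/= => /andP[s0 st].
  have us := bochner_sub (lexx 0) st ui; have fs := bochner_sub (lexx 0) st fi.
  exact: esym (prim_lin D us fs).
have bl := bochner_lin D mI (bochnerP iu) (bochnerP i_f).
exact: bochnerE mI (bochner_eq E bl).
Qed.

End PrimLinear.

Lemma summable_partial_sums (R : realType) (a : nat -> R) : (forall k, 0 <= a k) ->
  (\sum_(0 <= k <oo) (a k)%:E < +oo)%E ->
  exists2 sigma : R, 0 <= sigma & (fun N => \sum_(k < N) a k) @ \oo --> sigma.
Proof.
move=> a0 afin; set s := (\sum_(0 <= k <oo) _)%E in afin.
have s0 : (0 <= s)%E by apply: nneseries_ge0 => k _ _; rewrite lee_fin.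
have sE : s = (fine s)%:E by rewrite fineK// ge0_fin_numE.
have le N : \sum_(k < N) a k <= fine s.
  rewrite -lee_fin -sE -(big_mkord xpredT a) -sumEFin.
  by apply: nneseries_lim_ge => k _ _; rewrite lee_fin.
have nd : nondecreasing_seq (fun N => \sum_(k < N) a k).
  by apply/nondecreasing_seqP => n; rewrite big_ord_recr/= lerDl.
have cs : cvgn (fun N => \sum_(k < N) a k).
  by apply: nondecreasing_is_cvgn => //; exists (fine s) => _ [N _ <-].
exists (limn (fun N => \sum_(k < N) a k)) => //.
by have := nondecreasing_cvgn_le nd cs 0%N; rewrite big_ord0.
Qed.

Theorem proposition4p1 (R : realType) (X : completeNormedModType R[i])
    (ip : {dot X for Num.conj}) (S : system_node (CC R) X (CC R))
    (phi psi : nat -> X) (lambda : nat -> R[i]) :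
  is_hilbert ip ->
  riesz_spectral S phi lambda ->
  biorthogonal ip phi psi ->
  (forall n, complex.Re (lambda n) < 0) ->
  (\sum_(0 <= k <oo)
     (rnorm (coef_b S ip psi k * (coef_c S phi k)^*
             / (complex.Re (lambda k))%:C : CC R))%:E < +oo)%E ->
  Linfty_BIBO_stable S.
Proof.
move=> hilb rs bi neg sum_fin.
pose b := bcoef ip S psi lambda; pose c := coef_c S phi; pose d k := c k * b k.
pose a k := cabs (d k) / - complex.Re (lambda k).
have a0 k : 0 <= a k by rewrite divr_ge0 ?rnorm_ge0// oppr_ge0 ltW.
have aE k : rnorm (coef_b S ip psi k * (coef_c S phi k)^* / (complex.Re (lambda k))%:C : CC R)
    = a k.
  rewrite (coef_bE hilb rs bi) -[LHS]/(cabs (b k * (c k)^* / (complex.Re (lambda k))%:C)).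
  by rewrite cabsM cabsV cabsR ltr0_norm// cabsM cabs_conj /a /d cabsM [_ * cabs (b k)]mulrC.
have [sigma sigma0 dsum] : exists2 sigma : R, 0 <= sigma &
    (fun N => \sum_(k < N) a k) @ \oo --> sigma.
  apply: summable_partial_sums => //; apply: le_lt_trans sum_fin.
  by apply: lee_nneseries => k _; rewrite lee_fin ?aE ?a0.
have [tau tauP] := transfer_series rs neg dsum.
(* the part of the transfer function at the base point which the modes leave *)
pose D : R[i] := sn_G S (base_point S) (1 : R[i]) - tau.
have D0 : 0 <= cabs D by exact: rnorm_ge0.
(* the summand 1 only makes the constant positive *)
exists (sigma + cabs D + 1); first by rewrite ltr_wpDl ?addr_ge0.
move=> u x y [u1 xcont [x0 xE] yE] ul x00.
have ui t : 0 <= t -> bochner_integrable `[0, t] u by exact: L1_loc_integrable u1.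
have ub t : 0 <= t -> exists2 M : R, 0 <= M & ae_bounded u t M.
  exact: Linfty_loc_bounded ul.
have xc := within_cont_on xcont.
(* the initial state vanishes, as the integral over a point does *)
have ex0 : @sn_emb _ _ _ _ S x0 = 0.
  have h := xE 0 (lexx 0); rewrite x00 sg0 in h.
  by rewrite h (bochnerE (measurable_itv _) (bochner_itv1 _ 0)) addr0.
have {}xE t : 0 <= t -> x t = bochner `[0, t] (fun s => sn_T1n S (t - s) (sn_B S (u s))).
  by move=> t0; rewrite xE// ex0 (lin0 (sg_linear (sn_T1n S) t0)) add0r.
pose F := mode_series lambda d u.
pose out s : CC R := D *: u s + F s.
have cF t M : 0 <= t -> 0 <= M -> ae_bounded u t M -> cont_on F 0 t.
  move=> t0 M0 uM; exact: (@mode_series_cont _ _ d sigma neg dsum u t M t0 M0 (ui t t0) uM).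
have FM t M : 0 <= t -> 0 <= M -> ae_bounded u t M -> ae_bounded F t (M * sigma).
  move=> t0 M0 uM; apply: ae_bounded_cont => s st.
  exact: (@mode_series_le _ _ d sigma neg dsum u t M M0 (ui t t0) uM s st).
have outM t M : 0 <= t -> 0 <= M -> ae_bounded u t M ->
    ae_bounded out t ((sigma + cabs D + 1) * M).
  move=> t0 M0 uM; apply: ae_imply2 (FM t M t0 M0 uM) uM => s Fs us st.
  apply: le_trans (ler_rnormD _ _) _; rewrite rnormZ.
  have h1 := Fs st; have h2 := ler_wpM2l D0 (us st).
  have h3 := lerD h2 h1; apply: le_trans h3 _.
  rewrite 2!mulrDl mul1r [M * sigma]mulrC addrC -addrA lerD2l lerDl.
  exact: M0.
have outi t : 0 <= t -> bochner_integrable `[0, t] out.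
  move=> t0; have [M M0 uM] := ub t t0.
  have iF := bochner_cont t0 (cF t M t0 M0 uM).
  have mI : measurable `[0, t]%classic by exact: measurable_itv.
  by exists (D *: bochner `[0, t] u + bochner `[0, t] F); exact: bochner_lin mI (bochnerP (ui t t0)) (bochnerP iF).
exists out; split.
- move=> t t0; split.
    have [v bv] := outi t (ltW t0); exact: bochner_sm bv.
  have [M M0 uM] := ub t (ltW t0).
  apply: le_lt_trans (Linfty_norm_le _ (outM t M (ltW t0) M0 uM)) (ltry _).
  by rewrite mulr_ge0// !addr_ge0.
- move=> p; rewrite yE /regular_distribution.
  apply: test_function_by_parts => // t t0; have [M M0 uM] := ub t t0.
    exists ((sigma + cabs D + 1) * M); first by rewrite mulr_ge0// !addr_ge0.
    exact: outM.
  have e1 := @integrated_output _ _ _ _ _ _ _ hilb rs bi neg u x ui ub xc xE sigma dsum tau tauP t t0.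
  have iF := bochner_cont t0 (cF t M t0 M0 uM).
  have e2 := prim_double_lin D t0 M0 (mulr_ge0 M0 sigma0) (ui t t0) uM iF (FM t M t0 M0 uM).
  rewrite e1 -/D -/F; apply: esym; apply: etrans e2 _.
  exact: addrC.
- move=> t t0; have [_ /Linfty_ae_bounded[M [M0 -> uM]]] := ul t t0.
  rewrite -EFinM; apply: Linfty_norm_le; last exact: outM (ltW t0) M0 uM.
  by rewrite mulr_ge0// !addr_ge0.
Qed.
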